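(* Let $f:\Delta\to\Delta$ be a nonmixing Young tower over a uniformly expanding full-branch map $F:Y\to Y$ (reference probability measure $m$, not assumed invariant, constants $\lambda,K,\eta$) with return time $\tau:Y\to\mathbb{Z}^+$, period $d\ge2$ and associated data $\{I_k\}$, $\delta$, and let $L$ be the transfer operator of $f$ with respect to $m_\Delta$, all as described in the context. Let $\phi:\Delta\to\mathbb{R}$ satisfy $\|\phi\|_\eta<\infty$ and $\int_\Delta\phi\,dm_\Delta=0$. (1) Suppose that $m(\tau\ge n)\le C_\tau n^{-\beta}$ for some $\beta>1$ and all $n>0$. Then there exists a constant $C>0$ depending continuously on $\lambda$, $K$, $\eta$, $\max\{I_k\}$, $\delta$, $\beta$ and $C_\tau$ such that for all $n\ge1$ $$\int_\Delta\Bigl|\sum_{k=0}^{d-1}L^{nd+k}\phi\Bigr|\,dm_\Delta\le C\|\phi\|_\eta\, n^{-(\beta-1)}.$$ (2) Suppose that $m(\tau\ge n)\le C_\tau e^{-An^\gamma}$ for some $A>0$, $0<\gamma\le1$ and all $n>0$. Then there exist constants $B>0$ and $C>0$ depending continuously on $\lambda$, $K$, $\eta$, $\max\{I_k\}$, $\delta$, $A$, $\gamma$ and $C_\tau$ such that for all $n\ge0$ $$\int_\Delta\Bigl|\sum_{k=0}^{d-1}L^{nd+k}\phi\Bigr|\,dm_\Delta\le C\|\phi\|_\eta\, e^{-Bn^\gamma}.$$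
   Context: Uniformly expanding maps. $(Y,m)$ is a probability space, $F:Y\to Y$ is a nonsingular transformation, and $d_Y$ is a metric on $Y$ with $\operatorname{diam}Y\le 1$. $\alpha$ is an at most countable measurable partition of $Y$ such that $F$ restricts to a measure-theoretic bijection from $a$ onto $Y$ for each $a\in\alpha$. Let $\zeta=\frac{dm}{dm\circ F}$ be the inverse Jacobian of $F$ with respect to $m$. There are constants $\lambda>1$, $K>0$, $\eta\in(0,1]$ such that for all $x,y$ in the same partition element, $d_Y(Fx,Fy)\ge\lambda d_Y(x,y)$ and $|\log\zeta(x)-\log\zeta(y)|\le K d_Y(Fx,Fy)^\eta$. The measure $m$ is not assumed $F$-invariant. Young tower. $\tau:Y\to\mathbb{Z}^+$ is an $m$-integrable function constant on elements of $\alpha$. $\Delta=\{(y,\ell)\in Y\times\mathbb{Z}:0\le\ell\le\tau(y)-1\}$ and $f:\Delta\to\Delta$ is $f(y,\ell)=(y,\ell+1)$ if $\ell\le\tau(y)-2$, $f(y,\ell)=(Fy,0)$ if $\ell=\tau(y)-1$. Let $\bar\tau=\int_Y\tau\,dm$. $m_\Delta$ is the probability measure on $\Delta$ with $m_\Delta(A\times\{\ell\})=\bar\tau^{-1}m(A)$ for all $\ell\ge0$ and measurable $A\subset\{y:\tau(y)\ge\ell+1\}$. The metric on $\Delta$ is $d_\Delta((y,\ell),(y',\ell'))=1$ if $\ell\ne\ell'$ and $=d_Y(y,y')$ if $\ell=\ell'$. For $\phi:\Delta\to\mathbb{R}$, $|\phi|_\eta=\sup_{x\ne y}|\phi(x)-\phi(y)|/d_\Delta(x,y)^\eta$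 and $\|\phi\|_\eta=|\phi|_\eta+|\phi|_\infty$. Transfer operator. $L:L^1(\Delta)\to L^1(\Delta)$ is defined by $\int_\Delta L\phi\,\psi\,dm_\Delta=\int_\Delta\phi\,\psi\circ f\,dm_\Delta$ for $\phi\in L^1$, $\psi\in L^\infty$. Nonmixing case. The tower is called nonmixing if $\gcd\{\tau(a):a\in\alpha\}\neq1$. In that case set $d=\gcd\{j\ge1:m(\{y\in Y:\tau(y)=j\})>0\}\ge2$. There exist $\delta>0$ and a finite set of positive integers $\{I_k\}$ with $\gcd\{I_k\}=d$ such that $m(\{y\in Y:\tau(y)=I_k\})\ge\delta$ for every $k$; fix such data. ''Constants depending continuously on parameters'' means that they can be given by continuous functions of those parameters, the same functions for all systems and observables with those parameters. *)

(* Defs.v *)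
From HB Require Import structures.
From mathcomp Require Import all_boot all_order all_algebra.
From mathcomp Require Import all_classical all_reals all_analysis.

Set Implicit Arguments.
Unset Strict Implicit.
Unset Printing Implicit Defensive.

Import Order.TTheory GRing.Theory Num.Theory.
Import numFieldNormedType.Exports.

Local Open Scope classical_set_scope.
Local Open Scope ring_scope.

Definition is_metric (R : realType) (Y : Type) (dY : Y -> Y -> R) : Prop :=
  [/\ forall x y, 0 <= dY x y,
      forall x y, dY x y = 0 <-> x = y,
      forall x y, dY x y = dY y x &
      forall x y z, dY x z <= dY x y + dY y z].

Definition is_gcd (S : set nat) (g : nat) : Prop :=
  (forall j, S j -> (g %| j)%N) /\
  (forall e, (forall j, S j -> (e %| j)%N) -> (e %| g)%N).

Section expanding_map.
Context (R : realType) (dsp : measure_display) (Y : measurableType dsp).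
Variables (m : probability Y R) (F : Y -> Y).
Local Open Scope ereal_scope.

Definition nonsingular : Prop :=
  measurable_fun setT F /\
  forall N, measurable N -> m (F @^-1` N) = 0 <-> m N = 0.

(* [a0] is a full-measure part of [a] on which [F] is injective, with
   measurable inverse, and whose image is a full-measure subset of [Y]. *)
Definition bijective_part (a a0 : set Y) : Prop :=
  [/\ measurable a0, a0 `<=` a /\ m (a `\` a0) = 0,
      set_inj a0 F,
      forall E, measurable E -> E `<=` a0 -> measurable (F @` E) &
      m (~` (F @` a0)) = 0].

(* Bijection from [a] onto [Y] up to null sets. *)
Definition mt_bijection (a : set Y) : Prop := exists a0, bijective_part a a0.

(* [nu] is the measure m o F, that is E |-> m (F E) for E inside a partition
   element; the image is only meaningful (measurable) for E inside the part of
   the element on which F is a bijection. *)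
Definition is_m_comp_F (alpha : set (set Y)) (nu : {measure set Y -> \bar R}) :=
  forall a a0, alpha a -> bijective_part a a0 ->
  forall E, measurable E -> E `<=` a0 -> nu E = m (F @` E).

(* zeta = dm / d(m o F) *)
Definition inverse_jacobian (alpha : set (set Y)) (zeta : Y -> R) : Prop :=
  [/\ measurable_fun setT zeta, forall y, (0 < zeta y)%R &
      exists2 nu : {measure set Y -> \bar R}, is_m_comp_F alpha nu &
        forall E, measurable E -> m E = \int[nu]_(y in E) (zeta y)%:E].

Record uniformly_expanding (dY : Y -> Y -> R) (alpha : set (set Y))
    (zeta : Y -> R) (lambda K eta : R) : Prop := {
  ue_nonsingular : nonsingular ;
  ue_metric : is_metric dY ;
  ue_diam : forall x y, (dY x y <= 1)%R ;
  ue_countable : countable alpha ;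
  ue_measurable : forall a, alpha a -> measurable a ;
  ue_partition : partition alpha id [set: Y] ;
  ue_bijection : forall a, alpha a -> mt_bijection a ;
  ue_jacobian : inverse_jacobian alpha zeta ;
  ue_lambda : (1 < lambda)%R ;
  ue_K : (0 < K)%R ;
  ue_eta : (0 < eta <= 1)%R ;
  ue_expansion : forall a x y, alpha a -> a x -> a y ->
    (lambda * dY x y <= dY (F x) (F y))%R ;
  ue_distortion : forall a x y, alpha a -> a x -> a y ->
    (`|ln (zeta x) - ln (zeta y)| <= K * dY (F x) (F y) `^ eta)%R }.

End expanding_map.

(* The library only registers [counting] as a sigma-finite content. *)
HB.instance Definition _ (R : realType) :=
  isSFinite.Build _ nat R (@counting nat R)
    (sfinite_measure_sigma_finite (sigma_finite_counting R)).

Section tower.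
Context (R : realType) (dsp : measure_display) (Y : measurableType dsp).
Variables (m : probability Y R) (tau : {mfun Y >-> nat}).

Definition return_time (alpha : set (set Y)) : Prop :=
  [/\ forall y, (0 < tau y)%N,
      m.-integrable setT (fun y => (tau y)%:R%:E) &
      forall a x y, alpha a -> a x -> a y -> tau x = tau y].

(* The tower is a subset of [Y * nat]. Functions on the tower are functions on
   [Y * nat] of which only the values on [Delta] matter. *)
Definition Delta : set (Y * nat) := [set x | (x.2 < tau x.1)%N].

(* On [Delta], the second case is the top level l = tau y - 1. *)
Definition tower_map (F : Y -> Y) (x : Y * nat) : Y * nat :=
  if (x.2.+1 < tau x.1)%N then (x.1, x.2.+1) else (F x.1, 0%N).

Lemma measurable_tau_gt l : measurable [set y | (l < tau y)%N].
Proof.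
rewrite (_ : [set _ | _] = tau @^-1` [set j | (l < j)%N]) //.
by rewrite -[_ @^-1` _]setTI; exact: measurable_funPT.
Qed.

Lemma measurable_Delta : measurable Delta.
Proof.
rewrite (_ : Delta = \bigcup_l ([set y | (l < tau y)%N] `*` [set l])).
  by apply: bigcupT_measurable => l; apply: measurableX => //;
    exact: measurable_tau_gt.
apply/seteqP; split => [[y l] /= h|[y l] [k _ [/= h ->]]] //.
by exists l.
Qed.

Definition tau_bar : R := (\int[m]_y (tau y)%:R)%R.

Lemma tau_bar_ge0 : 0 <= tau_bar.
Proof. by apply: Rintegral_ge0 => y _; exact: ler0n. Qed.

Lemma tau_barV_ge0 : 0 <= tau_bar^-1.
Proof. by rewrite invr_ge0 tau_bar_ge0. Qed.

(* (m x counting) restricted to the tower and normalised *)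
Definition m_Delta : {measure set (Y * nat) -> \bar R} :=
  mscale (NngNum tau_barV_ge0)
    (mrestr (m \x (@counting nat R))%E measurable_Delta).

Local Open Scope ereal_scope.

Lemma m_DeltaE (A : set (Y * nat)) :
  m_Delta A = (tau_bar^-1)%:E * (m \x (@counting nat R)) (A `&` Delta).
Proof. by []. Qed.

Lemma m_Delta_level (A : set Y) (l : nat) :
  measurable A -> A `<=` [set y | (l < tau y)%N] ->
  m_Delta (A `*` [set l]) = (tau_bar^-1)%:E * m A.
Proof.
move=> mA Al; rewrite m_DeltaE setIidl; last first.
  by move=> [y k] [/= /Al ? ->].
have c1 : @counting nat R [set l] = 1.
  by rewrite /counting asboolT// fset_set1 finmap.cardfs1.
by rewrite product_measure1E// [X in m A * X]c1 mule1.
Qed.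

Lemma m_Delta_tower : m_Delta (~` Delta) = 0.
Proof. by rewrite m_DeltaE setICl measure0 mule0. Qed.

Lemma m_Delta_probability (alpha : set (set Y)) :
  return_time alpha -> m_Delta [set: Y * nat] = 1.
Proof.
move=> [t0 ti _].
have tI : \int[m]_y (tau y)%:R%:E = tau_bar%:E.
  by rewrite /tau_bar /Rintegral fineK//; exact: integrable_fin_num.
have ge1 : (1 <= tau_bar)%R.
  rewrite -lee_fin -tI.
  apply: (@le_trans _ _ (\int[m]_y (cst 1 y))).
    by rewrite integral_cst// mul1e -(@probability_setT _ _ _ m).
  apply: ge0_le_integral => //; first exact: measurable_int ti.
  by move=> y _; rewrite lee_fin ler1n t0.
rewrite m_DeltaE setTI /product_measure1.
rewrite (_ : \int[m]_x _ = \int[m]_y (tau y)%:R%:E); last first.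
  apply: eq_integral => y _ /=; rewrite (_ : xsection _ _ = `I_(tau y)).
    by rewrite /counting asboolT// (@card_fset_set _ `I_(tau y) (tau y)).
  by rewrite /xsection; apply/seteqP; split => k /=; rewrite inE.
by rewrite tI -EFinM mulVf// gt_eqF// (lt_le_trans _ ge1).
Qed.

Variable dY : Y -> Y -> R.

Definition d_Delta (x y : Y * nat) : R :=
  if x.2 == y.2 then dY x.1 y.1 else 1%R.

Definition holder_seminorm (eta : R) (phi : Y * nat -> R) : \bar R :=
  ereal_sup [set r | exists x y, [/\ Delta x, Delta y, x <> y &
    r = (`|phi x - phi y| / d_Delta x y `^ eta)%:E]].

Definition sup_norm (phi : Y * nat -> R) : \bar R :=
  ereal_sup [set (`|phi x|)%:E | x in Delta].

Definition holder_norm (eta : R) (phi : Y * nat -> R) : \bar R :=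
  holder_seminorm eta phi + sup_norm phi.

(* Functions, rather than classes modulo null sets, represent elements of L^1,
   so the operator is determined up to null sets only. *)
Definition transfer_operator (F : Y -> Y)
    (L : (Y * nat -> R) -> (Y * nat -> R)) : Prop :=
  forall phi, phi \in Lfun m_Delta 1 ->
    L phi \in Lfun m_Delta 1 /\
    forall psi, psi \in Lfun m_Delta +oo ->
      \int[m_Delta]_(x in Delta) (L phi x * psi x)%:E =
      \int[m_Delta]_(x in Delta) (phi x * psi (tower_map F x))%:E.

Definition nonmixing (alpha : set (set Y)) : Prop :=
  ~ is_gcd [set j | exists2 a, alpha a & forall y, a y -> tau y = j] 1.

Definition is_period (d : nat) : Prop :=
  is_gcd [set j | (1 <= j)%N /\ 0 < m [set y | tau y = j]] d.

(* The finite set {I_k} is given as a list. *)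
Definition period_data (d : nat) (I : seq nat) (delta : R) : Prop :=
  [/\ (0 < delta)%R,
      forall i, i \in I -> (0 < i)%N,
      is_gcd [set i | i \in I] d &
      forall i, i \in I -> delta%:E <= m [set y | tau y = i]].

End tower.

(* Admissible (lambda, K, eta, max I_k, delta, beta, C_tau) *)
Definition poly_params (R : realType) : set (R * R * R * nat * R * R * R) :=
  [set p | let: (lambda, K, eta, M, delta, beta, Ctau) := p in
    [/\ 1 < lambda, 0 < K & 0 < eta <= 1] /\
    [/\ (0 < M)%N, 0 < delta, 1 < beta & 0 < Ctau]].

(* Admissible (lambda, K, eta, max I_k, delta, A, gamma, C_tau) *)
Definition exp_params (R : realType) : set (R * R * R * nat * R * R * R * R) :=
  [set p | let: (lambda, K, eta, M, delta, A, gamma, Ctau) := p in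
    [/\ 1 < lambda, 0 < K & 0 < eta <= 1] /\
    [/\ (0 < M)%N, 0 < delta, 0 < A, 0 < gamma <= 1 & 0 < Ctau]].

(* Main.v *)
Require Import Defs.
From HB Require Import structures.
From mathcomp Require Import all_boot all_order all_algebra.
From mathcomp Require Import all_classical all_reals all_analysis.
From mathcomp Require Import measurable_realfun ess_sup_inf.
From mathcomp Require Import ring lra zify.

(* Testing against the sign of the sum, the L^1 norm becomes a sum over k < d of
   correlations of phi with psi o f^(nd+k), so that L disappears.  A law on the
   tower is described by the densities on the base of the points arriving there
   at each time; by bounded distortion these densities are uniformly log-Hoelder
   after one passage through F.  Two such laws supported on the same residue
   class of arrival times modulo d are coupled: after a bounded time, because
   the I_k / d generate all large integers, both put a definite mass with
   log-Hoelder density on the base, and a fixed multiple of m can be removed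
   from both.  This gives a renewal inequality for the difference of the
   correlations, whose solution decays like the tail sums of m(tau >= n).
   Decomposing phi according to the d residue classes, the sum over k makes each
   class meet the same reference correlations, weighted by the integral of phi
   over the class; these weights add up to zero.  All constants are uniform when
   the parameters stay in a compact box, and a continuous function dominating
   the constants of an increasing sequence of boxes gives the continuous
   dependence. *)

Set Implicit Arguments.
Unset Strict Implicit.
Unset Printing Implicit Defensive.

Import Order.TTheory GRing.Theory Num.Theory.
Import numFieldNormedType.Exports.

Local Open Scope classical_set_scope.
Local Open Scope ring_scope.


(** * Numerical semigroups *)

(** The two laws to be compared reach the base at different times, so no single moment suits all
    their mass. Pairs of points, one from each law, are therefore sorted by the later of their two
    arrival times: the weights of the groups telescope to the product of the total masses, and each
    group can be coupled a fixed delay after it has arrived. Multiplying each correlation by the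
    total of the other law keeps the comparison bilinear, and the multiples of [m] removed from both
    sides cancel exactly. What is left satisfies the same estimate with smaller totals, whence an
    induction on time. Log-Hoelder constants must survive two opposite operations. A passage through
    [F] replaces H by K + H lambda^(-eta), and subtracting a multiple of [m] enlarges the constant
    again. H is chosen with a gap of 1 between the two values, and this gap decides how much can be
    removed. The time unit of the renewal system is d steps of the tower, so that the reduced return
    times I_k / d have gcd 1. *)

Inductive nsemigroup (I : seq nat) : nat -> Prop :=
| nsemigroup0 : nsemigroup I 0
| nsemigroup_add i v : i \in I -> nsemigroup I v -> nsemigroup I (i + v).

Lemma nsemigroupD I u v : nsemigroup I u -> nsemigroup I v ->
  nsemigroup I (u + v).
Proof.
by elim=> [|i w iI _ IH] // /IH; rewrite -addnA; exact: nsemigroup_add.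
Qed.

Lemma nsemigroupM I k v : nsemigroup I v -> nsemigroup I (k * v).
Proof.
move=> Iv; elim: k => [|k IH]; first exact: nsemigroup0.
by rewrite mulSn; exact: nsemigroupD.
Qed.

Lemma nsemigroup_sub (I J : seq nat) v : {subset I <= J} ->
  nsemigroup I v -> nsemigroup J v.
Proof.
move=> IJ; elim=> [|i w iI _ IH]; first exact: nsemigroup0.
by apply: nsemigroup_add => //; exact: IJ.
Qed.

(** Moving the negative Bezout coefficients to the other side makes the gcd a difference of two
    elements of the semigroup. *)
Lemma nsemigroup_bezout (I : seq nat) : all (ltn 0) I -> exists u v,
  [/\ nsemigroup I u, nsemigroup I v & u = v + \big[gcdn/0]_(i <- I) i]%N.
Proof.
elim: I => [|x I IH] /=.
  by move=> _; exists 0%N, 0%N; rewrite big_nil; split; try exact: nsemigroup0.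
case/andP => x0 /IH [u [v [Iu Iv uv]]]; rewrite big_cons.
set g := \big[gcdn/0]_(i <- I) i in uv *.
have cons_sub w : nsemigroup I w -> nsemigroup (x :: I) w.
  by apply: nsemigroup_sub => i iI; rewrite inE iI orbT.
have Ix : nsemigroup (x :: I) x.
  by rewrite -[X in nsemigroup _ X]addn0; apply: nsemigroup_add;
    [rewrite inE eqxx|exact: nsemigroup0].
case: (@egcdnP x g x0) => a b ab _.
exists (a * x + b * v)%N, (b * u)%N; split.
- by apply: nsemigroupD; apply: nsemigroupM => //; exact: cons_sub.
- by apply: nsemigroupM; exact: cons_sub.
- by rewrite uv ab; lia.
Qed.

Lemma biggcd_dvd (I : seq nat) i :
  i \in I -> (\big[gcdn/0]_(j <- I) j %| i)%N.
Proof.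
elim: I => // j I IH; rewrite inE big_cons => /orP[/eqP ->|/IH].
  exact: dvdn_gcdl.
by apply: dvdn_trans; exact: dvdn_gcdr.
Qed.

(** With gcd 1 the previous lemma gives two consecutive elements n and n + 1. If v = q n + r with r
    < n <= q, then v = (q - r) n + r (n + 1), so every v >= n^2 is reached. *)
Lemma nsemigroup_cofinite (I : seq nat) : all (ltn 0) I ->
  is_gcd [set i | i \in I] 1 ->
  exists v0, forall v, (v0 <= v)%N -> nsemigroup I v.
Proof.
move=> /nsemigroup_bezout [u [n [Iu In un]]] [_ I1].
have {I1} I1 : \big[gcdn/0]_(i <- I) i = 1%N.
  by apply/eqP; rewrite -dvdn1; apply: I1 => j /= ?; exact: biggcd_dvd.
rewrite I1 addn1 in un; exists (n * n)%N => v nv.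
case: (posnP n) => [n0|n0].
  (* Here [u] is 1 and generates everything. *)
  by rewrite -[v]muln1; apply: nsemigroupM; rewrite -n0 -un.
have vn : (v %% n <= v %/ n)%N.
  by rewrite (leq_trans (ltnW (ltn_pmod v n0)))// leq_divRL.
rewrite (_ : v = (v %/ n - v %% n) * n + (v %% n) * u)%N.
  by apply: nsemigroupD; exact: nsemigroupM.
rewrite {1}(divn_eq v n) un mulnBl mulnS.
have := leq_mul vn (leqnn n); lia.
Qed.

(** Only finitely many sets of generators lie between 1 and N, so the maximum of their thresholds
    serves all of them. The threshold thus depends on the list only through a bound for its
    maximum. *)
Lemma nsemigroup_cofinite_uniform (N : nat) : exists v0, forall I : seq nat,
  (forall i, i \in I -> 0 < i <= N)%N -> is_gcd [set i | i \in I] 1 ->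
  forall v, (v0 <= v)%N -> nsemigroup I v.
Proof.
pose idx (A : {set 'I_N.+1}) : seq nat := [seq val i | i <- enum A].
have : forall A : {set 'I_N.+1}, exists v0 : nat,
    all (ltn 0) (idx A) -> is_gcd [set i | i \in idx A] 1 ->
    forall v, (v0 <= v)%N -> nsemigroup (idx A) v.
  move=> A; case: (pselect (all (ltn 0) (idx A) /\
      is_gcd [set i | i \in idx A] 1)) => [[A0 A1]|A01].
    by have [v0 ?] := nsemigroup_cofinite A0 A1; exists v0.
  by exists 0 => A0 A1; exfalso; exact: A01.
case/choice => f fP; exists (\max_A f A) => I I0 I1 v v0.
pose A : {set 'I_N.+1} := [set i | val i \in I]%SET.
have AI : idx A =i I.
  move=> i; apply/mapP/idP => [[j]|iI].
    by rewrite mem_enum inE => ? ->.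
  have iN : (i < N.+1)%N by case/andP: (I0 _ iI).
  by exists (Ordinal iN); rewrite ?mem_enum ?inE.
apply: (@nsemigroup_sub (idx A)) => [i|]; first by rewrite AI.
apply: (fP A).
- by apply/allP => i; rewrite AI => /I0 /andP[].
- rewrite (_ : [set i | i \in idx A] = [set i | i \in I])//.
  by apply/seteqP; split => i /=; rewrite AI.
- by apply: leq_trans v0; exact: leq_bigmax.
Qed.

(** * Coupling in a renewal system *)

(* The induced map seen at its returns: [regular] and [strongly_regular] are the
   densities on the base before and after a passage through [F], [obs n g] is
   the integral of the observable at time [n] against the density [g] started on
   the base, [ret i g] is the part of [g] returning after [i.+1] steps, and
   [late n] bounds the part of the base not returning within [n] steps. *)
Record renewal_system (R : realType) (V : zmodType) := RenewalSystem {
  regular : V -> Prop ;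
  strongly_regular : V -> Prop ;
  mass : V -> R ;
  obs : nat -> V -> R ;
  ret : nat -> V -> V ;
  late : nat -> R ;
  one : V ;
  returns : seq nat ;
  bnd : R ;
  hit : R ;
  minor : R ;
  regularW : forall g, strongly_regular g -> regular g ;
  regularD : forall f g, regular f -> regular g -> regular (f + g) ;
  strongly_regular0 : strongly_regular 0 ;
  strongly_regularD : forall f g,
    strongly_regular f -> strongly_regular g -> strongly_regular (f + g) ;
  mass0 : mass 0 = 0 ;
  massD : forall f g, regular f -> regular g -> mass (f + g) = mass f + mass g ;
  mass_ge0 : forall g, regular g -> 0 <= mass g ;
  obs0 : forall n, obs n 0 = 0 ;
  obsD : forall n f g, regular f -> regular g ->
    obs n (f + g) = obs n f + obs n g ;
  obs_le : forall n g, regular g -> `|obs n g| <= mass g ;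
  ret_regular : forall i g, regular g -> strongly_regular (ret i g) ;
  obs_ret : forall n g, regular g ->
    `|obs n g - \sum_(i < n) obs (n - i.+1) (ret i g)| <=
      mass g - \sum_(i < n) mass (ret i g) ;
  mass_late : forall n g, regular g ->
    mass g - \sum_(i < n) mass (ret i g) <= bnd * late n * mass g ;
  mass_hit : forall i g, i.+1 \in returns -> regular g ->
    hit * mass g <= mass (ret i g) ;
  returns_gt0 : all (ltn 0) returns ;
  minorP : forall g v, strongly_regular g -> 0 <= v <= minor * mass g ->
    exists g', [/\ regular g', mass g' = mass g - v &
      forall n, obs n g' = obs n g - v * obs n one] ;
  one_regular : regular one ;
  mass_one : mass one = 1 ;
  late_ge0 : forall n, 0 <= late n ;
  bnd_ge1 : 1 <= bnd ;
  hit_itv : 0 < hit <= 1 ;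
  minor_itv : 0 < minor <= 1 / 2 }.

Lemma sum_ord_recl (R : realType) n (F : nat -> R) :
  \sum_(i < n.+1) F i = F 0%N + \sum_(i < n) F i.+1.
Proof. by rewrite big_ord_recl. Qed.

Section coupling.
Context (R : realType) (V : zmodType) (Q : renewal_system R V).

(* [arrive z j] is the density of the points reaching the base at time [j];
   [pending z n] is the contribution to time [n] of the points which have not
   reached the base by then. *)
Record state := State {
  arrive : nat -> V ; pending : nat -> R ; total : R }.

Definition arrived (z : state) n : R := \sum_(j < n.+1) mass Q (arrive z j).

Definition tail (z : state) n : R := total z - arrived z n.

Definition valid (z : state) : Prop :=
  (forall j, regular Q (arrive z j)) /\ forall n, `|pending z n| <= tail z n.

Definition value (z : state) n : R :=
  \sum_(j < n.+1) obs Q (n - j) (arrive z j) + pending z n.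

(** The difference inside the new [pending] is the contribution of the points that were on the base
    at time 0 and have not come back yet; with it [value] is only shifted in time. *)
Definition step (z : state) : state :=
  State (fun j => arrive z j.+1 + ret Q j (arrive z 0))
    (fun n => pending z n.+1 + (obs Q n.+1 (arrive z 0) -
      \sum_(i < n.+1) obs Q (n - i) (ret Q i (arrive z 0))))
    (total z).

Lemma ret_reg i g : regular Q g -> regular Q (ret Q i g).
Proof. by move=> ?; exact/regularW/ret_regular. Qed.

Lemma arrived_step z n : valid z -> arrived (step z) n =
  arrived z n.+1 - (mass Q (arrive z 0) -
    \sum_(i < n.+1) mass Q (ret Q i (arrive z 0))).
Proof.
move=> [zr _]; rewrite /arrived /= [in RHS](sum_ord_recl _ (fun j => mass Q (arrive z j))).
under eq_bigr do rewrite (massD (zr _) (ret_reg _ (zr 0%N))).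
rewrite big_split /=. ring.
Qed.

Lemma tail_step z n : valid z -> tail (step z) n =
  tail z n.+1 + (mass Q (arrive z 0) -
    \sum_(i < n.+1) mass Q (ret Q i (arrive z 0))).
Proof. by move=> zv; rewrite /tail arrived_step//=; ring. Qed.

Lemma valid_step z : valid z -> valid (step z).
Proof.
move=> zv; have [zr ze] := zv; split=> [j|n] /=.
  by apply: regularD => //; exact: ret_reg.
rewrite tail_step//; apply: (le_trans (ler_normD _ _)).
rewrite lerD//; under eq_bigr do rewrite -subSS.
exact: obs_ret.
Qed.

Lemma value_step z n : valid z -> value (step z) n = value z n.+1.
Proof.
move=> [zr _]; rewrite /value /=.
rewrite [in RHS](sum_ord_recl _ (fun j => obs Q (n.+1 - j) (arrive z j))) subn0.
under [in RHS]eq_bigr do rewrite subSS.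
under eq_bigr do rewrite (obsD _ (zr _) (ret_reg _ (zr 0%N))).
by rewrite big_split /=; ring.
Qed.

Lemma mass_arrive z j : valid z -> mass Q (arrive z j) <= total z.
Proof.
move=> [zr ze]; have := le_trans (normr_ge0 _) (ze j).
rewrite subr_ge0; apply: le_trans.
rewrite /arrived (bigD1 (@Ordinal j.+1 j (leqnn _)))//= lerDl.
by apply: sumr_ge0 => i _; exact: mass_ge0.
Qed.

Lemma total_ge0 z : valid z -> 0 <= total z.
Proof. by move=> zv; apply: le_trans (mass_arrive 0 zv); exact/mass_ge0/zv.1. Qed.

Lemma valid_iter T z : valid z -> valid (iter T step z).
Proof. by move=> zv; elim: T => //= T; exact: valid_step. Qed.

Lemma total_iter T z : total (iter T step z) = total z.
Proof. by elim: T. Qed.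

Lemma value_iter T z n : valid z -> value (iter T step z) n = value z (n + T).
Proof.
move=> zv; elim: T n => [|T IH] n /=; first by rewrite addn0.
by rewrite value_step ?IH ?addSnnS//; exact: valid_iter.
Qed.

(** Whatever comes back during the iteration has just passed through [F], hence is strongly regular.
    Only the original arrivals may fail to be, and [minorize] waits until they are over. *)
Lemma arrive_iter T z j : valid z -> exists2 k,
  strongly_regular Q k & arrive (iter T step z) j = arrive z (j + T) + k.
Proof.
move=> zv; elim: T j => [|T IH] j /=.
  by exists 0; [exact: strongly_regular0|rewrite addn0 addr0].
have [k kr ->] := IH j.+1; exists (k + ret Q j (arrive (iter T step z) 0)).
  by apply: strongly_regularD => //; apply/ret_regular/(valid_iter T zv).1.
by rewrite addrA addSnnS.
Qed.

(** Each iteration launches a mass of at most [total z] from the base; the sum collects the parts of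
    these launches that are still away. *)
Lemma tail_iter T z n : valid z -> tail (iter T step z) n <=
  tail z (n + T) + bnd Q * total z * \sum_(i < T) late Q (n + i.+1).
Proof.
move=> zv; elim: T n => [|T IH] n /=.
  by rewrite big_ord0 mulr0 addr0 addn0.
have zTv := valid_iter T zv.
rewrite tail_step// (le_trans (lerD (IH _) (mass_late _ (zTv.1 0%N))))//.
rewrite (sum_ord_recl _ (fun i => late Q (n + i.+1))) addn1 mulrDr addSnnS.
rewrite -addrA lerD2l addrC.
under [X in _ <= _ + _ * X]eq_bigr do rewrite -addSnnS.
rewrite lerD2r mulrAC ler_wpM2r ?late_ge0// ler_wpM2l//.
  exact: le_trans ler01 (bnd_ge1 _).
by rewrite -(total_iter T); exact: mass_arrive.
Qed.

Lemma mass_arrive_step z j : valid z ->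
  mass Q (arrive z j.+1) <= mass Q (arrive (step z) j) /\
  mass Q (ret Q j (arrive z 0)) <= mass Q (arrive (step z) j).
Proof.
move=> [zr _] /=; rewrite (massD (zr _) (ret_reg j (zr 0%N))) lerDl lerDr.
by split; apply: mass_ge0 => //; exact: ret_reg.
Qed.

Lemma mass_arrive_iter z j T : valid z ->
  mass Q (arrive z (j + T)) <= mass Q (arrive (iter T step z) j).
Proof.
move=> zv; elim: T j => [|T IH] j /=; first by rewrite addn0.
rewrite -addSnnS (le_trans (IH _))//.
by have [] := mass_arrive_step j (valid_iter T zv).
Qed.

Lemma mass_arrive_return z i : valid z -> i \in returns Q ->
  hit Q * mass Q (arrive z 0) <= mass Q (arrive (iter i step z) 0).
Proof.
move=> zv; case: i => [|i] iI; first by have /allP/(_ _ iI) := returns_gt0 Q.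
rewrite iterSr; apply: le_trans (mass_arrive_iter 0 i (valid_step zv)).
apply: le_trans (mass_arrive_step _ zv).2.
by apply: mass_hit => //; exact: zv.1.
Qed.

(** A sum of elements of [returns] is realised by returning along them one after another. Each
    return costs a factor [hit]; the return times are at least 1 and [hit] is at most 1, so
    [hit Q ^+ v] covers the whole cost. *)
Lemma mass_arrive_semigroup z v : valid z -> nsemigroup (returns Q) v ->
  hit Q ^+ v * mass Q (arrive z 0) <= mass Q (arrive (iter v step z) 0).
Proof.
move=> zv Iv; elim: Iv z zv => [|i w iI Iw IH] z zv; first by rewrite mul1r.
rewrite addnC iterD; apply: le_trans (IH _ (valid_iter i zv)).
have /andP[h0 h1] := hit_itv Q.
rewrite exprD -mulrA ler_wpM2l ?exprn_ge0 ?(ltW h0)//.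
apply: le_trans (mass_arrive_return zv iI).
rewrite ler_wpM2r ?mass_ge0//; first exact: zv.1.
have i0 : (0 < i)%N by have /allP/(_ _ iI) := returns_gt0 Q.
by case: i i0 {iI} => // i _; rewrite exprS ger_pMr// exprn_ile1// ltW.
Qed.

Lemma arrivedE z n : arrived z n = \sum_(0 <= j < n.+1) mass Q (arrive z j).
Proof. by rewrite big_mkord. Qed.

Lemma tail_anti z k n : valid z -> (k <= n)%N -> tail z n <= tail z k.
Proof.
move=> [zr _] kn; rewrite /tail lerD2l lerN2 !arrivedE.
rewrite [leRHS](@big_cat_nat _ _ _ k.+1)//= lerDl.
by apply: sumr_ge0 => j _; exact: mass_ge0.
Qed.

Lemma tail_ge0 z n : valid z -> 0 <= tail z n.
Proof. by move=> [_ ze]; exact: le_trans (ze n). Qed.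

Lemma value_le z n : valid z -> `|value z n| <= total z.
Proof.
move=> [zr ze]; rewrite /value (le_trans (ler_normD _ _))//.
rewrite -[leRHS](subrKC (arrived z n)) lerD//.
rewrite (le_trans (ler_norm_sum _ _ _))// ler_sum// => j _.
exact: obs_le.
Qed.

(** The difference of the normalised laws, cleared of denominators: it is bilinear in the pair and
    makes sense when a total vanishes. *)
Definition cross z z' n : R := total z' * value z n - total z * value z' n.

Lemma cross_le z z' n : valid z -> valid z' ->
  `|cross z z' n| <= 2 * (total z * total z').
Proof.
move=> zv z'v; rewrite (le_trans (ler_normB _ _))// !normrM.
rewrite (ger0_norm (total_ge0 zv)) (ger0_norm (total_ge0 z'v)).
have := ler_wpM2l (total_ge0 z'v) (value_le n zv).
have := ler_wpM2l (total_ge0 zv) (value_le n z'v); lra.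
Qed.

(* After [L] further steps at most half of the mass is off the base for more
   than [L] steps; [v0] makes every longer delay a combination of returns. *)
Variables (h : nat -> R) (L v0 : nat).
Hypothesis sum_late : forall n T, \sum_(i < T) late Q (n + i.+1) <= h n.
Hypothesis hL : bnd Q * h L <= 1 / 2.
Hypothesis v0P : forall v, (v0 <= v)%N -> nsemigroup (returns Q) v.

(** The successor ensures that at the time of the removal even the last original arrival has left
    the base, also when [v0] and [L] vanish. *)
Definition delay := (v0 + L).+1.
Definition overlap : R := hit Q ^+ delay / (2 * L.+1%:R).

Lemma h_ge0 n : 0 <= h n.
Proof. by have := sum_late n 0; rewrite big_ord0. Qed.

(** At least half of the mass arrives at the base between the times [s] and [s + L]. Each of these
    arrivals is followed by at least [v0] units of time, hence by a combination of returns leading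
    back exactly at [s + delay]. Averaging over the [L.+1] arrival times gives the denominator of
    [overlap]. *)
Lemma mass_base_ge z s : valid z -> tail z s = 0 ->
  overlap * total z <= mass Q (arrive (iter (s + delay) step z) 0).
Proof.
move=> zv zs; pose z' := iter s step z.
have z'v : valid z' by exact: valid_iter.
have half : total z <= 2 * arrived z' L.
  have : tail z' L <= total z * (1 / 2).
    apply: (le_trans (tail_iter s L zv)); rewrite -[leRHS]add0r lerD//.
      by rewrite -zs; apply: tail_anti => //; exact: leq_addl.
    rewrite mulrAC mulrC ler_wpM2l ?total_ge0//; apply: le_trans hL.
    by rewrite ler_wpM2l// (le_trans _ (bnd_ge1 _)).
  by rewrite /tail /z' total_iter -/z'; lra.
have /andP[h0 h1] := hit_itv Q.
rewrite /overlap mulrAC ler_pdivrMr; last by rewrite mulr_gt0// ltr0n.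
apply: (@le_trans _ _ (2 * (hit Q ^+ delay * arrived z' L))).
  by rewrite mulrCA ler_wpM2l// exprn_ge0// ltW.
rewrite [leRHS]mulrCA ler_wpM2l// /arrived mulr_sumr mulr_natr.
rewrite -[X in _ *+ X]card_ord -sumr_const ler_sum// => -[j /= jL] _.
have jd : (j <= delay)%N by rewrite /delay; lia.
rewrite addnC iterD -/z' -(subnK jd) iterD.
have z'jv := valid_iter j z'v.
apply: le_trans (mass_arrive_semigroup z'jv _); last first.
  by apply: v0P; rewrite /delay; lia.
rewrite ler_pM ?exprn_ge0 ?(ltW h0) ?mass_ge0//; first exact: z'v.1.
  by rewrite ler_wiXn2l// ?(ltW h0)// leq_addr.
exact: (mass_arrive_iter 0).
Qed.

Definition drop : R := minor Q * overlap.

Lemma overlap_itv : 0 < overlap <= 1 / 2.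
Proof.
have /andP[h0 h1] := hit_itv Q.
rewrite divr_gt0 ?exprn_gt0 ?mulr_gt0 ?ltr0n//=.
rewrite ler_pdivrMr ?mulr_gt0 ?ltr0n// mulrA divfK// mul1r.
by rewrite (@le_trans _ _ 1) ?exprn_ile1 ?(ltW h0)// ler1n.
Qed.

Lemma drop_itv : 0 < drop <= 1 / 4.
Proof.
have /andP[p0 p1] := overlap_itv; have /andP[m0 m1] := minor_itv Q.
rewrite mulr_gt0//= (_ : 1 / 4 = 1 / 2 * (1 / 2)); last by field.
by rewrite ler_pM// ltW.
Qed.

(** The factor 2 absorbs the loss of total mass in a removal: since 2 (1 - drop) >= 1, the property
    holds again afterwards. *)
Definition good z : Prop :=
  valid z /\ forall k, tail z k <= 2 * bnd Q * h k * total z.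

(** All the mass of [z] has arrived by time [s], so whatever is away at time [s + delay] left the
    base within the iteration. The new tail is therefore controlled by [late] alone, and the
    induction restarts with the same constants. *)
Lemma minorize z s : valid z -> tail z s = 0 ->
  (forall j, (s < j)%N -> arrive z j = 0) ->
  exists z', [/\ good z', total z' = (1 - drop) * total z &
    forall n, value z (n + (s + delay)) =
      drop * total z * obs Q n (one Q) + value z' n].
Proof.
move=> zv zs zsupp; set T := (s + delay)%N; pose y := iter T step z.
have yv : valid y by exact: valid_iter.
have /andP[d0 d1] := drop_itv; have /andP[m0 m1] := minor_itv Q.
have M0 := total_ge0 zv.
have ystrong j : strongly_regular Q (arrive y j).
  have [k kr ->] := arrive_iter T j zv.
  by rewrite zsupp ?add0r// /T /delay; lia.
have [||g' [g'r g'm g'v]] := @minorP _ _ Q (arrive y 0) (drop * total z).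
- exact: ystrong.
- rewrite mulr_ge0 ?(ltW d0)//= /drop -mulrA ler_wpM2l ?(ltW m0)//.
  exact: mass_base_ge.
(* Only the density on the base at the current time is changed, by exactly the mass taken from the
   total; hence the tails of [y] and [z'] coincide. *)
pose z' := State (fun j => if j is 0 then g' else arrive y j) (pending y)
  ((1 - drop) * total z).
have az' n : arrived z' n = arrived y n - drop * total z.
  rewrite /arrived (sum_ord_recl _ (fun j => mass Q (arrive z' j))) /=.
  by rewrite (sum_ord_recl _ (fun j => mass Q (arrive y j))) g'm; ring.
have tz' n : tail z' n = tail y n.
  by rewrite /tail az' /= /y total_iter; ring.
exists z'; split=> // [|n].
- split=> [|k].
    split=> [[|j]|n] //=; first exact: yv.1.
    by rewrite tz'; exact: yv.2.
  rewrite tz' (le_trans (tail_iter _ _ zv))//.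
  have : tail z (k + T) <= 0.
    by rewrite -zs; apply: tail_anti => //; rewrite /T; lia.
  have := sum_late k T; set S := \sum_(i < T) _ => Sh.
  have b1 := bnd_ge1 Q; have h0 := h_ge0 k => t0.
  apply: (@le_trans _ _ (bnd Q * total z * h k)).
    have : bnd Q * total z * S <= bnd Q * total z * h k.
      by rewrite ler_wpM2l// mulr_ge0//; lra.
    lra.
  rewrite /= (_ : 2 * _ * _ * _ = bnd Q * total z * h k * (2 * (1 - drop))).
    by rewrite ler_peMr ?mulr_ge0//; lra.
  by ring.
- rewrite -value_iter// -/y /value.
  rewrite (sum_ord_recl _ (fun j => obs Q (n - j) (arrive y j))).
  rewrite (sum_ord_recl _ (fun j => obs Q (n - j) (arrive z' j))) /= g'v subn0.
  ring.
Qed.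

(** In [rateP], [w s] is the proportion of the pairs whose later arrival is at time [s]. They have
    [r - s] units left once the delay has been spent, and their coupling gains the factor
    [1 - drop]. The term in [h r] pays for the mass arriving after [r], and [2 <= rate n] is the
    case where [cross_le] suffices. *)
Variable rate : nat -> R.
Hypothesis rateP : forall n, 2 <= rate n \/ exists2 r, n = (r + delay)%N &
  forall w : nat -> R, (forall s, 0 <= w s) ->
    \sum_(0 <= s < r.+1) w s <= 1 ->
    (forall k, \sum_(k.+1 <= s < r.+1) w s <= 4 * bnd Q * h k) ->
    8 * bnd Q * h r + (1 - drop) * \sum_(0 <= s < r.+1) w s * rate (r - s) <=
      rate n.

(** The multiples of [one] removed from the two states are the same proportion [drop] of their
    totals, so they cancel in [cross]. Of the two factors [1 - drop] in the new product of totals,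
    one is used up by the left-hand side. *)
Lemma cross_minorize z z' s r : valid z -> valid z' ->
  tail z s = 0 -> tail z' s = 0 ->
  (forall j, (s < j)%N -> arrive z j = 0) ->
  (forall j, (s < j)%N -> arrive z' j = 0) ->
  (forall y y', good y -> good y' ->
    `|cross y y' r| <= rate r * (total y * total y')) ->
  `|cross z z' (r + (s + delay))| <=
    (1 - drop) * rate r * (total z * total z').
Proof.
move=> zv z'v zs z's zsupp z'supp IH.
have /andP[d0 d1] := drop_itv.
have [y [yg yt yv]] := minorize zv zs zsupp.
have [y' [y'g y't y'v]] := minorize z'v z's z'supp.
have := IH _ _ yg y'g; rewrite /cross yv y'v yt y't.
rewrite (_ : (_ * _ * _ - _) = (1 - drop) *
  (total z' * (drop * total z * obs Q r (one Q) + value y r) -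
   total z * (drop * total z' * obs Q r (one Q) + value y' r))); last by ring.
rewrite normrM ger0_norm; last by lra.
rewrite (_ : rate r * _ = (1 - drop) *
  ((1 - drop) * rate r * (total z * total z'))); last by ring.
by rewrite ler_pM2l//; lra.
Qed.

Definition select (p : pred nat) (s : nat) z : state :=
  State (fun j => if (j <= s)%N && p j then arrive z j else 0) (fun=> 0)
    (\sum_(0 <= j < s.+1 | p j) mass Q (arrive z j)).

Lemma arrived_select p s z n : arrived (select p s z) n =
  \sum_(0 <= j < n.+1 | (j <= s)%N && p j) mass Q (arrive z j).
Proof.
rewrite arrivedE [RHS]big_mkcond /=; apply: eq_bigr => j _.
by case: ifP => // _; rewrite mass0.
Qed.

Lemma tail_select p s z : tail (select p s z) s = 0.
Proof.
apply/eqP; rewrite subr_eq0 arrived_select /= big_nat_cond.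
rewrite [X in _ == X]big_nat_cond; apply/eqP.
by apply: eq_bigl => j; rewrite ltnS; case: (j <= s)%N.
Qed.

Lemma valid_select p s z : valid z -> valid (select p s z).
Proof.
move=> [zr _]; split=> [j|n] /=.
  by case: ifP => // _; exact/regularW/strongly_regular0.
rewrite normr0 subr_ge0 arrived_select /= big_mkcond [leRHS]big_mkcond /=.
have H j : 0 <= if p j then mass Q (arrive z j) else 0.
  by case: ifP => // _; exact: mass_ge0.
have [ns|sn] := leqP n s.
  rewrite [leRHS](@big_cat_nat _ _ _ n.+1)//= -[leLHS]addr0 lerD ?sumr_ge0//.
  by rewrite ler_sum_nat// => j jn; rewrite (leq_trans _ ns).
rewrite [leLHS](@big_cat_nat _ _ _ s.+1) ?(leqW sn)//= -[leRHS]addr0 lerD//.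
  by rewrite ler_sum_nat// => j jn; case: (j <= s)%N => /=.
by rewrite big_nat big1// => j /andP[sj _]; rewrite leqNgt sj.
Qed.

Lemma value_select p s z n : (s <= n)%N -> value (select p s z) n =
  \sum_(0 <= j < s.+1 | p j) obs Q (n - j) (arrive z j).
Proof.
move=> sn; rewrite /value /= addr0.
rewrite -(big_mkord xpredT (fun j => obs Q (n - j)
  (if (j <= s)%N && p j then arrive z j else 0))).
rewrite (@big_cat_nat _ _ _ s.+1)//= addrC big_nat big1 ?add0r; last first.
  by move=> j /andP[sj _]; rewrite leqNgt sj obs0.
rewrite [RHS]big_mkcond; apply: eq_big_nat => j; rewrite ltnS => /andP[_ ->].
by rewrite /=; case: (p j); rewrite ?obs0.
Qed.

Lemma sum_nat_last (F : nat -> R) s :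
  \sum_(0 <= j < s.+1 | j == s) F j = F s.
Proof.
rewrite big_mkcond big_nat_recr//= eqxx big_nat big1 ?add0r// => j /andP[_ js].
by rewrite ltn_eqF.
Qed.

Lemma sum_nat_belast (F : nat -> R) s :
  \sum_(0 <= j < s.+1 | (j < s)%N) F j = \sum_(0 <= j < s) F j.
Proof.
rewrite big_mkcond big_nat_recr//= ltnn addr0; apply: eq_big_nat => j.
by move=> /andP[_ ->].
Qed.

(** Strong induction on the time. The pairs of arrival times with maximum [s] form two blocks: [z]
    before [s] and [z'] at [s], or [z] at [s] and [z'] not later. Each block is a pair of [select]ed
    states, treated by [cross_minorize]. *)
Theorem coupling z z' n : good z -> good z' ->
  `|cross z z' n| <= rate n * (total z * total z').
Proof.
elim/ltn_ind: n z z' => n IH z z' [zv zt] [z'v z't].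
have M0 := total_ge0 zv; have M'0 := total_ge0 z'v.
have triv := cross_le n zv z'v.
have [r2|[r nr rP]] := rateP n.
  by apply: (le_trans triv); rewrite ler_wpM2r// mulr_ge0.
(* When a total vanishes so does [cross]. The other case allows dividing by the product of the
   totals, which turns the masses below into the weights of [rateP]. *)
move: M0; rewrite le_eqVlt => /predU1P[M0|M0].
  by move: triv; rewrite -M0 !mul0r !mulr0.
move: M'0; rewrite le_eqVlt => /predU1P[M'0|M'0].
  by move: triv; rewrite -M'0 !mulr0.
pose a j := mass Q (arrive z j); pose a' j := mass Q (arrive z' j).
pose v j := obs Q (n - j) (arrive z j); pose v' j := obs Q (n - j) (arrive z' j).
pose A s := \sum_(0 <= j < s) a j; pose A' s := \sum_(0 <= j < s) a' j.
pose W s := \sum_(0 <= j < s) v j; pose W' s := \sum_(0 <= j < s) v' j.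
(* The mass of the pairs whose later arrival is at time [s]; in this form the sums of [w]
   telescope. *)
pose w s := A s.+1 * A' s.+1 - A s * A' s.
have a0 j : 0 <= a j by apply: mass_ge0; exact: zv.1.
have a'0 j : 0 <= a' j by apply: mass_ge0; exact: z'v.1.
have A0 s : 0 <= A s by apply: sumr_ge0.
have A'0 s : 0 <= A' s by apply: sumr_ge0.
have AS s : A s.+1 = A s + a s by rewrite /A big_nat_recr.
have A'S s : A' s.+1 = A' s + a' s by rewrite /A' big_nat_recr.
have w0 s : 0 <= w s.
  rewrite /w AS A'S (_ : _ - _ = A s * a' s + a s * (A' s + a' s)); last by ring.
  by rewrite addr_ge0// mulr_ge0// addr_ge0.
have telw k m : (k <= m)%N ->
    \sum_(k <= s < m) w s = A m * A' m - A k * A' k.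
  by move=> km; rewrite (telescope_sumr (fun s => A s * A' s)).
have single s r' : n = (r' + (s + delay))%N ->
  `|(A' s.+1 * W s.+1 - A s.+1 * W' s.+1) - (A' s * W s - A s * W' s)| <=
    (1 - drop) * rate r' * w s.
  move=> nE; have sn : (s <= n)%N by rewrite nE; lia.
  have r'n : (r' < n)%N by rewrite nE /delay; lia.
  have supp p y j : (s < j)%N -> arrive (select p s y) j = 0.
    by move=> sj /=; rewrite leqNgt sj.
  have key p p' : `|cross (select p s z) (select p' s z') n| <=
      (1 - drop) * rate r' *
      (total (select p s z) * total (select p' s z')).
    rewrite nE; apply: cross_minorize; try exact: tail_select;
      try exact: supp; try exact: valid_select.
    by move=> y y' yg y'g; exact: IH.
  have := key (fun j => j == s) predT; have := key (fun j => j < s)%N (eq_op^~ s).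
  rewrite /cross !value_select//= !sum_nat_last !sum_nat_belast.
  rewrite -/(a s) -/(a' s) -/(v s) -/(v' s) -/(A s) -/(W s) -/(A' s.+1).
  rewrite -/(W' s.+1).
  rewrite (_ : _ - _ - _ = (a' s * W s - A s * v' s) +
    (A' s.+1 * v s - a s * W' s.+1)); last first.
    by rewrite AS A'S /W /W' !big_nat_recr//= -/(W s) -/(W' s); ring.
  move=> H1 H2; apply: (le_trans (ler_normD _ _)).
  apply: (le_trans (lerD H1 H2)); rewrite -mulrDr /w AS A'S.
  by rewrite le_eqVlt; apply/orP; left; apply/eqP; ring.
have main m : (m <= r.+1)%N -> `|A' m * W m - A m * W' m| <=
    (1 - drop) * \sum_(0 <= s < m) w s * rate (r - s).
  elim: m => [|m IHm] mr.
    by rewrite /A /A' !big_geq// !mul0r subrr normr0 mulr0.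
  rewrite -[X in `|X|](subrK (A' m * W m - A m * W' m)).
  rewrite (le_trans (ler_normD _ _))// big_nat_recr//= mulrDr addrC lerD//.
    by apply: IHm; exact: ltnW.
  rewrite mulrA mulrAC; apply: single; rewrite nr; lia.
have rn : (r <= n)%N by rewrite nr leq_addr.
have tE k : tail z k = total z - A k.+1 by rewrite /tail arrivedE.
have t'E k : tail z' k = total z' - A' k.+1 by rewrite /tail arrivedE.
have b1 := bnd_ge1 Q.
have AM k : A k.+1 <= total z by have := tail_ge0 k zv; rewrite tE subr_ge0.
have A'M k : A' k.+1 <= total z' by have := tail_ge0 k z'v; rewrite t'E subr_ge0.
set MM := total z * total z'.
have MM0 : 0 < MM by rewrite mulr_gt0.
(* One of the two points arrives after [k]: two tails, each with the factor 2 of [good], hence the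
   4. *)
have tailMM k : MM - A k.+1 * A' k.+1 <= 4 * bnd Q * h k * MM.
  have := ler_wpM2r (ltW M'0) (zt k); have := ler_wpM2l (ltW M0) (z't k).
  have : tail z k * A' k.+1 <= tail z k * total z'.
    by rewrite ler_wpM2l ?tail_ge0.
  rewrite tE t'E /MM; lra.
have wrate : 8 * bnd Q * h r * MM + (1 - drop) *
    (\sum_(0 <= s < r.+1) w s * rate (r - s)) <= rate n * MM.
  have sumE (k : nat) : \sum_(k <= s < r.+1) w s / MM =
    (\sum_(k <= s < r.+1) w s) / MM by rewrite mulr_suml.
  rewrite -ler_pdivrMr// mulrDl mulfK ?gt_eqF//.
  have := rP (fun s => w s / MM); rewrite (_ : \sum_(0 <= s < r.+1)
    w s / MM * rate (r - s) = (\sum_(0 <= s < r.+1) w s * rate (r - s)) / MM);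
    last by rewrite mulr_suml; apply: eq_bigr => s _; rewrite mulrAC.
  rewrite mulrA; apply=> [s||k].
  - by rewrite divr_ge0// ltW.
  - rewrite sumE ler_pdivrMr// mul1r telw// [A 0%N]/A big_geq// mul0r subr0.
    exact: ler_pM.
  - rewrite sumE ler_pdivrMr//; have [kr|rk] := leqP k r.
      rewrite telw//; apply: le_trans (tailMM k).
      by rewrite lerB// ler_pM.
    rewrite big_geq; last by rewrite ltnS ltnW.
    apply: mulr_ge0 _ (ltW MM0); apply: mulr_ge0 _ (h_ge0 _).
    by lra.
have valueE y (yv : valid y) : `|value y n -
    \sum_(0 <= j < r.+1) obs Q (n - j) (arrive y j)| <= tail y r.
  rewrite /value -(big_mkord xpredT (fun j => obs Q (n - j) (arrive y j))).
  rewrite (@big_cat_nat _ _ _ r.+1)//= (_ : _ - _ = \sum_(r.+1 <= j < n.+1)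
    obs Q (n - j) (arrive y j) + pending y n); last by ring.
  rewrite (le_trans (ler_normD _ _))// (_ : tail y r =
    \sum_(r.+1 <= j < n.+1) mass Q (arrive y j) + tail y n); last first.
    rewrite /tail !arrivedE [X in _ = _ + (_ - X)](@big_cat_nat _ _ _ r.+1)//=.
    by ring.
  rewrite lerD ?yv.2// (le_trans (ler_norm_sum _ _ _))// ler_sum// => j _.
  by apply: obs_le; exact: yv.1.
have := valueE _ zv; have := valueE _ z'v.
rewrite -/(W r.+1) -/(W' r.+1).
set rho := value z n - W r.+1; set rho' := value z' n - W' r.+1 => H' H.
have WA : `|W r.+1| <= total z.
  rewrite (le_trans _ (AM r))// (le_trans (ler_norm_sum _ _ _))// ler_sum// => j _.
  by apply: obs_le; exact: zv.1.
have W'A : `|W' r.+1| <= total z'.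
  rewrite (le_trans _ (A'M r))// (le_trans (ler_norm_sum _ _ _))// ler_sum// => j _.
  by apply: obs_le; exact: z'v.1.
(* Besides the pairs arriving by time [r] there are four error terms, each containing a tail at [r].
   Each is at most 2 [bnd] [h r] times the product of the totals, hence the 8 in [rateP]. *)
rewrite (_ : cross z z' n = (A' r.+1 * W r.+1 - A r.+1 * W' r.+1) +
   (tail z' r * W r.+1 + total z' * rho - tail z r * W' r.+1
    - total z * rho')); last by rewrite /cross tE t'E /rho /rho'; ring.
apply: le_trans wrate; rewrite (le_trans (ler_normD _ _))// addrC lerD ?main//.
have /(ler_wpM2l (ltW M'0)) tz := zt r; have /(ler_wpM2l (ltW M0)) tz' := z't r.
have t0 := tail_ge0 r zv; have t'0 := tail_ge0 r z'v.
have N1 : `|tail z' r * W r.+1| <= tail z' r * total z.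
  by rewrite normrM (ger0_norm t'0) ler_wpM2l.
have N2 : `|total z' * rho| <= total z' * tail z r.
  by rewrite normrM (ger0_norm (ltW M'0)) ler_wpM2l// ltW.
have N3 : `|tail z r * W' r.+1| <= tail z r * total z'.
  by rewrite normrM (ger0_norm t0) ler_wpM2l.
have N4 : `|total z * rho'| <= total z * tail z' r.
  by rewrite normrM (ger0_norm (ltW M0)) ler_wpM2l// ltW.
rewrite (le_trans (ler_normB _ _))// (le_trans (lerD (ler_normB _ _) N4))//.
apply: (le_trans (lerD (lerD (ler_normD _ _) N3) (lexx _))).
apply: (le_trans (lerD (lerD (lerD N1 N2) (lexx _)) (lexx _))).
rewrite /MM; lra.
Qed.

End coupling.

(** * Polynomial and stretched exponential rates *)

Section powers.
Context {R : realType}.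
Implicit Types (x y b g : R) (n : nat).

Lemma powR_le x y b : 0 <= b -> 0 <= x -> x <= y -> x `^ b <= y `^ b.
Proof.
move=> b0 x0 xy; apply: ge0_ler_powR => //; rewrite nnegrE//.
exact: le_trans xy.
Qed.

Lemma powRN_le x y b : 0 <= b -> 0 < x -> x <= y -> y `^ (- b) <= x `^ (- b).
Proof.
move=> b0 x0 xy; rewrite !powRN lef_pV2 ?posrE ?powR_gt0//; last first.
  exact: lt_le_trans xy.
by apply: powR_le => //; exact: ltW.
Qed.

(** For t in (0, 1] one has t <= t^g; apply this to x / (x + y) and y / (x + y) and add. *)
Lemma powR_subadd x y g : 0 < g <= 1 -> 0 <= x -> 0 <= y ->
  (x + y) `^ g <= x `^ g + y `^ g.
Proof.
move=> /andP[g0 g1]; rewrite le_eqVlt => /predU1P[<- _|x0].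
  by rewrite add0r lerDr powR_ge0.
rewrite le_eqVlt => /predU1P[<-|y0]; first by rewrite addr0 lerDl powR_ge0.
have xy0 : 0 < x + y by rewrite addr_gt0.
have H z : 0 < z -> z <= x + y -> z / (x + y) * (x + y) `^ g <= z `^ g.
  move=> z0 zxy; rewrite -[X in _ <= X `^ _](divfK (lt0r_neq0 xy0)).
  rewrite powRM ?divr_ge0 ?(ltW z0) ?(ltW xy0)// ler_wpM2r ?powR_ge0//.
  by rewrite ger1_powR// divr_gt0//= ler_pdivrMr// mul1r.
have := lerD (H x x0 _) (H y y0 _); rewrite -!mulrDl divff ?lt0r_neq0// mul1r.
by apply; rewrite ?lerDl ?lerDr ltW.
Qed.

Lemma natr_powR_le n g : 0 < g <= 1 -> n%:R `^ g <= n%:R :> R.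
Proof.
move=> /andP[g0 g1]; case: n => [|n]; first by rewrite powR0// gt_eqF.
by rewrite ler1_powR// ler1n.
Qed.

(** The inequality e^(x/(k+1)) >= x/(k+1), raised to the power k + 1 and inverted. *)
Lemma expRN_le (k : nat) x : 0 < x -> expR (- x) <= (k.+1%:R / x) ^+ k.+1.
Proof.
move=> x0; rewrite expRN -[X in X <= _]invrK invrK.
rewrite -[in leRHS]invf_div exprVn lef_pV2 ?posrE ?expR_gt0 ?exprn_gt0 ?divr_gt0//.
rewrite -{2}(divfK (_ : k.+1%:R != 0) x) ?pnatr_eq0// expRM_natr.
rewrite ler_pXn2r// ?nnegrE ?expR_ge0 ?divr_ge0 ?(ltW x0)//.
by rewrite (le_trans _ (expR_ge1Dx _))// lerDr.
Qed.

End powers.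

Section rates.
Context {R : realType}.

(** The sum is cut at a small fraction [th] of n. Before the cut, r - s is comparable to n and the
    loss 1 + rho/2 is beaten by 1 - rho. After it, the tail of [w] is already of order n^(-b) and
    [rate] is at most 2, which is what the truncation by [Num.min] is for. [C] is uniform over all b
    <= N. *)
Lemma poly_rate (B rho H : R) (t N : nat) :
  1 <= B -> 0 < rho <= 1 / 4 -> 0 <= H -> exists2 C : R, 0 < C &
  forall b : R, 0 <= b <= N%:R ->
  let h n : R := H * n.+1%:R `^ (- b) in
  let rate n : R := Num.min 2 (C * n.+1%:R `^ (- b)) in
  forall n, 2 <= rate n \/ exists2 r, n = (r + t)%N &
  forall w : nat -> R, (forall s, 0 <= w s) ->
    \sum_(0 <= s < r.+1) w s <= 1 ->
    (forall k, \sum_(k.+1 <= s < r.+1) w s <= 4 * B * h k) ->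
    8 * B * h r + (1 - rho) * \sum_(0 <= s < r.+1) w s * rate (r - s)%N <=
      rate n.
Proof.
move=> B1 /andP[rho0 rho1] H0.
(* Chosen so that K^b <= 1 + rho/2 for every b <= N; N + 1 instead of N avoids a division by 0. *)
pose K := (1 + rho / 2) `^ (N.+1%:R^-1).
have K1 : 1 < K.
  have iN0 : 0 < (N.+1%:R : R)^-1 by rewrite invr_gt0 ltr0n.
  have := gt0_ltr_powR iN0 (x := 1) (y := 1 + rho / 2).
  by rewrite powR1; apply; rewrite ?nnegrE; lra.
(* Then (n + 1) / K = (n + 1) - 2 th (n + 1): one [th] pays for the cut, the other for the delay
   [t]. *)
pose th := (1 - K^-1) / 2.
have th0 : 0 < th by rewrite divr_gt0// subr_gt0 invf_lt1// (lt_trans _ K1).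
(* The first bound makes [rate] equal to 2 unless t < th (n + 1). The second lets (rho / 2) C absorb
   the two terms that do not contain [C]. *)
pose C := Num.max (2 * (t%:R / th + 1) ^+ N)
  (2 / rho * (16 * B * H + 8 * B * H * (th^-1) ^+ N)).
have C0 : 0 < C.
  rewrite lt_max mulr_gt0// exprn_gt0// ltr_wpDl//.
  by rewrite divr_ge0// ltW.
exists C => // b /andP[b0 bN] h rate n.
pose p m : R := m.+1%:R `^ (- b).
have p0 m : 0 < p m by rewrite powR_gt0.
have pK (c : R) m : 1 <= c -> n.+1%:R <= c * m.+1%:R -> p m <= c `^ b * p n.
  move=> c1 nm; rewrite /p !powRN -[leRHS]invf_div.
  rewrite lef_pV2 ?posrE ?divr_gt0 ?powR_gt0// ?(lt_le_trans _ c1)//.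
  rewrite ler_pdivrMr ?powR_gt0 ?(lt_le_trans _ c1)//.
  rewrite -powRM ?(le_trans _ c1)//.
  by apply: powR_le => //; rewrite mulrC.
have powN (c : R) : 1 <= c -> c `^ b <= c ^+ N.
  by move=> c1; rewrite -powR_mulrn ?(le_trans _ c1)// ler_powR.
have [C2|C2] := leP 2 (C * p n); first by left; rewrite le_min lexx.
right.
have tn : t%:R < th * n.+1%:R.
  rewrite ltNge; apply/negP => nt; move: C2; apply/negP; rewrite -leNgt.
  rewrite /p powRN ler_pdivlMr ?powR_gt0//.
  apply: (@le_trans _ _ (2 * (t%:R / th + 1) ^+ N)); last by rewrite le_max lexx.
  rewrite ler_pM2l// (le_trans _ (powN _ _))//; last first.
    by rewrite lerDr divr_ge0// ltW.
  apply: powR_le => //; rewrite (@le_trans _ _ (t%:R / th))// ?lerDl//.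
  by rewrite ler_pdivlMr// mulrC.
have th1 : th < 1.
  rewrite /th ltr_pdivrMr// mul1r ltrBlDr ltr_wpDr ?invr_ge0//.
    by rewrite (le_trans _ (ltW K1)).
  by rewrite ltr1n.
have tn' : (t <= n)%N.
  rewrite -ltnS -(ltr_nat R) (lt_trans tn)//.
  by rewrite gtr_pMl.
exists (n - t)%N; first by rewrite subnK.
set r := (n - t)%N => w w0 w1 wh.
pose k := Num.truncn (th * n.+1%:R : R).
have thn0 : 0 <= th * n.+1%:R by rewrite mulr_ge0// ltW.
have k1 : th * n.+1%:R < k.+1%:R by case/andP: (truncn_itv thn0).
have k2 : k%:R <= th * n.+1%:R by rewrite truncn_le.
have nK : n.+1%:R / K = n.+1%:R - 2 * (th * n.+1%:R).
  by rewrite /th; field; rewrite gt_eqF// (lt_trans _ K1).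
have K0 : 0 < K by rewrite (lt_trans _ K1).
have nK0 : 0 < n.+1%:R / K by rewrite divr_gt0.
have kr : (k <= r)%N.
  rewrite /r leq_subRL// -ltnS -(ltr_nat R) natrD; lra.
have rk : n.+1%:R <= K * (r - k).+1%:R.
  have : (n.+1 = (r - k).+1 + k + t)%N by rewrite addSn subnK// addSn subnK.
  move/(congr1 (fun m => m%:R : R)); rewrite !natrD => nE.
  rewrite mulrC -ler_pdivrMr// nK; lra.
have rK : n.+1%:R <= K * r.+1%:R.
  by rewrite (le_trans rk)// ler_wpM2l ?(ltW K0)// ler_nat ltnS leq_subr.
have Kb : K `^ b <= 1 + rho / 2.
  have -> : 1 + rho / 2 = K `^ N.+1%:R.
    by rewrite /K -powRrM mulVf ?pnatr_eq0// powRr1//; lra.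
  by apply: ler_powR; [exact: ltW|rewrite (le_trans bN)// ler_nat].
have pr : p r <= 2 * p n.
  rewrite (le_trans (pK _ _ (ltW K1) rK))// ler_wpM2r ?(ltW (p0 _))//.
  by rewrite (le_trans Kb)//; lra.
have prk : p (r - k)%N <= (1 + rho / 2) * p n.
  by rewrite (le_trans (pK _ _ (ltW K1) rk))// ler_wpM2r ?(ltW (p0 _)).
have th1' : 1 <= th^-1 by rewrite invf_ge1// ltW.
have pk : p k <= (th^-1) ^+ N * p n.
  rewrite (le_trans (pK _ _ th1' _))//.
    by rewrite mulrC ler_pdivlMr// mulrC ltW.
  by rewrite ler_wpM2r ?(ltW (p0 _))// powN.
have rateE m : rate m = Num.min 2 (C * p m) by [].
have rate_ge0 m : 0 <= rate m by rewrite rateE le_min mulr_ge0 ?ltW.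
have sum1 : \sum_(0 <= s < k.+1) w s * rate (r - s)%N <= C * p (r - k)%N.
  apply: (@le_trans _ _ (\sum_(0 <= s < k.+1) w s * (C * p (r - k)%N))).
    apply: ler_sum_nat => s /andP[_ sk]; rewrite ler_wpM2l//.
    rewrite rateE ge_min; apply/orP; right; rewrite ler_wpM2l ?(ltW C0)//.
    by rewrite powRN_le// ler_nat ltnS leq_sub2l.
  rewrite -mulr_suml ler_piMl//; first by rewrite mulr_ge0 ?ltW.
  apply: le_trans w1; rewrite [leRHS](@big_cat_nat _ _ _ k.+1)//= lerDl.
  by rewrite sumr_ge0.
have sum2 : \sum_(k.+1 <= s < r.+1) w s * rate (r - s)%N <= 8 * B * h k.
  apply: (@le_trans _ _ (\sum_(k.+1 <= s < r.+1) w s * 2)).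
    by apply: ler_sum => s _; rewrite ler_wpM2l// rateE ge_min lexx.
  by rewrite -mulr_suml; have := wh k; lra.
rewrite (@big_cat_nat _ _ _ k.+1)//= rateE min_r ?(ltW C2)//.
apply: (@le_trans _ _ (8 * B * (H * (2 * p n)) + (1 - rho) *
    (C * ((1 + rho / 2) * p n) + 8 * B * (H * ((th^-1) ^+ N * p n))))).
  apply: lerD; first by rewrite ler_wpM2l ?mulr_ge0// 1?ler_wpM2l//; lra.
  apply: ler_wpM2l; first by lra.
  apply: lerD; first by rewrite (le_trans sum1)// ler_wpM2l// ltW.
  by rewrite (le_trans sum2)// ler_wpM2l ?mulr_ge0// 1?ler_wpM2l//; lra.
rewrite [leLHS](_ : _ = (16 * B * H + (1 - rho) * (8 * B * H * (th^-1) ^+ N) +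
  (1 - rho) * (1 + rho / 2) * C) * p n); last by ring.
rewrite ler_wpM2r ?(ltW (p0 _))//.
have CE : 2 / rho * (16 * B * H + 8 * B * H * (th^-1) ^+ N) <= C.
  by rewrite le_max lexx orbT.
have CE' : 16 * B * H + 8 * B * H * (th^-1) ^+ N <= C * (rho / 2).
  have r2 : 0 <= rho / 2 by rewrite divr_ge0// ltW.
  apply: le_trans (ler_wpM2r r2 CE); rewrite [leRHS](_ : _ =
    16 * B * H + 8 * B * H * (th^-1) ^+ N)//.
  by field; rewrite !gt_eqF.
set X := 8 * B * H * (th^-1) ^+ N in CE' *.
have X0 : 0 <= X by rewrite !mulr_ge0// ?exprn_ge0 ?invr_ge0 ?ltW//; lra.
have : 0 <= rho * X by rewrite mulr_ge0// ltW.
have : 0 <= rho * rho * C by rewrite !mulr_ge0// ltW.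
lra.
Qed.

(** Telescopes, since 1/(s+1)^2 <= 1/s - 1/(s+1). *)
Lemma sum_inv_square (k r : nat) : (0 < k)%N ->
  \sum_(k.+1 <= s < r.+1) (s%:R ^+ 2)^-1 <= k%:R^-1 :> R.
Proof.
move=> k0; have [rk|kr] := leqP r k.
  by rewrite big_geq ?ltnS// invr_ge0.
apply: (@le_trans _ _ (\sum_(k <= s < r) (- (s.+1%:R^-1) - - (s%:R^-1)))).
  rewrite big_add1 /=; apply: ler_sum_nat => s /andP[ks _].
  have s0 : 0 < s%:R :> R by rewrite ltr0n (leq_trans k0).
  rewrite opprK addrC -natr1 (_ : _ - _ = (s%:R * (s%:R + 1))^-1).
    rewrite lef_pV2 ?posrE ?exprn_gt0 ?mulr_gt0 ?addr_gt0//.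
    by rewrite expr2 ler_wpM2r// ?lerDl// addr_ge0// ltW.
  by field; rewrite !gt_eqF// addr_gt0.
rewrite telescope_sumr ?(ltnW kr)// opprK addrC lerBlDr lerDl invr_ge0//.
Qed.

(** Passing from [rate (r - s)] to [rate n] multiplies [w s] by about e^(kappa s^g), and the total
    cost has to stay below the gain [rho]. For s <= k this follows from a small [kappa]. For s > k
    the bound kappa <= a/2 leaves half of the decay of [w], whose sum is of order 1/k. Uniformity in
    g comes from s^g >= s^(1/N). *)
Lemma exp_rate (B rho H a : R) (t N : nat) :
  1 <= B -> 0 < rho <= 1 / 4 -> 0 <= H -> 0 < a -> (0 < N)%N ->
  exists C kappa : R, [/\ 0 < C, 0 < kappa <= a &
  forall g : R, N%:R^-1 <= g <= 1 ->
  let h n : R := H * expR (- (a * n%:R `^ g)) in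
  let rate n : R := C * expR (- (kappa * n%:R `^ g)) in
  forall n, 2 <= rate n \/ exists2 r, n = (r + t)%N &
  forall w : nat -> R, (forall s, 0 <= w s) ->
    \sum_(0 <= s < r.+1) w s <= 1 ->
    (forall k, \sum_(k.+1 <= s < r.+1) w s <= 4 * B * h k) ->
    8 * B * h r + (1 - rho) * \sum_(0 <= s < r.+1) w s * rate (r - s)%N <=
      rate n].
Proof.
move=> B1 /andP[rho0 rho1] H0 a0 N0.
(* The constant in e^(-(a/2) s^(1/N)) <= c / s^2, given by [expRN_le] with the power 2N of
   s^(1/N). *)
pose c : R := ((2 * N).-1.+1%:R / (a / 2)) ^+ (2 * N).-1.+1.
(* The factor e^a comes from bounding [w s] by [h] at s - 1, where s^g <= (s-1)^g + 1; the factor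
   e^(a t) pays for the delay. *)
pose D := 4 * B * H * expR a * expR (a * t%:R).
have c0 : 0 < c by rewrite exprn_gt0// !divr_gt0.
have D0 : 0 <= D by rewrite !mulr_ge0 ?expR_ge0//; lra.
(* Large enough for D c / k <= rho / 4. *)
pose k := (Num.truncn (4 * D * c / rho)).+1.
have kP : 4 * D * c / rho <= k%:R.
  have z0 : 0 <= 4 * D * c / rho.
    apply: mulr_ge0; last by rewrite invr_ge0 ltW.
    by apply: mulr_ge0 _ (ltW c0); apply: mulr_ge0.
  by have /andP[_ /ltW] := truncn_itv z0.
(* The second bound gives e^(kappa (t + k)) <= 1 + rho / 4. *)
pose kappa := Num.min (a / 2) (rho / (8 * (t + k)%:R)).
(* The first bound makes [rate n] at least 2 when n < t, the second makes the term in [h r] at most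
   a fraction rho / 4 of [rate n]. *)
pose C := Num.max (2 * expR (a * t%:R)) (32 * B * H * expR (a * t%:R) / rho).
have tk0 : 0 < (8 * (t + k)%:R : R) by rewrite mulr_gt0// ltr0n addn_gt0 orbT.
have kap0 : 0 < kappa by rewrite lt_min !divr_gt0.
have kapa2 : kappa <= a / 2 by rewrite ge_min lexx.
have kapa : kappa <= a by rewrite (le_trans kapa2)//; lra.
have C0 : 0 < C by rewrite lt_max mulr_gt0 ?expR_gt0.
have kapt : expR (kappa * (t + k)%:R) <= 1 + rho / 4.
  have K8 : kappa * (t + k)%:R <= rho / 8.
    have : kappa <= rho / (8 * (t + k)%:R) by rewrite ge_min lexx orbT.
    by rewrite ler_pdivlMr//; lra.
  have := expR_ge1Dx (- (kappa * (t + k)%:R)); rewrite expRN.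
  have := expR_gt0 (kappa * (t + k)%:R).
  set e := expR _ => e0 e1; have {e1} e1 : (1 - rho / 8) * e <= 1.
    by rewrite -ler_pdivlMr// mul1r; lra.
  have : (1 - rho / 8) * e <= (1 - rho / 8) * (1 + rho / 4).
    have : 0 <= rho * (1 / 4 - rho) by rewrite mulr_ge0 ?subr_ge0// ltW.
    lra.
  by rewrite ler_pM2l//; lra.
exists C, kappa; split => //; first by rewrite kap0.
move=> g /andP[Ng g1] h rate n.
have g0 : 0 < g by rewrite (lt_le_trans _ Ng)// invr_gt0 ltr0n.
have g01 : 0 < g <= 1 by rewrite g0.
pose q m : R := m%:R `^ g; pose x := expR (- (kappa * q n)).
have q0 m : 0 <= q m by exact: powR_ge0.
have qle m : q m <= m%:R by exact: natr_powR_le.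
have qD m m' : q (m + m')%N <= q m + q m'.
  by rewrite /q natrD; exact: powR_subadd.
have [nt|tn] := ltnP n t.
  left; apply: (@le_trans _ _ (2 * expR (a * t%:R) * x)); last first.
    by rewrite ler_wpM2r ?expR_ge0// le_max lexx.
  rewrite -mulrA -expRD ler_pMr// -[leLHS]expR0 ler_expR subr_ge0.
  apply: ler_pM; [exact: ltW|exact: q0|exact: kapa|].
  by apply: (le_trans (qle n)); rewrite ler_nat ltnW.
right; exists (n - t)%N; first by rewrite subnK.
set r := (n - t)%N => w w0 w1 wh.
have rt : (r + t = n)%N by rewrite subnK.
have x0 : 0 < x by exact: expR_gt0.
have tail_r : 8 * B * h r <= rho / 4 * C * x.
  apply: (@le_trans _ _ (8 * B * (H * (expR (a * t%:R) * x)))).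
    rewrite ler_wpM2l ?ler_wpM2l//; first by lra.
    rewrite -expRD ler_expR -/(q r).
    have : kappa * q n <= kappa * (q r + q t) by rewrite ler_pM2l// -rt.
    have : kappa * q r <= a * q r by rewrite ler_wpM2r.
    have : kappa * q t <= a * t%:R by rewrite ler_pM// ltW.
    lra.
  have CE : 32 * B * H * expR (a * t%:R) / rho <= C by rewrite le_max lexx orbT.
  rewrite [leLHS](_ : _ =
    rho / 4 * (32 * B * H * expR (a * t%:R) / rho) * x); last first.
    by field; rewrite gt_eqF.
  by rewrite ler_wpM2r ?(ltW x0)// ler_wpM2l//; lra.
have rate_le s : (s <= r)%N ->
    rate (r - s)%N <= C * x * (expR (kappa * t%:R) * expR (kappa * q s)).
  move=> sr; rewrite /rate -mulrA ler_wpM2l ?(ltW C0)// -!expRD ler_expR.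
  rewrite -/(q _) -rt -{2}(subnK sr).
  have : kappa * q (r - s + s + t)%N <=
      kappa * (q (r - s)%N + q s + t%:R).
    rewrite ler_pM2l//; apply: (le_trans (qD _ _)); apply: lerD (qle t).
    exact: qD.
  lra.
have small s : (s <= k)%N -> (s <= r)%N ->
    w s * rate (r - s)%N <= C * x * ((1 + rho / 4) * w s).
  move=> sk sr; rewrite [leRHS]mulrA [leLHS]mulrC ler_wpM2r//.
  rewrite (le_trans (rate_le _ sr))//.
  rewrite ler_wpM2l ?mulr_ge0 ?(ltW C0) ?(ltW x0)//.
  apply: le_trans kapt; rewrite -expRD ler_expR natrD mulrDr lerD2l ler_pM2l//.
  by apply: (le_trans (qle s)); rewrite ler_nat.
have large s : (k < s)%N -> (s <= r)%N ->
    w s * rate (r - s)%N <= C * x * (D * c * (s%:R ^+ 2)^-1).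
  move=> ks sr.
  have s0 : (0 < s)%N by rewrite (leq_trans _ ks).
  have ws : w s <= 4 * B * H * expR a * expR (- (a * q s)).
    have : w s <= \sum_(s <= i < r.+1) w i.
      by rewrite big_ltn ?ltnS// lerDl sumr_ge0.
    move=> ww; apply: (le_trans ww) => {ww}.
    case: s s0 {ks sr} => [h0|s _]; first discriminate h0.
    apply: (le_trans (wh s)); rewrite /h -!mulrA.
    apply: ler_wpM2l => [//|]; apply: ler_wpM2l; first exact: le_trans ler01 B1.
    apply: ler_wpM2l => [//|].
    rewrite -expRD ler_expR -/(q s).
    have : a * q s.+1 <= a * (q s + 1).
      rewrite ler_pM2l// -addn1; apply: (le_trans (qD s 1%N)).
      by rewrite lerD2l; exact: qle 1%N.
    by lra.
  have rate0 : 0 <= rate (r - s)%N by apply: mulr_ge0 (expR_ge0 _); exact: ltW.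
  apply: (le_trans (ler_pM (w0 s) rate0 ws (rate_le _ sr))).
  rewrite [leLHS](_ : _ = C * x * (4 * B * H * expR a * expR (kappa * t%:R) *
    (expR (- (a * q s)) * expR (kappa * q s)))); last by ring.
  rewrite ler_wpM2l ?mulr_ge0 ?(ltW C0) ?(ltW x0)// -[leRHS]mulrA.
  apply: ler_pM.
  - by rewrite !mulr_ge0 ?expR_ge0//; lra.
  - by rewrite mulr_ge0 ?expR_ge0.
  - rewrite /D ler_wpM2l ?mulr_ge0 ?expR_ge0//; first by lra.
    by rewrite ler_expR ler_wpM2r.
  have sg : (s%:R : R) `^ N%:R^-1 <= q s by rewrite ler_powR// ler1n.
  have sN0 : 0 < (s%:R : R) `^ N%:R^-1 by rewrite powR_gt0// ltr0n.
  apply: (@le_trans _ _ (expR (- (a / 2 * s%:R `^ N%:R^-1)))).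
    rewrite -expRD ler_expR.
    have : kappa * q s <= a / 2 * q s by rewrite ler_wpM2r.
    have : a / 2 * s%:R `^ N%:R^-1 <= a / 2 * q s by rewrite ler_pM2l ?divr_gt0.
    lra.
  rewrite (le_trans (expRN_le (2 * N).-1 _)) ?mulr_gt0 ?divr_gt0//.
  rewrite invfM mulrA exprMn -/c ler_pM2l// prednK ?muln_gt0//.
  rewrite exprVn lef_pV2 ?posrE ?exprn_gt0 ?ltr0n//.
  rewrite mulnC exprM -(powR_mulrn N (powR_ge0 _ _)) -powRrM mulVf ?powRr1//.
  by rewrite pnatr_eq0 -lt0n.
have Dc : 0 <= D * c by exact: mulr_ge0 D0 (ltW c0).
have sumw : \sum_(0 <= s < r.+1) w s * rate (r - s)%N <=
    C * x * (1 + rho / 4 + rho / 4).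
  apply: (@le_trans _ _ (C * x * ((1 + rho / 4) * (\sum_(0 <= s < r.+1) w s) +
      D * c * \sum_(k.+1 <= s < r.+1) (s%:R ^+ 2)^-1))).
    have sq0 s : 0 <= D * c * (s%:R ^+ 2)^-1.
      by apply: (mulr_ge0 Dc); rewrite invr_ge0 exprn_ge0.
    have [rk|kr] := leqP r k.
      rewrite [X in _ + _ * X]big_geq ?ltnS// mulr0 addr0 !mulr_sumr.
      by apply: ler_sum_nat => s /andP[_ sr]; apply: small => //;
        rewrite -ltnS// (leq_trans sr).
    rewrite (@big_cat_nat _ _ _ k.+1) ?ltnS ?(ltnW kr)//=.
    rewrite [\sum_(0 <= s < r.+1) w s](@big_cat_nat _ _ _ k.+1) ?ltnS ?(ltnW kr)//=.
    apply: (@le_trans _ _ (C * x * ((1 + rho / 4) * \sum_(0 <= s < k.+1) w s) +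
        C * x * (D * c * \sum_(k.+1 <= s < r.+1) (s%:R ^+ 2)^-1))).
      apply: lerD; rewrite !mulr_sumr; apply: ler_sum_nat => s /andP[s1 s2].
        by apply: small => //; rewrite -ltnS// (leq_trans s2)// ltnW.
      exact: large.
    rewrite -mulrDr ler_wpM2l ?mulr_ge0 ?(ltW C0) ?(ltW x0)// lerD2r.
    rewrite ler_wpM2l//; first by lra.
    by rewrite lerDl sumr_ge0.
  rewrite ler_wpM2l ?mulr_ge0 ?(ltW C0) ?(ltW x0)// lerD//.
    by rewrite ler_piMr//; lra.
  apply: (@le_trans _ _ (D * c * k%:R^-1)).
    by apply: (ler_wpM2l Dc); exact: sum_inv_square.
  rewrite ler_pdivrMr ?ltr0n//; move: kP.
  by rewrite ler_pdivrMr//; lra.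
apply: (@le_trans _ _ (rho / 4 * C * x +
    (1 - rho) * (C * x * (1 + rho / 4 + rho / 4)))).
  by rewrite lerD// ler_wpM2l//; lra.
rewrite /rate -/(q n) -/x.
have Cx : 0 <= C * x by rewrite mulr_ge0// ltW.
have : 0 <= C * x * (rho * (1 / 2 + rho)) by rewrite !mulr_ge0//; lra.
lra.
Qed.

End rates.

(** * Integration along inverse branches *)

Local Open Scope ereal_scope.

Section density.
Context (d : measure_display) (T : measurableType d) (R : realType).
Variables (mu nu : {measure set T -> \bar R}) (z : T -> R).
Hypothesis mz : measurable_fun setT z.
Hypothesis z0 : forall x, (0 <= z x)%R.
Hypothesis muE : forall E, measurable E -> mu E = \int[nu]_(x in E) (z x)%:E.

Import HBNNSimple.

Let measurable_weighted D (g : T -> R) : measurable_fun D g ->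
  measurable_fun D (fun x => (g x * z x)%:E).
Proof.
by move=> mg; apply/measurable_EFinP/measurable_funM => //; exact: measurable_funTS.
Qed.

Let density_indic E A r : measurable E -> measurable A -> (0 <= r)%R ->
  \int[mu]_(x in E) (r * \1_A x)%:E = \int[nu]_(x in E) (r * \1_A x * z x)%:E.
Proof.
move=> mE mA r0; transitivity (r%:E * mu (A `&` E)).
  under eq_integral do rewrite EFinM.
  rewrite ge0_integralZl_EFin ?integral_indic//.
  by apply/measurable_EFinP; exact: measurable_indic.
under [RHS]eq_integral do rewrite -mulrA EFinM.
rewrite ge0_integralZl_EFin//.
- rewrite muE; last exact: measurableI.
  rewrite setIC integral_mkcondr; congr (_ * _); apply: eq_integral => x _.
  by rewrite /patch indicE; case: (x \in A); rewrite ?mul1r ?mul0r.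
- by move=> x _; rewrite lee_fin mulr_ge0.
- exact/measurable_weighted/measurable_indic.
Qed.

Let density_nnsfun E (h : {nnsfun T >-> R}) : measurable E ->
  \int[mu]_(x in E) (h x)%:E = \int[nu]_(x in E) (h x * z x)%:E.
Proof.
move=> mE; pose A r := h @^-1` [set r].
have mA r : measurable (A r) by exact: measurable_funPTI.
have rng r : r \in range h -> (0 <= r)%R by rewrite inE => -[x _ <-].
have term0 r x : (0 <= r * \1_(A r) x)%R.
  by rewrite indicE; have [|] := boolP (x \in A r); rewrite ?mulr0// inE mulr1 => <-.
under eq_integral do rewrite fimfunE -fsumEFin//.
rewrite ge0_integral_fsum//; last 2 first.
- by move=> r; apply/measurable_EFinP/measurable_funM => //; exact: measurable_indic.
- by move=> r x _; rewrite lee_fin.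
have hz x : (h x * z x)%:E = \sum_(r \in range h) (r * \1_(A r) x * z x)%:E.
  by rewrite fimfunE mulr_fsuml fsumEFin.
under [RHS]eq_integral do rewrite hz.
rewrite ge0_integral_fsum//; last 2 first.
- by move=> r; apply/measurable_weighted/measurable_funM => //; exact: measurable_indic.
- by move=> r x _; rewrite lee_fin mulr_ge0.
by apply: eq_fsbigr => r /rng r0; exact: density_indic.
Qed.

(** The measure [nu] is arbitrary, possibly not sigma-finite, so the formula is carried from simple
    functions by monotone convergence. *)
Lemma ge0_integral_density E (f : T -> \bar R) : measurable E ->
  measurable_fun E f -> (forall x, E x -> 0 <= f x) ->
  \int[mu]_(x in E) f x = \int[nu]_(x in E) (f x * (z x)%:E).
Proof.
move=> mE mf f0; pose h := nnsfun_approx mE mf.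
have h_cvg x : E x -> (h n x)%:E @[n --> \oo] --> f x.
  by move=> Ex; exact: cvg_nnsfun_approx.
have h_nd x : {homo (fun n => h n x) : i j / (i <= j)%N >-> (i <= j)%R}.
  by move=> i j ij; exact/lefP/nd_nnsfun_approx.
have lim_mu : \int[mu]_(x in E) (h n x)%:E @[n --> \oo] --> \int[mu]_(x in E) f x.
  rewrite (eq_integral (fun x => limn (fun n => (h n x)%:E))); last first.
    by move=> x /[!inE] Ex; apply/esym/cvg_lim => //; exact: h_cvg.
  apply: cvg_monotone_convergence => //.
  - by move=> n; exact/measurable_EFinP/measurable_funTS.
  - by move=> n x _; rewrite lee_fin.
  - by move=> x _ i j ij; rewrite lee_fin h_nd.
have lim_nu : \int[nu]_(x in E) (h n x * z x)%:E @[n --> \oo] -->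
    \int[nu]_(x in E) (f x * (z x)%:E).
  rewrite (eq_integral (fun x => limn (fun n => (h n x * z x)%:E))); last first.
    move=> x /[!inE] Ex; apply/esym/cvg_lim => //.
    by under eq_fun do rewrite EFinM; apply: cvgeZr => //; exact: h_cvg.
  apply: cvg_monotone_convergence => //.
  - by move=> n; exact/measurable_weighted/measurable_funTS.
  - by move=> n x _; rewrite lee_fin mulr_ge0.
  - by move=> x _ i j ij; rewrite lee_fin ler_wpM2r// h_nd.
rewrite (funext (fun n => density_nnsfun (h n) mE)) in lim_mu.
exact: cvg_unique lim_mu lim_nu.
Qed.

End density.

Section branch.
Context (R : realType) (d : measure_display) (Y : measurableType d).
Variables (m nu : {measure set Y -> \bar R}) (F : Y -> Y) (z : Y -> R).
Variable a0 : set Y.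
Hypotheses (mF : measurable_fun setT F) (ma0 : measurable a0).
Hypothesis injF : set_inj a0 F.
Hypothesis imF : forall E, measurable E -> E `<=` a0 -> measurable (F @` E).
Hypothesis nuE : forall E, measurable E -> E `<=` a0 -> nu E = m (F @` E).
Hypothesis mz : measurable_fun setT z.
Hypothesis z0 : forall x, (0 < z x)%R.
Hypothesis mE : forall E, measurable E -> m E = \int[nu]_(x in E) (z x)%:E.

Definition branch (y : Y) : Y :=
  if pselect (exists2 x, a0 x & F x = y) is left h then projT1 (cid2 h) else y.

Lemma branchP y : (F @` a0) y -> a0 (branch y) /\ F (branch y) = y.
Proof.
by rewrite /branch => -[x ax Fx]; case: pselect => [h|[]];
  [case: (cid2 h)|exists x].
Qed.

Lemma branchK x : a0 x -> branch (F x) = x.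
Proof.
move=> ax; have [|ab Fb] := @branchP (F x); first by exists x.
by apply: injF; rewrite ?inE.
Qed.

Lemma measurable_branch : measurable_fun (F @` a0) branch.
Proof.
move=> _ B mB; rewrite (_ : _ `&` _ = F @` (a0 `&` B)).
  by apply: imF; [exact: measurableI|move=> ? []].
apply/seteqP; split => [y [ya /= yB]|_ [x [ax Bx] <-]].
  by have [? ?] := branchP ya; exists (branch y).
by split; [exists x|rewrite /preimage /= branchK].
Qed.

(** The term contributed by the branch [a0] to the transfer operator of [F]: inverse Jacobian times
    density at the preimage. *)
Definition branch_density (g : Y -> R) : Y -> R :=
  (fun y => z (branch y) * g (branch y))%R \_ (F @` a0).

Lemma measurable_branch_density g : measurable_fun setT g ->
  measurable_fun setT (branch_density g).
Proof.
move=> mg; apply/(measurable_restrictT _ _).1; first exact: imF.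
by apply: measurable_funM; apply: measurableT_comp => //;
  exact: measurable_branch.
Qed.

(** On the image of [a0], [m] is the push-forward of [nu] restricted to [a0], because nu(E) = m(F
    E); back on [a0], [m] has density [z] with respect to [nu]. *)
Lemma ge0_integral_branch_density (g : Y -> R) (xi : Y -> \bar R) :
  measurable_fun setT g -> (forall x, (0 <= g x)%R) ->
  measurable_fun setT xi -> (forall x, 0 <= xi x) ->
  \int[m]_y ((branch_density g y)%:E * xi y) =
  \int[m]_(x in a0) ((g x)%:E * xi (F x)).
Proof.
move=> mg g0 mxi xi0.
have mFa : measurable (F @` a0) by exact: imF.
pose k y := (z (branch y) * g (branch y))%:E * xi y.
have mk : measurable_fun (F @` a0) k.
  apply: emeasurable_funM; last exact: measurable_funTS.
  apply/measurable_EFinP; apply: measurable_funM; apply: measurableT_comp => //;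
    exact: measurable_branch.
have k0 y : 0 <= k y by rewrite mule_ge0// lee_fin mulr_ge0// ltW.
transitivity (\int[m]_(y in F @` a0) k y).
  rewrite [RHS]integral_mkcond; apply: eq_integral => y _.
  by rewrite /branch_density /patch; case: ifPn => // _; rewrite mul0e.
transitivity (\int[pushforward (mrestr nu ma0) F]_(y in F @` a0) k y).
  apply: eq_measure_integral => A mA AF.
  change (m A = nu (F @^-1` A `&` a0)).
  rewrite nuE; last by move=> ? [].
    congr (m _); apply/seteqP; split => [y Ay|_ [x [Ax ax] <-]//].
    by have [x ax xy] := AF _ Ay; exists x => //; split => //; rewrite /= xy.
  by apply: measurableI => //; rewrite -[_ @^-1` _]setTI; exact: mF.
have mFaF : measurable (F @^-1` (F @` a0)).
  by rewrite -[_ @^-1` _]setTI; exact: mF.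
have mkF : measurable_fun (F @^-1` (F @` a0)) (k \o F).
  apply: (measurable_comp mFa) => //; last exact: measurable_funTS.
  by move=> _ [x ? <-].
rewrite ge0_integral_pushforward//.
have null_a0 : mrestr nu ma0 (~` a0) = 0 by rewrite /mrestr setICl measure0.
rewrite (ge0_negligible_integral (measurableC ma0) mFaF mkF _ null_a0)//; last first.
  by move=> x _; exact: k0.
have -> : F @^-1` (F @` a0) `\` ~` a0 = a0.
  by apply/seteqP; split => [x [_ /contrapT]//|x ax]; split => [|]//; exists x.
transitivity (\int[nu]_(x in a0) (k \o F) x).
  by apply: eq_measure_integral => A mA Aa; rewrite /= /mrestr setIidl.
rewrite (ge0_integral_density mz (fun x => ltW (z0 x)) mE)//.
- apply: eq_integral => x; rewrite inE => ax.
  by rewrite /k /= branchK// EFinM -muleA muleC.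
- apply: emeasurable_funM; first exact/measurable_EFinP/measurable_funTS.
  by apply: measurable_funTS; exact: measurableT_comp.
- by move=> x _; rewrite mule_ge0// lee_fin.
Qed.

(** By positivity of [z]. Since nu(E) = m(F E), it follows that a branch maps null sets to null
    sets. *)
Lemma null_density E : measurable E -> m E = 0 -> nu E = 0.
Proof.
move=> mmE; rewrite mE// => zE.
have mzE : measurable_fun E (EFin \o z).
  by apply/measurable_EFinP; exact: measurable_funTS.
have /(ae_eq_integral_abs nu mmE mzE) zE0 :
    \int[nu]_(x in E) `|(EFin \o z) x| = 0.
  by rewrite -[RHS]zE; apply: eq_integral => x _; rewrite gee0_abs// lee_fin ltW.
apply: measure_negligible => //; apply: negligibleS zE0 => x Ex /= /(_ Ex) [] /eqP.
by rewrite gt_eqF.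
Qed.

End branch.

Local Close Scope ereal_scope.

(** * Transfer of log-Hoelder densities *)

Section holder_densities.
Context (R : realType) (dsp : measure_display) (Y : measurableType dsp).
Variables (m : probability Y R) (dY : Y -> Y -> R) (eta : R).

(** The Hoelder bound on ln g written without logarithm: zeros of g are allowed and the class is
    stable under sums. *)
Definition log_holder (H : R) (A : set Y) (g : Y -> R) : Prop :=
  forall x y, A x -> A y -> g x <= g y * expR (H * dY x y `^ eta).

Definition bounded_density (g : Y -> R) : Prop :=
  [/\ measurable_fun setT g, forall x, 0 <= g x & exists b, forall x, g x <= b].

(** An exceptional null set is unavoidable, since [F] maps each element of the partition onto [Y]
    only up to null sets. *)
Definition holder_density (H : R) (g : Y -> R) : Prop :=
  bounded_density g /\
  exists N, [/\ measurable N, m N = 0%E & log_holder H (~` N) g].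

(** Nothing is asked across different elements: a density restricted to a level set of [tau] may
    jump there. Full branches remove these jumps in [transfer]. *)
Definition piecewise_holder (alpha : set (set Y)) (H : R) (g : Y -> R) : Prop :=
  bounded_density g /\
  exists N, [/\ measurable N, m N = 0%E &
    forall a, alpha a -> log_holder H (a `\` N) g].

End holder_densities.

Local Open Scope ereal_scope.

(** Empty sets pad the enumeration, so that series over nat serve finite and infinite partitions
    alike. *)
Lemma partition_seq (d : measure_display) (Y : measurableType d)
    (alpha : set (set Y)) :
  countable alpha -> partition alpha id [set: Y] -> exists A : nat -> set Y,
  [/\ trivIset setT A, \bigcup_n A n = setT &
    forall n, alpha (A n) \/ A n = set0].
Proof.
move=> /countable_injP [f finj] [cov triv ne].
pose A n := \bigcup_(a in [set a | alpha a /\ f a = n]) a.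
have AE a : alpha a -> A (f a) = a.
  move=> aa; apply/seteqP; split => [x [b [ab fb] bx]|x ax]; last by exists a.
  by rewrite -(finj b a)// inE.
exists A; split.
- move=> i j _ _ [x [[a [aa <-] ax] [b [ab <-] bx]]].
  by rewrite (triv a b)//; exists x.
- rewrite -cov; apply/seteqP; split => x.
    by move=> [n _ [a [aa _] ax]]; exists a.
  by move=> [a aa ax]; exists (f a) => //; rewrite AE.
- move=> n; have [[a aa fa]|h] := pselect (exists2 a, alpha a & f a = n).
    by left; rewrite -fa AE.
  right; apply/seteqP; split => // x [a [aa fa] _]; apply: h.
  by exists a.
Qed.

Section transfer.
Context (R : realType) (dsp : measure_display) (Y : measurableType dsp).
Variables (m : probability Y R) (F : Y -> Y) (dY : Y -> Y -> R).
Variables (alpha : set (set Y)) (zeta : Y -> R) (lambda K eta : R).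
Hypothesis ue : uniformly_expanding m F dY alpha zeta lambda K eta.

Lemma dY_powR_le1 x y : (0 <= dY x y `^ eta <= 1)%R.
Proof.
have /andP[e0 _] := ue_eta ue; have [d0 _ _ _] := ue_metric ue.
rewrite powR_ge0 /=; apply: (@le_trans _ _ (1 `^ eta)%R); last by rewrite powR1.
apply: powR_le => //.
  exact: ltW.
exact: (ue_diam ue).
Qed.

Lemma dY_contraction a x y : alpha a -> a x -> a y ->
  (dY x y `^ eta <= lambda^-1 `^ eta * dY (F x) (F y) `^ eta)%R.
Proof.
move=> aa ax ay; have l0 : (0 < lambda)%R by rewrite (lt_trans _ (ue_lambda ue)).
have /andP[e0 _] := ue_eta ue; have [d0 _ _ _] := ue_metric ue.
rewrite -powRM ?invr_ge0 ?(ltW l0)//; apply: powR_le => //; first exact: ltW.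
by rewrite mulrC ler_pdivlMr// mulrC; exact: (ue_expansion ue) aa ax ay.
Qed.

Lemma zeta_distortion a x y : alpha a -> a x -> a y ->
  (zeta x <= zeta y * expR (K * dY (F x) (F y) `^ eta))%R.
Proof.
move=> aa ax ay; have [_ z0 _] := ue_jacobian ue.
rewrite -[leLHS]lnK ?posrE// -[in leRHS](lnK (z0 y : zeta y \is Num.pos)).
rewrite -expRD ler_expR -lerBlDl.
by rewrite (le_trans (ler_norm _))//; exact: (ue_distortion ue) aa ax ay.
Qed.

(** The bound is proved branch by branch and then summed. Two points with preimages in the same
    element receive K from the distortion of [zeta], and H lambda^(-eta) because the preimages are
    closer by the factor lambda. *)
Lemma transfer (H : R) (g : Y -> R) : (0 <= H)%R ->
  piecewise_holder m dY eta alpha H g ->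
  exists2 g', holder_density m dY eta (K + H * lambda^-1 `^ eta) g' &
  forall xi : Y -> R, measurable_fun setT xi -> (forall y, 0 <= xi y)%R ->
    \int[m]_y (g' y * xi y)%:E = \int[m]_y (g y * xi (F y))%:E.
Proof.
move=> H0 [[mg g0 [b gb]] [N [mN N0 gN]]].
have [[mF _] _ _ _ mal part bij [mz z0 [nu nuF mE]] _ _ _ _ _] := ue.
have [A [trivA covA alA]] := partition_seq (ue_countable ue) part.
pose good_part n (b : set Y) := [/\ measurable b, b `<=` A n /\ m (A n `\` b) = 0,
  set_inj b F,
  forall E, measurable E -> E `<=` b ->
    measurable (F @` E) /\ nu E = m (F @` E) &
  alpha (A n) -> m (~` (F @` b)) = 0].
have /choice [B BP] : forall n, exists b, good_part n b.
  move=> n; have [An|An] := alA n.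
    have [a0 a0P] := bij _ An; exists a0.
    have [ma0 a0A inj im full] := a0P.
    by split => // E mE' Ea0; split; [exact: im mE' Ea0|exact: (nuF _ _ An a0P _ mE' Ea0)].
  exists set0; rewrite /good_part An; split => //; first by split; rewrite ?setD0 ?measure0.
    by move=> x y; rewrite inE.
  - by move=> E _; rewrite subset0 => ->; rewrite image_set0 !measure0.
  - by have [_ _ ne] := part => /ne [].
pose h n := branch_density F zeta (B n) g.
have Bprop n := BP n.
have imB n E : measurable E -> E `<=` B n -> measurable (F @` E).
  by have [_ _ _ im _] := BP n => mE' /(im _ mE') [].
have nuB n E : measurable E -> E `<=` B n -> nu E = m (F @` E).
  by have [_ _ _ im _] := BP n => mE' /(im _ mE') [].
have mB n : measurable (B n) by have [] := BP n.
have injB n : set_inj (B n) F by have [] := BP n.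
have mA n : measurable (A n).
  by have [/mal //|->] := alA n; exact: measurable0.
have mh n : measurable_fun setT (h n).
  exact: (measurable_branch_density (mB n) (injB n) (imB n) mz mg).
have h0 n y : (0 <= h n y)%R.
  rewrite /h /branch_density /patch; case: ifP => // _.
  by rewrite mulr_ge0// ltW.
have hint n xi : measurable_fun setT xi -> (forall y, 0 <= xi y) ->
    \int[m]_y ((h n y)%:E * xi y) = \int[m]_(x in A n) ((g x)%:E * xi (F x)).
  move=> mxi xi0.
  rewrite (ge0_integral_branch_density mF (mB n) (injB n) (imB n) (nuB n)
    mz z0 mE mg g0 mxi xi0).
  have [_ [BA AB0] _ _ _] := BP n.
  have gxi0 x : 0 <= (g x)%:E * xi (F x) by rewrite mule_ge0// lee_fin.
  have mgxi D : measurable_fun D (fun x => (g x)%:E * xi (F x)).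
    apply: measurable_funTS; apply: emeasurable_funM; first exact/measurable_EFinP.
    exact: measurableT_comp.
  rewrite [RHS](ge0_negligible_integral (N := A n `\` B n))//; last first.
    exact: measurableD.
  by rewrite setDD setIidr.
pose hh y := \sum_(n <oo) (h n y)%:E.
have hh0 y : 0 <= hh y by apply: nneseries_ge0 => n _ _; rewrite lee_fin.
have mhh : measurable_fun setT hh.
  by apply: ge0_emeasurable_sum => // n; [move=> y _ _; rewrite lee_fin|
    move=> _; exact/measurable_EFinP].
have hhint (xi : Y -> R) : measurable_fun setT xi -> (forall y, 0 <= xi y)%R ->
    \int[m]_y (hh y * (xi y)%:E) = \int[m]_y (g y * xi (F y))%:E.
  move=> mxi xi0.
  transitivity (\int[m]_y (\sum_(n <oo) ((h n y)%:E * (xi y)%:E))).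
    apply: eq_integral => y _; rewrite /hh muleC -nneseriesZl//.
      by apply: eq_eseriesr => n _; rewrite muleC.
    by move=> n _; rewrite lee_fin.
  have mxiE : measurable_fun setT (EFin \o xi) by exact/measurable_EFinP.
  rewrite integral_nneseries//; last 2 first.
  - by move=> n; apply: emeasurable_funM => //; exact/measurable_EFinP.
  - by move=> n y _; rewrite mule_ge0// lee_fin.
  have xiE0 y : 0 <= (EFin \o xi) y by rewrite /= lee_fin.
  rewrite (eq_eseriesr (fun n _ => hint n (EFin \o xi) mxiE xiE0)).
  rewrite -ge0_integral_bigcup ?covA//.
  - apply: emeasurable_funM; first exact/measurable_EFinP.
    exact: measurableT_comp.
  - by move=> x _; rewrite mule_ge0// lee_fin.
have hh_int : \int[m]_y hh y < +oo.
  have := hhint (cst 1%R) (measurable_cst _) (fun=> ler01).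
  under eq_integral do rewrite mule1.
  move=> ->; under eq_integral do rewrite mulr1.
  apply: (@le_lt_trans _ _ (\int[m]_y (b%:E))).
    apply: ge0_le_integral => //.
    - by move=> y _; rewrite lee_fin.
    - exact/measurable_EFinP.
    - by move=> y _; rewrite lee_fin.
  rewrite integral_cst// [X in _ * X]probability_setT mule1 ltry//.
have mhhoo : measurable (hh @^-1` [set +oo]).
  by rewrite -[_ @^-1` _]setTI; exact: mhh.
have hh_fin : m (hh @^-1` [set +oo]) = 0.
  have /integrable_ae : m.-integrable setT hh.
    apply/integrableP; split => //.
    by under eq_integral do rewrite gee0_abs//.
  move=> /(_ measurableT) hae; apply: measure_negligible => //.
  by apply: negligibleS hae => y /= hy /(_ Logic.I); rewrite hy.
(* Points lacking a preimage outside [N] in some branch. Off this null set all branches can be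
   compared at once. *)
pose Gc := \bigcup_(n in [set n | alpha (A n)]) ~` (F @` (B n `\` N)).
have mFBN n : measurable (F @` (B n `\` N)).
  by apply: (imB n); [exact: measurableD|move=> ? []].
have mGc : measurable Gc by apply: bigcup_measurable => n _; exact: measurableC.
have Gc0 : m Gc = 0.
  apply: measure_negligible => //; rewrite /Gc bigcup_mkcond.
  apply: negligible_bigcup => n; case: ifPn => [|_]; last exact: negligible_set0.
  rewrite inE /= => An; have [_ _ _ _ /(_ An) full] := BP n.
  have mFBI : measurable (F @` (B n `&` N)).
    by apply: (imB n); [exact: measurableI|move=> ? []].
  have mFB : measurable (F @` B n) by exact: (imB n).
  apply: (@negligibleS _ _ _ _ (~` (F @` B n) `|` F @` (B n `&` N))).
    move=> y nFy; have [[x Bx xy]|] := pselect ((F @` B n) y); last by left.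
    right; exists x => //; split => //; apply: contrapT => Nx; apply: nFy.
    by exists x.
  have mBN : measurable (B n `&` N) by exact: measurableI.
  suff FBN0 : m (F @` (B n `&` N)) = 0.
    apply: negligibleU; first by exists (~` (F @` B n)); split => //;
      exact: measurableC.
    by exists (F @` (B n `&` N)); split.
  rewrite -(nuB n)//.
  apply: (null_density mz z0 mE mBN).
  by apply/eqP; rewrite -measure_le0 -N0 le_measure ?inE//; exact: measurableI.
pose N' := Gc `|` hh @^-1` [set +oo].
have mN' : measurable N'.
  exact: measurableU.
have N'0 : m N' = 0 by rewrite measureU0.
set H' := (K + H * lambda^-1 `^ eta)%R.
have hlip n y y' : ~ Gc y -> ~ Gc y' ->
    (h n y <= h n y' * expR (H' * dY y y' `^ eta))%R.
  move=> Gy Gy'; rewrite /h /branch_density /patch.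
  have [An|An] := alA n; last first.
    have [_ [BA _] _ _ _] := BP n; move: BA; rewrite An subset0 => ->.
    by rewrite image_set0 !in_set0 mul0r.
  have inFB x : ~ Gc x -> (F @` (B n `\` N)) x.
    by move=> Gx; apply: contrapT => xF; apply: Gx; exists n.
  have brB x : ~ Gc x -> [/\ x \in F @` B n, A n (branch F (B n) x),
      ~ N (branch F (B n) x) & F (branch F (B n) x) = x].
    move=> /inFB [u [Bu Nu] <-]; rewrite (branchK (injB n) Bu).
    have [_ [BA _] _ _ _] := BP n.
    by split => //; [rewrite inE; exists u|exact: BA].
  have [-> Ay Ny Fy] := brB _ Gy; have [-> Ay' Ny' Fy'] := brB _ Gy'.
  set u := branch F (B n) y in Ay Ny Fy *.
  set u' := branch F (B n) y' in Ay' Ny' Fy' *.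
  have dd := dY_contraction An Ay Ay'; rewrite Fy Fy' in dd.
  have zz := zeta_distortion An Ay Ay'; rewrite Fy Fy' in zz.
  have gg : (g u <= g u' * expR (H * (lambda^-1 `^ eta * dY y y' `^ eta)))%R.
    apply: (le_trans (gN _ An _ _ (conj Ay Ny) (conj Ay' Ny'))).
    by rewrite ler_wpM2l// ler_expR ler_wpM2l.
  apply: (le_trans (ler_pM (ltW (z0 u)) (g0 u) zz gg)).
  by rewrite mulrACA -expRD /H' mulrDl mulrA.
have hhlip y y' : ~ Gc y -> ~ Gc y' ->
    hh y <= (expR (H' * dY y y' `^ eta))%:E * hh y'.
  move=> Gy Gy'; rewrite /hh -nneseriesZl; last by move=> n _; rewrite lee_fin.
  apply: lee_nneseries => n _; first by rewrite lee_fin.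
  by rewrite -EFinM lee_fin mulrC; exact: hlip.
pose g' := (fine \o hh) \_ (~` N').
have g'E y : ~ N' y -> g' y = fine (hh y) /\ (g' y)%:E = hh y.
  move=> Ny; rewrite /g' /patch mem_set//=; split=> //; rewrite fineK//.
  by rewrite ge0_fin_numE// ltey; apply/eqP => hy; apply: Ny; right.
have g'0 y : (0 <= g' y)%R.
  by rewrite /g' /patch; case: ifP => //= _; exact: fine_ge0.
have g'lip : log_holder dY eta H' (~` N') g'.
  move=> y y' Ny Ny'; have [_ gy] := g'E _ Ny; have [_ gy'] := g'E _ Ny'.
  rewrite -lee_fin EFinM gy gy' muleC; apply: hhlip.
    by move=> Gy; apply: Ny; left.
  by move=> Gy; apply: Ny'; left.
exists g'.
  split; last by exists N'.
  split => //.
    apply/(measurable_restrictT _ _).1; first exact: measurableC.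
    by apply: measurable_funTS; exact: measurableT_comp.
  (* A single finite value bounds [g'] everywhere, by the log-Hoelder bound and diam Y <= 1. *)
  have [y0 Ny0] : exists y0, ~ N' y0.
    apply: contrapT => /forallNP Nall; move: N'0.
    rewrite (_ : N' = setT) ?probability_setT; last first.
      by apply/seteqP; split => // y _; apply: contrapT; exact: Nall.
    by case=> /eqP; rewrite oner_eq0.
  exists (g' y0 * expR H')%R => y.
  have H'0 : (0 <= H')%R.
    by rewrite addr_ge0 ?(ltW (ue_K ue))// mulr_ge0// powR_ge0.
  have [Ny|Ny] := pselect (N' y).
    have -> : g' y = 0%R by rewrite /g' /patch memNset//; exact.
    by rewrite mulr_ge0 ?expR_ge0.
  apply: (le_trans (g'lip _ _ Ny Ny0)); rewrite ler_wpM2l// ler_expR.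
  by have /andP[_ d1] := dY_powR_le1 y y0; rewrite ler_piMr.
move=> xi mxi xi0; rewrite -hhint//; under eq_integral do rewrite EFinM.
have mxiE : measurable_fun setT (EFin \o xi) by exact/measurable_EFinP.
have mg' : measurable_fun setT g'.
  apply/(measurable_restrictT _ _).1; first exact: measurableC.
  by apply: measurable_funTS; exact: measurableT_comp.
apply: ge0_ae_eq_integral => //.
- by apply: emeasurable_funM => //; exact/measurable_EFinP.
- exact: emeasurable_funM.
- by move=> y _; rewrite mule_ge0// lee_fin.
- by move=> y _; rewrite mule_ge0// lee_fin.
exists N'; split => // y /= /not_implyP[_ gy]; apply: contrapT => Ny.
by apply: gy; have [_ ->] := g'E _ Ny.
Qed.

End transfer.

Local Close Scope ereal_scope.

(** * Real integrals of bounded measurable functions *)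

Section bounded_measurable.
Context (R : realType) (dsp : measure_display) (Y : measurableType dsp).
Variable m : probability Y R.
Implicit Types f g : Y -> R.

Definition bounded_measurable f : Prop :=
  measurable_fun setT f /\ exists b, forall x, `|f x| <= b.

Lemma bounded_measurable_cst (r : R) : bounded_measurable (fun=> r).
Proof. by split; [exact: measurable_cst|exists `|r|]. Qed.

Lemma bounded_measurableD f g : bounded_measurable f -> bounded_measurable g ->
  bounded_measurable (fun x => f x + g x).
Proof.
move=> [mf [a fa]] [mg [b gb]]; split; first exact: measurable_funD.
by exists (a + b) => x; rewrite (le_trans (ler_normD _ _))// lerD.
Qed.

Lemma bounded_measurableM f g : bounded_measurable f -> bounded_measurable g ->
  bounded_measurable (fun x => f x * g x).
Proof.
move=> [mf [a fa]] [mg [b gb]]; split; first exact: measurable_funM.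
by exists (a * b) => x; rewrite normrM ler_pM.
Qed.

Lemma bounded_measurableB f g : bounded_measurable f -> bounded_measurable g ->
  bounded_measurable (fun x => f x - g x).
Proof.
move=> [mf [a fa]] [mg [b gb]]; split; first exact: measurable_funB.
by exists (a + b) => x; rewrite (le_trans (ler_normB _ _))// lerD.
Qed.

Lemma bounded_measurable_sum n (f : 'I_n -> Y -> R) :
  (forall i, bounded_measurable (f i)) ->
  bounded_measurable (fun x => \sum_(i < n) f i x).
Proof.
elim: n f => [|n IH] f bf.
  rewrite (_ : (fun _ => _) = fun=> 0); first exact: bounded_measurable_cst.
  by apply/funext => x; rewrite big_ord0.
rewrite (_ : (fun _ => _) =
  fun x => f ord0 x + \sum_(i < n) f (lift ord0 i) x); last first.
  by apply/funext => x; rewrite big_ord_recl.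
by apply: bounded_measurableD => //; exact: IH.
Qed.

Lemma bounded_measurable_indic (A : set Y) : measurable A ->
  bounded_measurable (\1_A : Y -> R).
Proof.
move=> mA; split; first exact: measurable_indic.
exists 1 => x; rewrite indicE.
by case: (x \in A); rewrite ?normr0 ?normr1 ?ler01.
Qed.

Lemma bounded_density_measurable g : bounded_density g -> bounded_measurable g.
Proof.
move=> [mg g0 [b gb]]; split=> //; exists b => x.
by rewrite ger0_norm.
Qed.

Lemma bounded_measurable_integrable f : bounded_measurable f ->
  m.-integrable setT (EFin \o f).
Proof.
move=> [mf [b fb]]; apply: measurable_bounded_integrable => //.
  by rewrite [ltLHS]probability_setT ltry.
exists b; split; first exact: num_real.
by move=> x bx y _; apply: (le_trans (fb y)); exact: ltW.
Qed.

Local Notation J f := (\int[m]_y f y).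

Lemma JD f g : bounded_measurable f -> bounded_measurable g ->
  J (fun y => f y + g y) = J f + J g.
Proof. by move=> bf bg; apply: RintegralD => //; exact: bounded_measurable_integrable. Qed.

Lemma JB f g : bounded_measurable f -> bounded_measurable g ->
  J (fun y => f y - g y) = J f - J g.
Proof. by move=> bf bg; apply: RintegralB => //; exact: bounded_measurable_integrable. Qed.

Lemma JZ (r : R) f : bounded_measurable f -> J (fun y => r * f y) = r * J f.
Proof. by move=> bf; apply: RintegralZl => //; exact: bounded_measurable_integrable. Qed.

Lemma J_cst (r : R) : \int[m]_(y in setT) r = r.
Proof. by rewrite Rintegral_cst// [X in fine X]probability_setT mulr1. Qed.

Lemma J_sum n (f : 'I_n -> Y -> R) : (forall i, bounded_measurable (f i)) ->
  J (fun y => \sum_(i < n) f i y) = \sum_(i < n) J (f i).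
Proof.
elim: n f => [|n IH] f bf.
  by under eq_Rintegral do rewrite big_ord0; rewrite J_cst big_ord0.
under eq_Rintegral do rewrite big_ord_recl.
rewrite JD//; last exact: bounded_measurable_sum.
by rewrite big_ord_recl; congr (_ + _); exact: IH.
Qed.

Lemma J_le_ae (N : set Y) f g : measurable N -> m N = 0%E ->
  bounded_measurable f -> bounded_measurable g ->
  (forall x, ~ N x -> f x <= g x) -> J f <= J g.
Proof.
move=> mN N0 bf bg fg.
have mNC : measurable (~` N) by exact: measurableC.
have restr h : bounded_measurable h -> J h = \int[m]_(y in ~` N) h y.
  move=> bh; congr fine.
  rewrite (negligible_integral mN measurableT _ N0) ?setTD//.
  exact: bounded_measurable_integrable.
rewrite (restr f bf) (restr g bg); apply: le_Rintegral => //;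
  apply: integrableS (bounded_measurable_integrable _) => //.
Qed.

Lemma J_le f g : bounded_measurable f -> bounded_measurable g ->
  (forall x, f x <= g x) -> J f <= J g.
Proof.
move=> bf bg fg; apply: (@J_le_ae set0) => //.
Qed.

Lemma J_eq_ae (N : set Y) f g : measurable N -> m N = 0%E ->
  bounded_measurable f -> bounded_measurable g ->
  (forall x, ~ N x -> f x = g x) -> J f = J g.
Proof.
move=> mN N0 bf bg fg; apply/eqP; rewrite eq_le.
by apply/andP; split; apply: (J_le_ae mN N0) => // x Nx; rewrite fg.
Qed.

Lemma J_norm f g : bounded_measurable f -> bounded_measurable g ->
  (forall x, `|f x| <= g x) -> `|J f| <= J g.
Proof.
move=> bf bg fg; rewrite ler_norml; apply/andP; split; last first.
  by apply: J_le => // x; rewrite (le_trans (ler_norm _)).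
rewrite -[J g]mul1r -mulNr -JZ//; apply: J_le => //.
  by apply: bounded_measurableM => //; exact: bounded_measurable_cst.
by move=> x; rewrite mulN1r lerNl (le_trans _ (fg x))// -normrN ler_norm.
Qed.

Lemma J_indic (A : set Y) : measurable A -> J (\1_A : Y -> R) = fine (m A).
Proof.
by move=> mA; rewrite /Rintegral integral_indic// setIT.
Qed.

End bounded_measurable.

(** * The renewal system of the base *)

Section renewal_of_tower.
Context (R : realType) (dsp : measure_display) (Y : measurableType dsp).
Variables (m : probability Y R) (F : Y -> Y) (dY : Y -> Y -> R).
Variables (alpha : set (set Y)) (zeta : Y -> R) (lambda K eta : R).
Hypothesis ue : uniformly_expanding m F dY alpha zeta lambda K eta.
Variables (tau : {mfun Y >-> nat}) (d : nat) (I : seq nat).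
Hypothesis tau_const : forall a x y, alpha a -> a x -> a y -> tau x = tau y.
Variables (H del : R) (psi : nat -> Y -> R).

Let H1 := K + H * lambda^-1 `^ eta.
Hypothesis H_ge1 : 1 <= H.
(** The gap of 1 is spent in [tower_minorP], when a constant is subtracted from a density. *)
Hypothesis H1_le : H1 + 1 <= H.
Hypothesis del_itv : 0 < del <= 1.
Hypothesis d_gt0 : (0 < d)%N.
Hypothesis I_gt0 : forall i, i \in I -> (0 < i)%N.
Hypothesis I_dvd : forall i, i \in I -> (d %| i)%N.
Hypothesis I_del : forall i, i \in I -> (del%:E <= m [set y | tau y = i])%E.
Hypothesis mpsi : forall n, measurable_fun setT (psi n).
Hypothesis psi_le1 : forall n y, `|psi n y| <= 1.
Hypothesis psi_ret : forall n y, (tau y <= n)%N ->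
  psi n y = psi (n - tau y) (F y).

Local Notation J f := (\int[m]_y f y).
Local Notation hd := (holder_density m dY eta).

Lemma H1_ge0 : 0 <= H1.
Proof.
rewrite addr_ge0 ?(ltW (ue_K ue))// mulr_ge0 ?powR_ge0//.
exact: le_trans H_ge1.
Qed.

Lemma hd_bounded G g : hd G g -> bounded_measurable g.
Proof. by move=> [/bounded_density_measurable]. Qed.

Lemma psi_bounded n : bounded_measurable (psi n).
Proof. by split => //; exists 1. Qed.

Lemma holder_densityW G G' g : G <= G' -> hd G g -> hd G' g.
Proof.
move=> GG' [bg [N [mN N0 gN]]]; split => //; exists N; split => // x y Nx Ny.
have [_ g0 _] := bg; rewrite (le_trans (gN _ _ Nx Ny))// ler_wpM2l//.
by rewrite ler_expR ler_wpM2r// powR_ge0.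
Qed.

Lemma holder_densityD G f g : hd G f -> hd G g -> hd G (f + g).
Proof.
move=> [[mf f0 [a fa]] [N [mN N0 fN]]] [[mg g0 [b gb]] [M [mM M0 gM]]]; split.
  split; first exact: measurable_funD.
    by move=> x; rewrite addr_ge0.
  by exists (a + b) => x; rewrite lerD.
exists (N `|` M); split; first exact: measurableU.
  by rewrite measureU0.
move=> x y /not_orP[Nx Mx] /not_orP[Ny My].
by rewrite mulrDl lerD ?fN ?gM.
Qed.

Lemma holder_density_cst G (r : R) : 0 <= r -> 0 <= G -> hd G (fun=> r).
Proof.
move=> r0 G0; split.
  by split => //; exists r.
exists set0; split => //.
move=> x y _ _; rewrite ler_peMr// -[leLHS]expR0 ler_expR mulr_ge0//.
exact: powR_ge0.
Qed.

(** Since diam Y <= 1, almost all values of g agree up to a factor e^G; integrate over one of the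
    two points. *)
Lemma holder_density_ge G g : 0 <= G -> hd G g -> exists N,
  [/\ measurable N, m N = 0%E &
   forall x, ~ N x -> expR (- G) * J g <= g x /\ g x <= expR G * J g].
Proof.
move=> G0 hg; have [[mg g0 _] [N [mN N0 gN]]] := hg.
have bg := hd_bounded hg.
exists N; split => // x Nx.
have dG y : expR (G * dY x y `^ eta) <= expR G /\ expR (G * dY y x `^ eta) <= expR G.
  have /andP[_ d1] := dY_powR_le1 ue x y; have /andP[_ d2] := dY_powR_le1 ue y x.
  by rewrite !ler_expR !ler_piMr.
have up y : ~ N y -> g x <= expR G * g y.
  by move=> Ny; rewrite (le_trans (gN _ _ Nx Ny))// mulrC ler_wpM2r//; have [] := dG y.
have lo y : ~ N y -> g y <= expR G * g x.
  by move=> Ny; rewrite (le_trans (gN _ _ Ny Nx))// mulrC ler_wpM2r//; have [] := dG y.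
have bc r : bounded_measurable (fun _ : Y => r) by exact: bounded_measurable_cst.
split.
  rewrite expRN mulrC ler_pdivrMr ?expR_gt0// mulrC -[leRHS](J_cst m).
  exact: (J_le_ae mN N0).
rewrite -JZ// -[leLHS](J_cst m).
by apply: (J_le_ae mN N0) => //; exact: bounded_measurableM.
Qed.

Definition at_return i : set Y := [set y | tau y = (i.+1 * d)%N].

Lemma measurable_at_return i : measurable (at_return i).
Proof.
rewrite (_ : at_return i = tau @^-1` [set (i.+1 * d)%N]) //.
by rewrite -[_ @^-1` _]setTI; exact: measurable_funPT.
Qed.

Let b1 i : bounded_measurable (\1_(at_return i) : Y -> R).
Proof. exact/bounded_measurable_indic/measurable_at_return. Qed.

(** A signed test function becomes nonnegative after adding a bound [b], and the contributions of
    [b] cancel. *)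
Lemma transfer_bounded (G : R) g : 0 <= G ->
  piecewise_holder m dY eta alpha G g ->
  exists2 g', hd (K + G * lambda^-1 `^ eta) g' &
  forall xi, bounded_measurable xi ->
    J (fun y => g' y * xi y) = J (fun y => g y * xi (F y)).
Proof.
move=> G0 pg; have [g' hg' g'E] := transfer ue G0 pg; exists g' => // xi [mxi [b xib]].
have mF : measurable_fun setT F by case: (ue_nonsingular ue).
have bg : bounded_measurable g by case: pg => /bounded_density_measurable.
have bg' := hd_bounded hg'.
have bxi : bounded_measurable xi by split => //; exists b.
have bxiF : bounded_measurable (xi \o F).
  by split; [exact: measurableT_comp|exists b => x; exact: xib].
have bc r : bounded_measurable (fun _ : Y => r) by exact: bounded_measurable_cst.
have key (u : Y -> R) : measurable_fun setT u -> (forall y, 0 <= u y) ->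
    J (fun y => g' y * u y) = J (fun y => g y * u (F y)).
  by move=> mu u0; rewrite /Rintegral g'E.
have := key _ (measurable_cst b) (fun y => le_trans (normr_ge0 _) (xib y)) => kb.
have : J (fun y => g' y * (b + xi y)) = J (fun y => g y * (b + xi (F y))).
  apply: (key (fun y => b + xi y)); first exact: measurable_funD.
  by move=> y; rewrite -lerBlDl sub0r; have := xib y; rewrite ler_norml => /andP[].
under eq_Rintegral do rewrite mulrDr.
under [in RHS]eq_Rintegral do rewrite mulrDr.
rewrite !JD//; try exact: bounded_measurableM.
by rewrite kb => /addrI.
Qed.

(** The transferred density is known only through its integrals and is obtained only for regular
    [g]; [xget] makes it a total operation. *)
Definition ret_at i (g : Y -> R) : Y -> R :=
  xget 0 [set g' | hd H1 g' /\ forall xi, bounded_measurable xi ->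
    J (fun y => g' y * xi y) = J (fun y => g y * \1_(at_return i) y * xi (F y))].

Lemma ret_atP i g : hd H g -> hd H1 (ret_at i g) /\
  forall xi, bounded_measurable xi -> J (fun y => ret_at i g y * xi y) =
    J (fun y => g y * \1_(at_return i) y * xi (F y)).
Proof.
move=> hg; have [[mg g0 [b gb]] [N [mN N0 gN]]] := hg.
rewrite /ret_at; case: xgetP => [g' _ //|none]; exfalso.
have [||g' hg' g'E] := @transfer_bounded H (fun y => g y * \1_(at_return i) y).
- exact: le_trans H_ge1.
- split.
    split; first by apply: measurable_funM => //; exact/measurable_indic/measurable_at_return.
      by move=> x; rewrite mulr_ge0.
    exists b => x; apply: le_trans (gb x); apply: ler_piMr => //.
  exists N; split => // a aa x y [ax Nx] [ay Ny].
  rewrite mulrAC (_ : \1__ y = \1_(at_return i) x); last first.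
    by rewrite !indicE; congr (_ _)%:R; apply/idP/idP; rewrite !inE /at_return /=
      (tau_const aa ax ay).
  by rewrite ler_wpM2r// gN.
- by apply: (none g'); split.
Qed.

Definition tower_mass (g : Y -> R) : R := J g.

Definition tower_val n (g : Y -> R) : R := J (fun y => g y * psi (n * d) y).

(** When [tau y] is a positive multiple of [d], this is the indicator of n d < tau y. *)
Let not_yet n (y : Y) : R := 1 - \sum_(i < n) \1_(at_return i) y.

Definition tower_late n : R := J (not_yet n).

Lemma not_yet_itv n y : 0 <= not_yet n y <= 1.
Proof.
rewrite subr_ge0 lerBlDr lerDl sumr_ge0// andbT.
have [[i iy]|h] := pselect (exists i : 'I_n, at_return i y).
  rewrite (bigD1 i)//= big1 ?addr0 => [|j ji]; rewrite indicE.
    by case: (_ \in _).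
  rewrite memNset// => jy; move: ji; rewrite /at_return /= in iy jy.
  move: iy; rewrite jy => /eqP; rewrite eqn_pmul2r// eqSS => /eqP ij.
  by rewrite (val_inj ij) eqxx.
rewrite big1// => i _; rewrite indicE memNset// => iy; apply: h.
by exists i.
Qed.

Lemma not_yet_eq0 n i y : (i < n)%N -> at_return i y -> not_yet n y = 0.
Proof.
move=> ni iy; have /andP[n0 _] := not_yet_itv n y; apply/eqP.
rewrite eq_le n0 andbT subr_le0 (bigD1 (Ordinal ni))//= indicE mem_set//.
by rewrite lerDl sumr_ge0.
Qed.

Let bnot n : bounded_measurable (not_yet n).
Proof.
apply: bounded_measurableB; first exact: bounded_measurable_cst.
exact: bounded_measurable_sum.
Qed.

Lemma mass_ret i g : hd H g ->
  tower_mass (ret_at i g) = J (fun y => g y * \1_(at_return i) y).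
Proof.
move=> hg; have [_ /(_ _ (bounded_measurable_cst _ 1))] := ret_atP i hg.
under eq_Rintegral do rewrite mulr1.
by under [in RHS]eq_Rintegral do rewrite mulr1.
Qed.

Lemma val_ret_at n i g : hd H g -> (i < n)%N ->
  tower_val (n - i.+1) (ret_at i g) =
  J (fun y => g y * \1_(at_return i) y * psi (n * d) y).
Proof.
move=> hg ni; have [_ retE] := ret_atP i hg.
rewrite /tower_val retE; last exact: psi_bounded.
apply: eq_Rintegral => y _; have [iy|iy] := pselect (at_return i y).
  have yi : tau y = (i.+1 * d)%N by [].
  by rewrite [in RHS]psi_ret yi ?leq_mul2r ?ni ?orbT// mulnBl.
by rewrite indicE memNset// mulr0 !mul0r.
Qed.

Lemma mass_not_yet n g : hd H g ->
  tower_mass g - \sum_(i < n) tower_mass (ret_at i g) =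
  J (fun y => g y * not_yet n y).
Proof.
move=> hg; have bg := hd_bounded hg.
under eq_bigr do rewrite mass_ret//.
rewrite -J_sum; last by move=> i; exact: bounded_measurableM.
rewrite -JB//; last first.
  by apply: bounded_measurable_sum => i; exact: bounded_measurableM.
by apply: eq_Rintegral => y _; rewrite /not_yet mulrBr mulr1 mulr_sumr.
Qed.

Lemma val_not_yet n g : hd H g ->
  tower_val n g - \sum_(i < n) tower_val (n - i.+1) (ret_at i g) =
  J (fun y => g y * not_yet n y * psi (n * d) y).
Proof.
move=> hg; have bg := hd_bounded hg; have bp := psi_bounded.
under eq_bigr => i _ do rewrite val_ret_at//.
rewrite -J_sum; last by move=> i; do 2 apply: bounded_measurableM => //.
rewrite -JB//; last 2 first.
- exact: bounded_measurableM.
- by apply: bounded_measurable_sum => i; do 2 apply: bounded_measurableM => //.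
apply: eq_Rintegral => y _; rewrite /not_yet mulrBr mulr1 mulrBl.
by rewrite mulr_sumr mulr_suml.
Qed.

Definition tower_minor : R := (2 * H * expR (2 * H))^-1.

Lemma tower_minorP g v : hd H1 g -> 0 <= v <= tower_minor * tower_mass g ->
  exists g', [/\ hd H g', tower_mass g' = tower_mass g - v &
    forall n, tower_val n g' = tower_val n g - v * tower_val n (fun=> 1)].
Proof.
move=> hg /andP[v0 vm]; have [[mg g0 [b gb]] [N [mN N0 gN]]] := hg.
have bg := hd_bounded hg; have H0 : 0 <= H by exact: le_trans H_ge1.
have [M [mM M0 gM]] := holder_density_ge H1_ge0 hg.
have e1 : 1 <= expR H by rewrite -[leLHS]expR0 ler_expR.
have H1H : H1 <= H by rewrite (le_trans _ H1_le)// lerDl.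
have vg x : ~ M x -> v * (H * expR H) <= g x.
  move=> Mx; have [+ _] := gM _ Mx; apply: le_trans.
  have mg0 : 0 <= J g by apply: Rintegral_ge0 => *; exact: g0.
  apply: (@le_trans _ _ (tower_minor * J g * (H * expR H))).
    by rewrite ler_wpM2r// mulr_ge0// expR_ge0.
  rewrite mulrAC ler_wpM2r// /tower_minor mulrC ler_pdivrMr; last first.
    by rewrite !mulr_gt0 ?expR_gt0// (lt_le_trans _ H_ge1).
  rewrite [leRHS](_ : _ = 2 * (H * expR (- H1 + 2 * H))); last first.
    by rewrite expRD; ring.
  have : expR H <= expR (- H1 + 2 * H).
    by rewrite ler_expR mulr_natl mulr2n addrA -[leLHS]add0r lerD2r addrC subr_ge0.
  have : 0 <= H * expR (- H1 + 2 * H) by rewrite mulr_ge0// expR_ge0.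
  move=> h1 h2; have := ler_wpM2l H0 h2; lra.
have vg' x : ~ M x -> v <= g x.
  move=> Mx; rewrite (le_trans _ (vg x Mx))// ler_peMr//.
  by rewrite (le_trans H_ge1)// ler_peMr.
(* Off the null set [M] this is [g y - v]; on [M] the maximum keeps the density nonnegative. *)
pose g' y := Num.max 0 (g y - v).
have bmax : bounded_density g'.
  split; first by apply: measurable_maxr => //; exact: measurable_funB.
    by move=> y; rewrite le_max lexx.
  exists b => y; rewrite ge_max (le_trans (g0 y) (gb y))/=.
  by rewrite lerBlDr (le_trans (gb y))// lerDl.
have g'E x : ~ M x -> g' x = g x - v.
  by move=> Mx; rewrite /g' max_r// subr_ge0 vg'.
have bg' : bounded_measurable g' by exact: bounded_density_measurable.
have bc r : bounded_measurable (fun _ : Y => r) by exact: bounded_measurable_cst.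
exists g'; split.
- split => //; exists (N `|` M); split; first exact: measurableU.
    by rewrite measureU0.
  move=> x y /not_orP[Nx Mx] /not_orP[Ny My].
  rewrite !g'E//; set u := dY x y `^ eta.
  have /andP[u0 u1] : 0 <= u <= 1 by exact: dY_powR_le1 ue x y.
  have gxy : g x <= g y * expR (H1 * u) by exact: gN.
  have a1 : expR (H * u) - 1 <= H * u * expR H.
    have := expR_ge1Dx (- (H * u)); rewrite expRN => a2.
    have : expR (H * u) * (1 - H * u) <= 1.
      by rewrite -ler_pdivlMl ?expR_gt0// mulr1.
    have : H * u * expR (H * u) <= H * u * expR H.
      by rewrite ler_wpM2l ?mulr_ge0// ler_expR ler_piMr.
    lra.
  have a3 : u <= expR (H * u) - expR (H1 * u).
    have -> : H * u = H1 * u + (H - H1) * u by ring.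
    rewrite expRD -[X in _ - X]mulr1 -mulrBr.
    apply: (@le_trans _ _ (1 * ((H - H1) * u))).
      by rewrite mul1r ler_peMl// lerBrDr addrC.
    rewrite ler_pM ?mulr_ge0//; first by rewrite subr_ge0.
      by rewrite -[leLHS]expR0 ler_expR mulr_ge0// H1_ge0.
    by rewrite lerBrDl expR_ge1Dx.
  have a4 := ler_wpM2l v0 a1.
  have a5 := ler_wpM2l (g0 y) a3.
  have a6 := ler_wpM2r u0 (vg _ My).
  lra.
- rewrite /tower_mass (J_eq_ae mM M0 bg' _ g'E); last exact: bounded_measurableB.
  by rewrite JB// J_cst.
- move=> n; rewrite /tower_val.
  have bp := psi_bounded (n * d).
  rewrite -JZ; last exact: bounded_measurableM.
  rewrite -JB; [|exact: bounded_measurableM|]; last first.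
    by do 2 apply: bounded_measurableM => //.
  apply: (J_eq_ae mM M0); first exact: bounded_measurableM.
    apply: bounded_measurableB; first exact: bounded_measurableM.
    by do 2 apply: bounded_measurableM => //.
  by move=> x Mx; rewrite g'E// mul1r mulrBl.
Qed.

Lemma tower_val_le n g : hd H g -> `|tower_val n g| <= tower_mass g.
Proof.
move=> hg; apply: J_norm; [|exact: hd_bounded hg|].
  by apply: bounded_measurableM (psi_bounded _); exact: hd_bounded hg.
move=> x; have [[_ g0 _] _] := hg.
by rewrite normrM (ger0_norm (g0 x)) ler_piMr.
Qed.

Lemma tower_val_ret n g : hd H g ->
  `|tower_val n g - \sum_(i < n) tower_val (n - i.+1) (ret_at i g)| <=
    tower_mass g - \sum_(i < n) tower_mass (ret_at i g).
Proof.
move=> hg; have bg := hd_bounded hg; have bp := psi_bounded.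
rewrite val_not_yet// mass_not_yet//; apply: J_norm.
- by apply: bounded_measurableM => //; exact: bounded_measurableM.
- exact: bounded_measurableM.
move=> x; have [[_ g0 _] _] := hg; have /andP[n0 _] := not_yet_itv n x.
by rewrite normrM ger0_norm ?mulr_ge0// ler_piMr// mulr_ge0.
Qed.

Lemma tower_mass_late n g : hd H g ->
  tower_mass g - \sum_(i < n) tower_mass (ret_at i g) <=
    expR H * tower_late n * tower_mass g.
Proof.
move=> hg; have bg := hd_bounded hg; rewrite mass_not_yet//.
have [N [mN N0 gN]] := holder_density_ge (le_trans ler01 H_ge1) hg.
rewrite mulrAC /tower_late -JZ//; apply: (J_le_ae mN N0).
- exact: bounded_measurableM.
- by apply: bounded_measurableM => //; exact: bounded_measurable_cst.
move=> x Nx; have /andP[n0 _] := not_yet_itv n x.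
by rewrite ler_wpM2r//; have [] := gN _ Nx.
Qed.

Lemma tower_mass_hit i g : i.+1 \in [seq (k %/ d)%N | k <- I] -> hd H g ->
  expR (- H) * del * tower_mass g <= tower_mass (ret_at i g).
Proof.
move=> /mapP[k kI ki] hg; have bg := hd_bounded hg; rewrite mass_ret//.
have kE : k = (i.+1 * d)%N by rewrite ki divnK// I_dvd.
have [N [mN N0 gN]] := holder_density_ge (le_trans ler01 H_ge1) hg.
have mg0 : 0 <= J g by have [[_ g0 _] _] := hg; apply: Rintegral_ge0.
apply: (@le_trans _ _ (expR (- H) * J g * J (\1_(at_return i) : Y -> R))).
  rewrite mulrAC ler_wpM2l ?mulr_ge0 ?expR_ge0//.
  rewrite J_indic; last exact: measurable_at_return.
  rewrite -lee_fin fineK; last exact: fin_num_measure (measurable_at_return i).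
  by have := I_del kI; rewrite kE.
rewrite -JZ//; apply: (J_le_ae mN N0).
- by apply: bounded_measurableM => //; exact: bounded_measurable_cst.
- exact: bounded_measurableM.
move=> x Nx; rewrite ler_wpM2r//; last by have [] := gN _ Nx.
Qed.

Lemma tower_massD f g : hd H f -> hd H g ->
  tower_mass (f + g) = tower_mass f + tower_mass g.
Proof. by move=> hf hg; apply: JD; [exact: hd_bounded hf|exact: hd_bounded hg]. Qed.

Lemma tower_valD n f g : hd H f -> hd H g ->
  tower_val n (f + g) = tower_val n f + tower_val n g.
Proof.
move=> /hd_bounded bf /hd_bounded bg; have bp := psi_bounded (n * d).
rewrite /tower_val -JD; try exact: bounded_measurableM.
by apply: eq_Rintegral => y _; rewrite mulrDl.
Qed.

Lemma tower_mass_ge0 g : hd H g -> 0 <= tower_mass g.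
Proof. by move=> [[_ g0 _] _]; apply: Rintegral_ge0. Qed.

Lemma tower_mass0 : tower_mass 0 = 0.
Proof. exact: J_cst. Qed.

Lemma tower_val0 n : tower_val n 0 = 0.
Proof.
rewrite /tower_val -[RHS](J_cst m).
by apply: eq_Rintegral => y _; rewrite mul0r.
Qed.

Lemma tower_late_ge0 n : 0 <= tower_late n.
Proof. by apply: Rintegral_ge0 => y _; have /andP[] := not_yet_itv n y. Qed.

Let H_ge0 : 0 <= H. Proof. exact: le_trans H_ge1. Qed.

Let expH_ge1 : 1 <= expR H.
Proof. by rewrite -[leLHS]expR0 ler_expR. Qed.

Lemma tower_minor_itv : 0 < tower_minor <= 1 / 2.
Proof.
have H0 : 0 < H by exact: lt_le_trans H_ge1.
have e2 : 1 <= expR (2 * H) by rewrite -[leLHS]expR0 ler_expR mulr_ge0.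
rewrite /tower_minor invr_gt0 !mulr_gt0 ?expR_gt0//= div1r.
by rewrite lef_pV2 ?posrE ?mulr_gt0 ?expR_gt0// -mulrA ler_peMr// mulr_ege1.
Qed.

Lemma tower_hit_itv : 0 < expR (- H) * del <= 1.
Proof.
have /andP[d0 d1] := del_itv; rewrite mulr_gt0 ?expR_gt0//=.
by rewrite mulr_ile1 ?expR_ge0 ?(ltW d0)// -[leRHS]expR0 ler_expR oppr_le0.
Qed.

Lemma tower_returns_gt0 : all (ltn 0) [seq (k %/ d)%N | k <- I].
Proof.
apply/allP => _ /mapP[k kI ->] /=.
by rewrite divn_gt0// dvdn_leq ?I_gt0 ?I_dvd.
Qed.

Definition tower_system : renewal_system R (Y -> R) :=
  @RenewalSystem R (Y -> R) (hd H) (hd H1) tower_mass tower_val ret_at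
  tower_late (fun=> 1) [seq (k %/ d)%N | k <- I] (expR H)
  (expR (- H) * del) tower_minor
  (fun g => @holder_densityW H1 H g (le_trans (ler_wpDr ler01 (lexx H1)) H1_le))
  (@holder_densityD H) (holder_density_cst (lexx 0) H1_ge0)
  (@holder_densityD H1) tower_mass0 tower_massD tower_mass_ge0 tower_val0
  tower_valD tower_val_le (fun i g hg => (ret_atP i hg).1) tower_val_ret
  tower_mass_late tower_mass_hit tower_returns_gt0 tower_minorP
  (holder_density_cst ler01 H_ge0) (J_cst m 1) tower_late_ge0 expH_ge1
  tower_hit_itv tower_minor_itv.

End renewal_of_tower.

(** * Residual times *)

Section tower_orbits.
Context (R : realType) (dsp : measure_display) (Y : measurableType dsp).
Variables (F : Y -> Y) (tau : {mfun Y >-> nat}).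
Local Notation T := (tower_map tau F).

Lemma iter_tower_map_up k y l : (l + k < tau y)%N ->
  iter k T (y, l) = (y, l + k)%N.
Proof.
elim: k => [|k IH] lk /=; first by rewrite addn0.
rewrite IH; last by rewrite (leq_trans _ lk)// addnS.
by rewrite /tower_map /= -addnS lk.
Qed.

Lemma iter_tower_map_return n y r : (0 < r <= tau y)%N -> (r <= n)%N ->
  iter n T (y, tau y - r)%N = iter (n - r) T (F y, 0%N).
Proof.
case: r => // r /andP[_ rt] rn; rewrite -[in LHS](subnK rn) iterD; congr iter.
rewrite iterS iter_tower_map_up; last by rewrite subnS -ltnS; lia.
by rewrite /tower_map /= (_ : _ < _ = false)%N//; lia.
Qed.

Lemma measurable_nat_section (G : Y -> nat -> R) :
  (forall k, measurable_fun setT (G ^~ k)) ->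
  measurable_fun setT (fun y => G y (tau y)).
Proof.
move=> mG _ B mB; rewrite setTI.
rewrite (_ : _ @^-1` _ =
    \bigcup_k ((tau @^-1` [set k]) `&` ((G ^~ k) @^-1` B))); last first.
  apply/seteqP; split => [y /= By|y [k _ [/= <-]]]//.
  by exists (tau y).
apply: bigcupT_measurable => k; apply: measurableI.
  by rewrite -[_ @^-1` _]setTI; exact: measurable_funPT.
by rewrite -[_ @^-1` _]setTI; exact: mG.
Qed.

Lemma measurable_section (f : Y * nat -> R) k :
  measurable_fun setT f -> measurable_fun setT (fun y => f (y, k)).
Proof. by move=> mf; apply: measurableT_comp => //; exact: measurable_pair2. Qed.

Lemma measurable_tower_map : measurable_fun setT F -> measurable_fun setT T.
Proof.
move=> mF; have mS (g : Y * nat -> nat) : measurable_fun setT g ->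
    measurable_fun setT (fun x => (g x).+1).
  by move=> mg; apply: (@measurableT_comp _ _ _ _ _ _ S).
apply: (@measurable_fun_ifT _ _ _ _ (fun x => (x.1, x.2.+1))
  (fun x => (F x.1, 0%N)) (fun x => (x.2.+1 < tau x.1)%N)).
- apply: measurable_fun_ltn; first exact: mS.
  by apply: measurableT_comp => //; exact: measurable_funPT.
- by apply: measurable_fun_pair => //; exact: mS.
- by apply: measurable_fun_pair => //; exact: measurableT_comp.
Qed.

Lemma measurable_iter_tower_map n : measurable_fun setT F ->
  measurable_fun setT (iter n T).
Proof.
move=> mF; elim: n => [|n IH]; first exact: measurable_id.
exact: (measurableT_comp (measurable_tower_map mF) IH).
Qed.

End tower_orbits.

(** * Sums over the residue classes of the residual time *)

Section class_sums.
Context (R : realType) (dsp : measure_display) (Y : measurableType dsp).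
Variables (m : probability Y R) (tau : {mfun Y >-> nat}) (d : nat).
(* The point of [Delta] above [y] returning to the base after [r] steps is
   [(y, tau y - r)]. *)
Definition at_residual (f : Y * nat -> R) (r : nat) (y : Y) : R :=
  if (0 < r <= tau y)%N then f (y, tau y - r)%N else 0.

Definition class_sum (c : nat) (f : Y * nat -> R) (y : Y) : R :=
  \sum_(i < (tau y).+1) at_residual f (i * d + c) y.

Lemma measurable_at_residual f r : measurable_fun setT f ->
  measurable_fun setT (at_residual f r).
Proof.
move=> mf; apply: (@measurable_nat_section _ _ _ tau
  (fun y k => if (0 < r <= k)%N then f (y, k - r)%N else 0)) => k /=.
by case: (0 < r <= k)%N; [exact: measurable_section|exact: measurable_cst].
Qed.

Lemma measurable_class_sum c f : measurable_fun setT f ->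
  measurable_fun setT (class_sum c f).
Proof.
move=> mf; apply: (@measurable_nat_section _ _ _ tau (fun y k => \sum_(i < k.+1)
   if (0 < i * d + c <= k)%N then f (y, k - (i * d + c))%N else 0)) => k.
apply: measurable_sum => i /=.
by case: (0 < i * d + c <= k)%N; [exact: measurable_section|exact: measurable_cst].
Qed.

Lemma at_residual_norm f g r y : (forall x, Delta tau x -> `|f x| <= g x) ->
  `|at_residual f r y| <= at_residual g r y.
Proof.
rewrite /at_residual => fg; case: ifP => [/andP[r0 rt]|]; last by rewrite normr0.
by apply: fg; rewrite /Delta /=; lia.
Qed.

Lemma at_residual_ge0 f r y : (forall x, Delta tau x -> 0 <= f x) ->
  0 <= at_residual f r y.
Proof.
rewrite /at_residual => fg; case: ifP => // /andP[r0 rt]; apply: fg.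
by rewrite /Delta /=; lia.
Qed.

Hypothesis d_gt0 : (0 < d)%N.

Lemma at_residual_big f i c y : (tau y < i)%N -> at_residual f (i * d + c) y = 0.
Proof.
move=> ti; rewrite /at_residual (_ : (_ <= tau y)%N = false) ?andbF//.
by have := leq_pmulr i d_gt0; lia.
Qed.

(* Both sides only differ by the residual times beyond [n]. *)
Lemma class_sum_late c f g n y : (forall x, Delta tau x -> `|f x| <= g x) ->
  `|class_sum c f y - \sum_(i < n) at_residual f (i * d + c) y| <=
  class_sum c g y - \sum_(i < n) at_residual g (i * d + c) y.
Proof.
move=> fg; rewrite /class_sum -!(big_mkord xpredT (fun i => at_residual _ (i * d + c) y)).
have [nt|tn] := leqP n (tau y).+1.
  rewrite !(@big_cat_nat _ _ _ n 0 (tau y).+1)//= ![_ + \sum_(n <= i < _) _]addrC !addrK.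
  rewrite (le_trans (ler_norm_sum _ _ _))// ler_sum// => i _.
  exact: at_residual_norm.
have z h : \sum_(0 <= i < n) at_residual h (i * d + c) y =
    \sum_(0 <= i < (tau y).+1) at_residual h (i * d + c) y.
  rewrite (@big_cat_nat _ _ _ (tau y).+1 0 n) ?(ltnW tn)//= [X in _ + X]big_nat.
  by rewrite [X in _ + X]big1 ?addr0// => i /andP[ti _]; exact: at_residual_big.
by rewrite !z !subrr normr0.
Qed.

Lemma class_sum_late_le (b : R) c n y : 0 <= b ->
  class_sum c (fun=> b) y -
    \sum_(i < n.+1) at_residual (fun=> b) (i * d + c) y <= b * (tau y - n)%:R.
Proof.
move=> b0; have res0 i : 0 <= at_residual (fun=> b) i y by exact: at_residual_ge0.
rewrite /class_sum -!(big_mkord xpredT (fun i => at_residual _ (i * d + c) y)).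
have [nt|tn] := leqP n (tau y).
  rewrite (@big_cat_nat _ _ _ n.+1 0 (tau y).+1)//= addrAC subrr add0r.
  rewrite mulr_natr -subSS -sumr_const_nat; apply: ler_sum => i _.
  by rewrite /at_residual; case: ifP.
rewrite [X in _ - X](@big_cat_nat _ _ _ (tau y).+1 0 n.+1) ?(leqW tn)//=.
rewrite opprD addrA subrr sub0r (@le_trans _ _ 0) ?mulr_ge0// oppr_le0.
by apply: sumr_ge0.
Qed.

Lemma class_sum_norm c f g y : (forall x, Delta tau x -> `|f x| <= g x) ->
  `|class_sum c f y| <= class_sum c g y.
Proof. by move=> /(class_sum_late c 0 y); rewrite !big_ord0 !subr0. Qed.

(** Every residual time is i d + c for exactly one pair with c < d, and r = tau y - l matches
    residual times with levels. The values r = 0 and r > tau y contribute 0. *)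
Lemma class_sum_all f y :
  \sum_(c < d) class_sum c f y = \sum_(l < tau y) f (y, val l).
Proof.
rewrite exchange_big /= -(big_mkord xpredT (fun i => \sum_(c < d) at_residual f (i * d + c) y)).
have -> n : \sum_(0 <= i < n) \sum_(c < d) at_residual f (i * d + c) y =
    \sum_(0 <= r < n * d) at_residual f r y.
  elim: n => [|n IH]; first by rewrite !big_geq.
  rewrite big_nat_recr//= IH mulSn addnC [RHS](@big_cat_nat _ _ _ (n * d))//=.
    congr (_ + _); rewrite -{2}[(n * d)%N]add0n [(_ + d)%N]addnC big_addn addnK.
    by rewrite big_mkord; apply: eq_bigr => c _; rewrite addnC.
  exact: leq_addr.
rewrite (@big_cat_nat _ _ _ (tau y).+1)//=; last by rewrite leq_pmulr.
rewrite [X in _ + X]big_nat [X in _ + X]big1 ?addr0; last first.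
  by move=> r /andP[tr _]; rewrite /at_residual (ltn_geF tr) andbF.
rewrite big_nat_recl//= {1}/at_residual /= add0r big_nat_rev add0n /=.
rewrite -(big_mkord xpredT (fun l => f (y, l))); apply: eq_big_nat => l /andP[_ lt].
rewrite /at_residual (_ : (_ < _ <= _)%N = true); last by apply/andP; split; lia.
by congr (f (y, _)); lia.
Qed.

Variable alpha : set (set Y).
Hypothesis rt : return_time m tau alpha.

Definition tower_bounded (f : Y * nat -> R) : Prop :=
  measurable_fun setT f /\ exists b, forall x, Delta tau x -> `|f x| <= b.

Lemma class_sum_le (b : R) c y : 0 <= b ->
  class_sum c (fun=> b) y <= b * (tau y).+1%:R.
Proof.
move=> b0; rewrite mulr_natr -[X in _ *+ X]card_ord -sumr_const.
by apply: ler_sum => i _; rewrite /at_residual; case: ifP.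
Qed.

Lemma integrable_tau1 : m.-integrable setT (fun y => (tau y).+1%:R%:E).
Proof.
have [_ it _] := rt.
under eq_fun do rewrite -natr1 EFinD.
by apply: integrableD => //; apply: finite_measure_integrable_cst.
Qed.

Lemma class_sum_integrable c f : tower_bounded f ->
  m.-integrable setT (EFin \o class_sum c f).
Proof.
move=> [mf [b fb]].
apply: (@le_integrable _ _ _ _ _ measurableT _
  (fun y => (`|b| * (tau y).+1%:R)%:E)).
- by apply/measurable_EFinP; exact: measurable_class_sum.
- move=> y _; rewrite lee_fin [leRHS]ger0_norm ?mulr_ge0//.
  apply: le_trans (class_sum_le _ _ (normr_ge0 b)).
  by apply: class_sum_norm => x Dx; rewrite (le_trans (fb x Dx))// ler_norm.
- under eq_fun do rewrite EFinM.
  exact: integrableZl integrable_tau1.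
Qed.

End class_sums.

(** The [drop] of the renewal system of a tower, written out because the rates are fixed before any
    tower is given. *)
Definition tower_drop (R : realType) (H del : R) (L v0 : nat) : R :=
  tower_minor H * ((expR (- H) * del) ^+ delay L v0 / (2 * L.+1%:R)).

(** * Laws on the tower as states of the renewal system *)

Section tower_coupling.
Context (R : realType) (dsp : measure_display) (Y : measurableType dsp).
Variables (m : probability Y R) (F : Y -> Y) (dY : Y -> Y -> R).
Variables (alpha : set (set Y)) (zeta : Y -> R) (lambda K eta : R).
Hypothesis ue : uniformly_expanding m F dY alpha zeta lambda K eta.
Variables (tau : {mfun Y >-> nat}) (d : nat) (I : seq nat).
Hypothesis rt : return_time m tau alpha.
Hypothesis d_gt0 : (0 < d)%N.
Variable Nd : set Y.
Hypotheses (mNd : measurable Nd) (Nd0 : m Nd = 0%E).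
Hypothesis d_tau : forall y, ~ Nd y -> (d %| tau y)%N.
Variables (H del : R).
Hypothesis H_ge1 : 1 <= H.
Hypothesis H1_le : K + H * lambda^-1 `^ eta + 1 <= H.
Hypothesis del_itv : 0 < del <= 1.
Hypothesis I_gt0 : forall i, i \in I -> (0 < i)%N.
Hypothesis I_dvd : forall i, i \in I -> (d %| i)%N.
Hypothesis I_del : forall i, i \in I -> (del%:E <= m [set y | tau y = i])%E.
Variable Psi : Y * nat -> R.
Hypothesis mPsi : measurable_fun setT Psi.
Hypothesis Psi_le1 : forall x, `|Psi x| <= 1.

Local Notation T := (tower_map tau F).
Local Notation J f := (\int[m]_y f y).
Local Notation hd := (holder_density m dY eta).

Definition base_obs n (y : Y) : R := Psi (iter n T (y, 0%N)).

Let mF : measurable_fun setT F. Proof. by case: (ue_nonsingular ue). Qed.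

Lemma measurable_base_obs n : measurable_fun setT (base_obs n).
Proof.
apply: (@measurable_section _ _ _ (Psi \o iter n T) 0%N).
by apply: measurableT_comp => //; exact: measurable_iter_tower_map.
Qed.

Lemma base_obs_le1 n y : `|base_obs n y| <= 1.
Proof. exact: Psi_le1. Qed.

Let tau_gt0 y : (0 < tau y)%N. Proof. by case: rt. Qed.

Lemma base_obs_ret n y : (tau y <= n)%N ->
  base_obs n y = base_obs (n - tau y) (F y).
Proof.
move=> tn; rewrite /base_obs -(@iter_tower_map_return _ _ _ _ n y (tau y)) ?subnn//.
by rewrite tau_gt0/=.
Qed.

Let tau_const a x y : alpha a -> a x -> a y -> tau x = tau y.
Proof. by case: rt => _ _; exact. Qed.

Definition tower_renewal : renewal_system R (Y -> R) :=
  tower_system ue tau_const H_ge1 H1_le del_itv d_gt0 I_gt0 I_dvd I_del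
    measurable_base_obs base_obs_le1 base_obs_ret.

Local Notation Q := tower_renewal.

Variables (h : nat -> R) (L v0 : nat) (rate : nat -> R).
Hypothesis h_tail : forall k n,
  \sum_(i < n) fine (m [set y | (k + i.+1 <= tau y)%N]) <= h k.
Hypothesis h0 : 1 <= h 0.
Hypothesis hL : expR H * h L <= 1 / 2.
Hypothesis v0P : forall v, (v0 <= v)%N ->
  nsemigroup [seq (k %/ d)%N | k <- I] v.

Lemma measurable_tau_ge k : measurable [set y | (k <= tau y)%N].
Proof.
rewrite (_ : [set _ | _] = tau @^-1` [set j | (k <= j)%N]) //.
by rewrite -[_ @^-1` _]setTI; exact: measurable_funPT.
Qed.

(** Almost everywhere [tau] is a positive multiple of [d]. Having no return within N units of d
    steps then forces tau > N d >= N, so the tails of [tau] serve in the time unit d without any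
    extra constant. *)
Lemma sum_late_le n k : \sum_(i < k) late Q (n + i.+1) <= h n.
Proof.
apply: le_trans (h_tail n k); apply: ler_sum => -[i /= _] _.
rewrite -J_indic; last exact: measurable_tau_ge.
have bi : bounded_measurable (\1_[set y | (n + i.+1 <= tau y)%N] : Y -> R).
  exact/bounded_measurable_indic/measurable_tau_ge.
apply: (J_le_ae mNd Nd0) => //.
  apply: bounded_measurableB; first exact: bounded_measurable_cst.
  apply: bounded_measurable_sum => j.
  exact/bounded_measurable_indic/measurable_at_return.
move=> y /d_tau /dvdnP[[|j] tauE].
  by have := tau_gt0 y; rewrite tauE.
have /andP[_ n1] := not_yet_itv R tau d_gt0 (n + i.+1) y.
rewrite indicE; case: (boolP (y \in _)) => [_ //|]; rewrite notin_setE /= => lt.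
have jn : (j < n + i.+1)%N.
  by move/negP: lt; rewrite -ltnNge tauE; have := leq_pmulr j.+1 d_gt0; lia.
by rewrite (not_yet_eq0 _ d_gt0 jn).
Qed.

Lemma integrable_excess k : m.-integrable setT (fun y => (tau y - k)%:R%:E).
Proof.
have [_ it _] := rt; apply: (le_integrable measurableT _ _ it).
  apply/measurable_EFinP.
  exact: (@measurable_nat_section _ _ _ tau (fun _ j => (j - k)%:R)).
by move=> y _; rewrite lee_fin !normr_nat ler_nat leq_subr.
Qed.

(** Layer-cake formula: the truncated difference tau - k is the sum over i of the indicators of tau
    >= k + i + 1. *)
Lemma excess_tau_le k : J (fun y => (tau y - k)%:R) <= h k.
Proof.
have fin_excess : (\int[m]_y (tau y - k)%:R%:E)%E \is a fin_num.
  exact: integrable_fin_num (integrable_excess k).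
rewrite -lee_fin fineK//.
have excessE y : ((tau y - k)%:R%:E =
    \sum_(i <oo) (\1_[set y | (k + i.+1 <= tau y)%N] y)%:E :> \bar R)%E.
  rewrite (nneseries_split 0 (tau y - k)); last by move=> *; rewrite lee_fin.
  rewrite add0n [X in (_ + X)%E]eseries0 ?adde0; last first.
    move=> i ki _; rewrite indicE memNset//= => ik; move: ki ik.
    by rewrite leq_subLR; lia.
  rewrite sumEFin; congr EFin; rewrite big_nat (eq_bigr (fun=> 1)); last first.
    by move=> i /andP[_ ik]; rewrite indicE mem_set//=; lia.
  by rewrite -big_nat sumr_const_nat subn0.
under eq_integral do rewrite excessE.
rewrite integral_nneseries//; last first.
  move=> i; apply/measurable_EFinP; apply: measurable_indic.
  exact: measurable_tau_ge.
apply: lime_le.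
  by apply: is_cvg_nneseries => i _ _; apply: integral_ge0 => y _; rewrite lee_fin.
near=> n; rewrite big_mkord.
rewrite (eq_bigr (fun i : 'I_n =>
    (fine (m [set y | (k + i.+1 <= tau y)%N]))%:E)); last first.
  move=> i _; rewrite integral_indic ?setIT//; last exact: measurable_tau_ge.
  by rewrite fineK// fin_num_measure//; exact: measurable_tau_ge.
by rewrite sumEFin lee_fin; exact: h_tail.
Unshelve. all: by end_near. Qed.

Variable u : Y * nat -> R.
Hypothesis mu : measurable_fun setT u.
Hypothesis u_itv : forall x, Delta tau x -> 1 <= u x <= 3.
Hypothesis u_holder : forall y y' l, Delta tau (y, l) -> Delta tau (y', l) ->
  u (y, l) <= u (y', l) * expR (dY y y' `^ eta).
Variable c : nat.
Hypothesis cd : (c < d)%N.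

Let u_ge0 x : Delta tau x -> 0 <= u x.
Proof. by move=> /u_itv /andP[u1 _]; exact: le_trans u1. Qed.

Let u_norm x : Delta tau x -> `|u x| <= u x.
Proof. by move=> /u_ge0 ?; rewrite ger0_norm. Qed.

Lemma at_residual_bounded r : bounded_density (at_residual tau u r).
Proof.
split; first exact: measurable_at_residual.
  by move=> y; exact: at_residual_ge0.
exists 3 => y; rewrite /at_residual; case: ifP => // /andP[r0 rtau].
have Dy : Delta tau (y, (tau y - r)%N) by rewrite /Delta /=; lia.
by have /andP[] := u_itv Dy.
Qed.

(** [tau] is constant on an element of the partition, so a given residual time selects the same
    level above all its points. *)
Lemma at_residual_holder r :
  piecewise_holder m dY eta alpha 1 (at_residual tau u r).
Proof.
split; first exact: at_residual_bounded.
exists set0; split => // a aa x y [ax _] [ay _].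
rewrite /at_residual (tau_const aa ax ay); case: ifP => [/andP[r0 rtau]|_].
  by rewrite mul1r; apply: u_holder; rewrite /Delta /= ?(tau_const aa ax ay); lia.
by rewrite mul0r.
Qed.

Let init_ex i : exists g, hd H g /\ forall xi, bounded_measurable xi ->
  J (fun y => g y * xi y) =
  J (fun y => at_residual tau u (i * d + c) y * xi (F y)).
Proof.
have [g hg gE] := transfer_bounded ue ler01 (at_residual_holder (i * d + c)).
exists g; split => //; apply: holder_densityW hg.
rewrite (le_trans _ H1_le)// -[leLHS]addr0 lerD// lerD2l ler_wpM2r// powR_ge0//.
Qed.

Definition initial i : Y -> R := projT1 (cid (init_ex i)).

Lemma initialP i : hd H (initial i) /\ forall xi, bounded_measurable xi ->
  J (fun y => initial i y * xi y) =
  J (fun y => at_residual tau u (i * d + c) y * xi (F y)).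
Proof. by rewrite /initial; case: cid. Qed.

Definition class_integral n : R :=
  J (class_sum tau d c (fun x => u x * Psi (iter (n * d + c) T x))).

(** Time n of this state is time n d + c of the tower, so that all points of the class [c] arrive at
    integer times. *)
Definition initial_state : state R (Y -> R) :=
  State initial (fun n => class_integral n -
    \sum_(i < n.+1) obs Q (n - i) (initial i))
  (J (class_sum tau d c u)).

Lemma mass_initial i : mass Q (initial i) = J (at_residual tau u (i * d + c)).
Proof.
have [_ /(_ _ (bounded_measurable_cst _ 1))] := initialP i.
under eq_Rintegral do rewrite mulr1.
by under [in RHS]eq_Rintegral do rewrite mulr1.
Qed.

Lemma obs_initial n i : (i <= n)%N -> obs Q (n - i) (initial i) =
  J (at_residual tau (fun x => u x * Psi (iter (n * d + c) T x)) (i * d + c)).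
Proof.
move=> ni; have [_ gE] := initialP i.
rewrite /= /tower_val gE; last first.
  by split; [exact: measurable_base_obs|exists 1; exact: base_obs_le1].
apply: eq_Rintegral => y _; rewrite /at_residual; case: ifP => rtau; last first.
  by rewrite mul0r.
rewrite iter_tower_map_return//; last by rewrite leq_add2r leq_mul2r ni orbT.
by rewrite subnDr mulnBl.
Qed.

Lemma value_initial n : value Q initial_state n = class_integral n.
Proof. by rewrite /value /= addrC subrK. Qed.

Let tb_u : tower_bounded tau u.
Proof.
split=> //; exists 3 => x Dx; rewrite ger0_norm ?u_ge0//.
by have /andP[] := u_itv Dx.
Qed.

Let uPsi n x := u x * Psi (iter (n * d + c) T x).

Let tb_uPsi n : tower_bounded tau (uPsi n).
Proof.
have [_ [b ub]] := tb_u; split.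
  apply: measurable_funM => //; apply: measurableT_comp => //.
  exact: measurable_iter_tower_map.
by exists b => x Dx; rewrite normrM (le_trans _ (ub x Dx))// ler_piMr.
Qed.
Let int_class (f : Y * nat -> R) : tower_bounded tau f ->
  m.-integrable setT (EFin \o class_sum tau d c f).
Proof. by move=> bf; apply: (class_sum_integrable d_gt0 rt). Qed.

Let bm_residual (f : Y * nat -> R) r : tower_bounded tau f ->
  bounded_measurable (at_residual tau f r).
Proof.
move=> [mf [b fb]]; split; first exact: measurable_at_residual.
exists `|b| => y; have := @at_residual_norm _ _ _ tau f (fun=> `|b|) r y.
move=> /(_ _)/le_trans; apply; last by rewrite /at_residual; case: ifP.
by move=> x Dx; rewrite (le_trans (fb x Dx))// ler_norm.
Qed.

Let bm_sum (f : Y * nat -> R) n : tower_bounded tau f -> bounded_measurable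
  (fun y => \sum_(i < n) at_residual tau f (i * d + c) y).
Proof. by move=> bf; apply: bounded_measurable_sum => i; exact: bm_residual. Qed.

Let int_late (f : Y * nat -> R) n : tower_bounded tau f -> m.-integrable setT
  (EFin \o (fun y => class_sum tau d c f y -
    \sum_(i < n) at_residual tau f (i * d + c) y)).
Proof.
move=> bf; rewrite (_ : _ \o _ = fun y => ((class_sum tau d c f y)%:E -
  (\sum_(i < n) at_residual tau f (i * d + c) y)%:E)%E)//.
apply: integrableB => //; first exact: int_class.
by apply: bounded_measurable_integrable; exact: bm_sum.
Qed.

Let J_late (f : Y * nat -> R) n : tower_bounded tau f ->
  J (class_sum tau d c f) - \sum_(i < n) J (at_residual tau f (i * d + c)) =
  J (fun y => class_sum tau d c f y -
    \sum_(i < n) at_residual tau f (i * d + c) y).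
Proof.
move=> bf; rewrite RintegralB//; [|exact: int_class|]; last first.
  by apply: bounded_measurable_integrable; exact: bm_sum.
by congr (_ - _); rewrite J_sum// => i; exact: bm_residual.
Qed.

Lemma tail_initial k : tail Q initial_state k =
  J (fun y => class_sum tau d c u y -
    \sum_(i < k.+1) at_residual tau u (i * d + c) y).
Proof.
rewrite /tail /arrived /= -J_late//; congr (_ - _).
by apply: eq_bigr => i _; exact: mass_initial.
Qed.

Lemma valid_initial : valid Q initial_state.
Proof.
split=> [j|n]; first by have [] := initialP j.
rewrite tail_initial /=.
have -> : \sum_(i < n.+1) obs Q (n - i) (initial i) =
    \sum_(i < n.+1) J (at_residual tau (uPsi n) (i * d + c)).
  by apply: eq_bigr => i _; apply: obs_initial; rewrite -ltnS.
have ie : m.-integrable setT (EFin \o (fun y => `|class_sum tau d c (uPsi n) y -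
    \sum_(i < n.+1) at_residual tau (uPsi n) (i * d + c) y|)).
  by have /integrable_norm := int_late n.+1 (tb_uPsi n).
rewrite (J_late n.+1 (tb_uPsi n)).
apply: (le_trans (le_normr_Rintegral measurableT (int_late n.+1 (tb_uPsi n)))).
apply: (le_Rintegral measurableT ie (int_late n.+1 tb_u)) => y _.
apply: class_sum_late => // x Dx; rewrite normrM.
by rewrite (le_trans _ (u_norm Dx))// ler_piMr.
Qed.

(** Almost every [y] has a point of the class above it: with residual time [c] if c > 0, with
    residual time [tau y] if c = 0. This lower bound turns absolute tail bounds into the relative
    ones of [good]. *)
Lemma total_initial_ge1 : 1 <= total initial_state.
Proof.
rewrite /= -[leLHS](J_cst m).
have bu : m.-integrable setT (EFin \o class_sum tau d c u) by exact: int_class.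
pose v := class_sum tau d c u.
have -> : J v = \int[m]_(y in ~` Nd) v y.
  by congr fine; rewrite (negligible_integral mNd measurableT _ Nd0) ?setTD.
have -> : \int[m]_(y in setT) (1 : R) = \int[m]_(y in ~` Nd) (1 : R).
  congr fine; rewrite (negligible_integral mNd measurableT _ Nd0) ?setTD//.
  exact: finite_measure_integrable_cst.
have mC : measurable (~` Nd) by exact: measurableC.
apply: le_Rintegral => //.
- by apply: (integrableS measurableT) => //; exact: finite_measure_integrable_cst.
- exact: (integrableS measurableT).
move=> y /d_tau /dvdnP[j jE]; have := tau_gt0 y.
have key (i : 'I_(tau y).+1) : (0 < i * d + c <= tau y)%N -> 1 <= v y.
  move=> ic; rewrite /v /class_sum (bigD1 i)//= -[leLHS]addr0 lerD//.
    rewrite /at_residual ic; have Dy : Delta tau (y, (tau y - (i * d + c))%N).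
      by rewrite /Delta /=; case/andP: ic; lia.
    by have /andP[] := u_itv Dy.
  by apply: sumr_ge0 => l _; exact: at_residual_ge0.
move=> ty; have jt : (j < (tau y).+1)%N by rewrite ltnS jE leq_pmulr.
have dt : (d <= tau y)%N by rewrite jE leq_pmull//; move: ty; rewrite jE; case: (j).
case: (posnP c) => c0.
  by apply: (key (Ordinal jt)); rewrite /= c0 addn0 -jE leqnn ty.
by apply: (key ord0); rewrite /= mul0n add0n c0/= (leq_trans (ltnW cd)).
Qed.

Lemma good_initial : good Q h initial_state.
Proof.
split=> [|k]; first exact: valid_initial.
have M1 := total_initial_ge1; rewrite tail_initial.
have h0' : 0 <= h k by apply: le_trans (h_tail k 0); rewrite big_ord0.
have eH : 2 <= expR H.
  by rewrite (le_trans _ (expR_ge1Dx H))// (_ : 2 = 1 + 1 :> R)// lerD2l.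
apply: (@le_trans _ _ (3 * h k)); last first.
  rewrite [leRHS]mulrAC ler_wpM2r//=.
  rewrite -[3]mulr1 ler_pM//; lra.
apply: (@le_trans _ _ (3 * J (fun y => (tau y - k)%:R))); last first.
  by rewrite ler_wpM2l// excess_tau_le.
rewrite -RintegralZl//; last exact: integrable_excess.
apply: le_Rintegral => //; first exact: int_late.
  apply: (eq_integrable _ (fun y => 3%:E * (tau y - k)%:R%:E)%E) => //.
  by apply: integrableZl => //; exact: integrable_excess.
move=> y _.
have := class_sum_late_le tau d c k y (ler0n R 3); apply: le_trans.
rewrite (le_trans (ler_norm _))//; apply: class_sum_late => // x Dx.
by rewrite ger0_norm ?u_ge0//; have /andP[] := u_itv Dx.
Qed.

(** The measure [m] put on the base at time [k]. Coupling k = 0 with k = 1 shows that the reference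
    correlations change little in one unit of time. *)
Definition reference_state (k : nat) : state R (Y -> R) :=
  State (fun j => if j == k then one Q else 0) (fun=> 0) 1.

Lemma arrived_reference k n : arrived Q (reference_state k) n = (k <= n)%N%:R.
Proof.
rewrite arrivedE /=; have [kn|nk] := leqP k n.
  rewrite (bigD1_seq k) ?iota_uniq ?mem_index_iota//= eqxx.
  rewrite big1 ?addr0; first exact: (mass_one Q).
  by move=> j jk; rewrite (negbTE jk); exact: (mass0 Q).
rewrite big_nat big1// => j /andP[_ jn].
by rewrite ltn_eqF ?(leq_trans jn nk)//; exact: (mass0 Q).
Qed.

Lemma good_reference k : (k <= 1)%N -> good Q h (reference_state k).
Proof.
move=> k1; have tailE n : tail Q (reference_state k) n = 1 - (k <= n)%N%:R.
  by rewrite /tail arrived_reference.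
have eH : 1 <= expR H.
  by rewrite -[leLHS]expR0 ler_expR (le_trans _ H_ge1).
split=> [|n].
  split=> [j|n] /=.
    case: ifP => _; first exact: (one_regular Q).
    exact/(regularW (strongly_regular0 Q)).
  by rewrite tailE normr0 subr_ge0; case: (k <= n)%N.
have hn0 : 0 <= h n by apply: le_trans (h_tail n 0); rewrite big_ord0.
rewrite tailE /= mulr1; case: n hn0 => [|n] hn0; last first.
  by rewrite (leq_trans k1)// subrr !mulr_ge0 ?expR_ge0.
apply: (@le_trans _ _ 1); first by rewrite lerBlDr lerDl; case: (k <= 0)%N.
by rewrite !mulr_ege1// ler1n.
Qed.

Lemma value_reference k n : (k <= n)%N ->
  value Q (reference_state k) n = obs Q (n - k) (one Q).
Proof.
move=> kn; rewrite /value /= addr0.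
rewrite -(big_mkord xpredT (fun j => obs Q (n - j) (if j == k then one Q else 0))).
rewrite (bigD1_seq k) ?iota_uniq ?mem_index_iota//= eqxx.
rewrite big1 ?addr0// => j jk.
by rewrite (negbTE jk); exact: (obs0 Q).
Qed.

Hypothesis rateP : forall n, 2 <= rate n \/
  exists2 r, n = (r + delay L v0)%N &
  forall w : nat -> R, (forall s, 0 <= w s) ->
    \sum_(0 <= s < r.+1) w s <= 1 ->
    (forall k, \sum_(k.+1 <= s < r.+1) w s <= 4 * expR H * h k) ->
    8 * expR H * h r +
      (1 - tower_drop H del L v0) * \sum_(0 <= s < r.+1) w s * rate (r - s)%N <= rate n.

Lemma class_integral_rate n :
  `|class_integral n - total initial_state * obs Q n (one Q)| <=
    rate n * total initial_state.
Proof.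
have := coupling sum_late_le hL v0P rateP n good_initial
  (good_reference (leq0n 1)).
by rewrite /cross value_initial value_reference// subn0 mul1r mulr1.
Qed.

Lemma reference_rate n :
  `|obs Q n.+1 (one Q) - obs Q n (one Q)| <= rate n.+1.
Proof.
have := coupling sum_late_le hL v0P rateP n.+1 (good_reference (leq0n 1))
  (good_reference (leqnn 1)).
by rewrite /cross !value_reference// subn0 subn1 !mul1r !mulr1.
Qed.

End tower_coupling.

(** * Correlations on the tower *)

Section tower_estimate.
Context (R : realType) (dsp : measure_display) (Y : measurableType dsp).
Variables (m : probability Y R) (F : Y -> Y) (dY : Y -> Y -> R).
Variables (alpha : set (set Y)) (zeta : Y -> R) (lambda K eta : R).
Hypothesis ue : uniformly_expanding m F dY alpha zeta lambda K eta.
Variables (tau : {mfun Y >-> nat}) (d : nat) (I : seq nat).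
Hypothesis rt : return_time m tau alpha.
Hypothesis d_gt0 : (0 < d)%N.
Variable Nd : set Y.
Hypotheses (mNd : measurable Nd) (Nd0 : m Nd = 0%E).
Hypothesis d_tau : forall y, ~ Nd y -> (d %| tau y)%N.
Variables (H del : R).
Hypothesis H_ge1 : 1 <= H.
Hypothesis H1_le : K + H * lambda^-1 `^ eta + 1 <= H.
Hypothesis del_itv : 0 < del <= 1.
Hypothesis I_gt0 : forall i, i \in I -> (0 < i)%N.
Hypothesis I_dvd : forall i, i \in I -> (d %| i)%N.
Hypothesis I_del : forall i, i \in I -> (del%:E <= m [set y | tau y = i])%E.
Variables (h : nat -> R) (L v0 : nat) (rate : nat -> R).
Hypothesis h_tail : forall k n,
  \sum_(i < n) fine (m [set y | (k + i.+1 <= tau y)%N]) <= h k.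
Hypothesis h0 : 1 <= h 0.
Hypothesis hL : expR H * h L <= 1 / 2.
Hypothesis v0P : forall v, (v0 <= v)%N ->
  nsemigroup [seq (k %/ d)%N | k <- I] v.

Hypothesis rateP : forall n, 2 <= rate n \/
  exists2 r, n = (r + delay L v0)%N &
  forall w : nat -> R, (forall s, 0 <= w s) ->
    \sum_(0 <= s < r.+1) w s <= 1 ->
    (forall k, \sum_(k.+1 <= s < r.+1) w s <= 4 * expR H * h k) ->
    8 * expR H * h r +
      (1 - tower_drop H del L v0) * \sum_(0 <= s < r.+1) w s * rate (r - s)%N <= rate n.

Local Notation T := (tower_map tau F).
Local Notation J f := (\int[m]_y f y).

Let tau_gt0 y : (0 < tau y)%N. Proof. by case: rt. Qed.

Let mF : measurable_fun setT F. Proof. by case: (ue_nonsingular ue). Qed.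

Section observable.
Variable Psi : Y * nat -> R.
Hypothesis mPsi : measurable_fun setT Psi.
Hypothesis Psi_le1 : forall x, `|Psi x| <= 1.

Definition reference n : R := J (base_obs F tau Psi (n * d)).

Let mass1 c := J (class_sum tau d c (fun=> 1)).

Lemma class_rate (u : Y * nat -> R) c n : (c < d)%N -> measurable_fun setT u ->
  (forall x, Delta tau x -> 1 <= u x <= 3) ->
  (forall y y' l, Delta tau (y, l) -> Delta tau (y', l) ->
    u (y, l) <= u (y', l) * expR (dY y y' `^ eta)) ->
  `|J (class_sum tau d c (fun x => u x * Psi (iter (n * d + c) T x))) -
    J (class_sum tau d c u) * reference n| <= rate n * J (class_sum tau d c u).
Proof.
move=> cd mu u_itv u_holder.
have := class_integral_rate ue rt d_gt0 mNd Nd0 d_tau H_ge1 H1_le del_itv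
  I_gt0 I_dvd I_del mPsi Psi_le1 h_tail h0 hL v0P mu u_itv
  u_holder cd rateP n.
rewrite /reference /class_integral /= /tower_val.
by under [X in _ * X]eq_Rintegral do rewrite mul1r.
Qed.

Lemma reference_step n : `|reference n.+1 - reference n| <= rate n.+1.
Proof.
have := reference_rate ue rt d_gt0 mNd Nd0 d_tau H_ge1 H1_le del_itv
  I_gt0 I_dvd I_del mPsi Psi_le1 h_tail h0 hL v0P rateP n.
rewrite /reference /= /tower_val.
by under [X in X - _]eq_Rintegral do rewrite mul1r;
  under [X in _ - X]eq_Rintegral do rewrite mul1r.
Qed.

End observable.

Local Notation JC c f := (J (class_sum tau d c f)).
Local Notation mass1 c := (JC c (fun=> 1)).

Let int_class c f : tower_bounded tau f ->
  m.-integrable setT (EFin \o class_sum tau d c f).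
Proof. by move=> bf; apply: (class_sum_integrable d_gt0 rt). Qed.

Lemma tower_bounded_lin f g (r : R) : tower_bounded tau f ->
  tower_bounded tau g -> tower_bounded tau (fun x => f x + r * g x).
Proof.
move=> [mf [a fa]] [mg [b gb]]; split.
  by apply: measurable_funD => //; exact: measurable_funM.
exists (a + `|r| * b) => x Dx; rewrite (le_trans (ler_normD _ _))//.
by rewrite normrM lerD ?ler_wpM2l ?fa ?gb.
Qed.

Lemma JC_lin c f g (r : R) : tower_bounded tau f -> tower_bounded tau g ->
  JC c (fun x => f x + r * g x) = JC c f + r * JC c g.
Proof.
move=> bf bg; have ig : m.-integrable setT
    (EFin \o (fun y => r * class_sum tau d c g y)).
  rewrite (_ : _ \o _ = fun y => (r%:E * (class_sum tau d c g y)%:E)%E)//.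
  by apply: integrableZl => //; exact: int_class.
rewrite -(RintegralZl _ _ (int_class c bg))// -RintegralD//; last exact: int_class.
apply: eq_Rintegral => y _; rewrite /class_sum mulr_sumr -big_split /=.
apply: eq_bigr => i _; rewrite /at_residual; case: ifP => // _.
by rewrite mulr0 addr0.
Qed.

Lemma JC_le c f g : tower_bounded tau f -> tower_bounded tau g ->
  (forall x, Delta tau x -> `|f x| <= g x) -> `|JC c f| <= JC c g.
Proof.
move=> bf bg fg.
have /integrable_norm nf := int_class c bf.
apply: (le_trans (le_normr_Rintegral measurableT (int_class c bf))).
apply: (le_Rintegral measurableT nf (int_class c bg)) => y _.
exact: class_sum_norm.
Qed.

Let tb1 : tower_bounded tau (fun=> 1 : R).
Proof. by split => //; exists 1 => x _; rewrite normr1. Qed.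

Lemma mass1_ge0 c : 0 <= mass1 c.
Proof.
apply: Rintegral_ge0 => y _; apply: sumr_ge0 => i _.
exact: at_residual_ge0.
Qed.

(** In the nontrivial case of [rateP], take all weights equal to 0. *)
Lemma rate_ge0 n : 0 <= rate n.
Proof.
have [|[r nr rP]] := rateP n; first exact: le_trans.
elim/ltn_ind: n r nr rP => n IH r nr rP.
have rate0 s : (s < n)%N -> 0 <= rate s.
  move=> sn; have [|[r' sr' r'P]] := rateP s; first exact: le_trans.
  exact: IH sn r' sr' r'P.
have hr0 : 0 <= h r by apply: le_trans (h_tail r 0); rewrite big_ord0.
apply: le_trans (rP (fun=> 0) _ _ _) => //.
- rewrite big1 => [|s _]; last by rewrite mul0r.
  by rewrite mulr0 addr0 !mulr_ge0 ?expR_ge0.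
- by rewrite big1.
- move=> k; rewrite big1// !mulr_ge0 ?expR_ge0//.
  by apply: le_trans (h_tail k 0); rewrite big_ord0.
Qed.

Section estimate.
Variables (phi Psi : Y * nat -> R) (B : R).
Hypothesis mphi : measurable_fun setT phi.
Hypothesis B0 : 0 < B.
Hypothesis phi_le : forall x, Delta tau x -> `|phi x| <= B.
Hypothesis phi_holder : forall y y' l, Delta tau (y, l) -> Delta tau (y', l) ->
  `|phi (y, l) - phi (y', l)| <= B * dY y y' `^ eta.
Hypothesis mPsi : measurable_fun setT Psi.
Hypothesis Psi_le1 : forall x, `|Psi x| <= 1.

Let tb_phi : tower_bounded tau phi. Proof. by split => //; exists B. Qed.

(** The signed [phi] becomes a density with values in [1, 3]; being at least 1, it turns the Hoelder
    bound into a log-Hoelder bound with constant 1. *)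
Let u x : R := 2 + B^-1 * phi x.

Let u_itv x : Delta tau x -> 1 <= u x <= 3.
Proof.
move=> Dx; have := phi_le Dx; rewrite ler_norml => /andP[p1 p2].
have : -1 <= B^-1 * phi x by rewrite ler_pdivlMl// mulrN1.
have : B^-1 * phi x <= 1 by rewrite ler_pdivrMl// mulr1.
by rewrite /u; lra.
Qed.

Let u_holder y y' l : Delta tau (y, l) -> Delta tau (y', l) ->
  u (y, l) <= u (y', l) * expR (dY y y' `^ eta).
Proof.
move=> Dy Dy'; have := phi_holder Dy Dy'; set e := dY y y' `^ eta => pe.
have e0 : 0 <= e by exact: powR_ge0.
have /andP[u1 _] := u_itv Dy'.
have ud : u (y, l) <= u (y', l) + e.
  have : B^-1 * (phi (y, l) - phi (y', l)) <= e.
    by rewrite ler_pdivrMl// (le_trans (ler_norm _)).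
  by rewrite mulrBr /u; lra.
apply: (le_trans ud); apply: (@le_trans _ _ (u (y', l) * (1 + e))).
  by rewrite mulrDr mulr1 lerD2l ler_peMl.
by rewrite ler_wpM2l ?expR_ge1Dx// (le_trans ler01).
Qed.

Let mu : measurable_fun setT u.
Proof. by apply: measurable_funD => //; exact: measurable_funM. Qed.

Let tb_u : tower_bounded tau u.
Proof.
split => //; exists 3 => x Dx; have /andP[u1 u3] := u_itv Dx.
by rewrite ger0_norm// (le_trans ler01).
Qed.

Lemma class_mean_le c : `|JC c phi| <= B * mass1 c.
Proof.
have tbB : tower_bounded tau (fun x => 0 + B * (fun=> 1) x).
  apply: tower_bounded_lin => //.
  by split; [exact: measurable_cst|exists 0 => x _; rewrite normr0].
rewrite -[leRHS]add0r (_ : 0 = JC c (fun=> 0)); last first.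
  rewrite -[LHS](J_cst m); apply: eq_Rintegral => y _.
  by rewrite /class_sum big1// => i _; rewrite /at_residual; case: ifP.
rewrite -JC_lin//; last first.
  by split; [exact: measurable_cst|exists 0 => x _; rewrite normr0].
apply: JC_le => // x Dx; rewrite add0r mulr1; exact: phi_le.
Qed.

(** Since phi = B (u - 2), the coupling is applied to [u], whose mass is at most 3 times that of 1,
    and twice to the constant 1: 5 = 3 + 2. *)
Lemma class_oscillation c n : (c < d)%N ->
  `|JC c (fun x => phi x * Psi (iter (n * d + c) T x)) -
    JC c phi * reference Psi n| <= 5 * B * rate n * mass1 c.
Proof.
move=> cd; pose P x := Psi (iter (n * d + c) T x).
have tbM f : tower_bounded tau f -> tower_bounded tau (fun x => f x * P x).
  move=> [mf [b fb]]; split.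
    apply: measurable_funM => //; apply: measurableT_comp => //.
    exact: measurable_iter_tower_map.
  exists b => x Dx; rewrite normrM (le_trans _ (fb x Dx))// ler_piMr//.
  exact: Psi_le1.
have h1 := @class_rate Psi mPsi Psi_le1 u c n cd mu u_itv u_holder.
have h2 := @class_rate Psi mPsi Psi_le1 (fun=> 1) c n cd (measurable_cst _) _ _.
have {h2} h2 : `|JC c (fun x => 1 * P x) - mass1 c * reference Psi n| <=
    rate n * mass1 c.
  apply: h2 => [x _|y y' l _ _]; first by rewrite lexx ler1n.
  by rewrite mul1r -[leLHS]expR0 ler_expR powR_ge0.
have tbP := tbM _ tb1; have tbphiP := tbM _ tb_phi.
have E1 : JC c (fun x => u x * P x) = JC c (fun x => 1 * P x) +
    1 * (JC c (fun x => 1 * P x) + B^-1 * JC c (fun x => phi x * P x)).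
  have -> : (fun x => u x * P x) =
      (fun x => 1 * P x + 1 * (1 * P x + B^-1 * (phi x * P x))).
    by apply/funext => x; rewrite /u; ring.
  by rewrite -JC_lin// -JC_lin//; exact: tower_bounded_lin.
have E2 : JC c u = mass1 c + 1 * (mass1 c + B^-1 * JC c phi).
  have -> : u = (fun x => 1 + 1 * (1 + B^-1 * phi x)).
    by apply/funext => x; rewrite /u; ring.
  by rewrite -JC_lin// -JC_lin//; exact: tower_bounded_lin.
have m0 := mass1_ge0 c; have r0 := rate_ge0 n.
have phi_m := class_mean_le c.
have phi_m' : B^-1 * JC c phi <= mass1 c.
  by rewrite ler_pdivrMl// (le_trans (ler_norm _)).
rewrite E1 E2 in h1.
have -> : JC c (fun x => phi x * P x) - JC c phi * reference Psi n =
    B * ((JC c (fun x => 1 * P x) +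
     1 * (JC c (fun x => 1 * P x) + B^-1 * JC c (fun x => phi x * P x)) -
     (mass1 c + 1 * (mass1 c + B^-1 * JC c phi)) * reference Psi n) -
     2 * (JC c (fun x => 1 * P x) - mass1 c * reference Psi n)).
  by field; rewrite gt_eqF.
rewrite normrM gtr0_norm// -!mulrA [leRHS]mulrCA ler_pM2l//.
rewrite (le_trans (ler_normB _ _))// normrM (ger0_norm (ler0n _ 2)).
have : rate n * (mass1 c + 1 * (mass1 c + B^-1 * JC c phi)) <=
    rate n * (3 * mass1 c) by rewrite ler_wpM2l//; lra.
have := ler_wpM2l (ler0n R 2) h2.
move: h1; set X := `|_ - _|; set Z := `|_ - _|; lra.
Qed.

End estimate.

Section summation.
Variables (phi Psi : Y * nat -> R) (B : R).
Hypothesis mphi : measurable_fun setT phi.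
Hypothesis B0 : 0 < B.
Hypothesis phi_le : forall x, Delta tau x -> `|phi x| <= B.
Hypothesis phi_holder : forall y y' l, Delta tau (y, l) -> Delta tau (y', l) ->
  `|phi (y, l) - phi (y', l)| <= B * dY y y' `^ eta.
Hypothesis mPsi : measurable_fun setT Psi.
Hypothesis Psi_le1 : forall x, `|Psi x| <= 1.

Let shifted e := Psi \o iter e T.

Let mshifted e : measurable_fun setT (shifted e).
Proof. by apply: measurableT_comp => //; exact: measurable_iter_tower_map. Qed.

Let shifted_le1 e x : `|shifted e x| <= 1.
Proof. exact: Psi_le1. Qed.

(* Time [n.+1 * d + k] is a multiple of [d], plus [c], plus [lag c k]. *)
Let lag c k := if (c <= k)%N then (k - c)%N else (k + (d - c))%N.

(** If c <= k, [class_oscillation] at n + 1 suffices. If c > k, only n full periods fit, and moving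
    the reference correlation from n to n + 1 costs one more [rate], so 5 becomes 6. *)
Lemma class_lag c k n : (c < d)%N -> (k < d)%N ->
  `|JC c (fun x => phi x * Psi (iter (n.+1 * d + k) T x)) -
    JC c phi * reference (shifted (lag c k)) n.+1| <=
  6 * B * (rate n.+1 + rate n) * mass1 c.
Proof.
move=> cd kd; have m0 := mass1_ge0 c.
have r0 := rate_ge0 n; have r1 := rate_ge0 n.+1.
have iterE N e : (n.+1 * d + k = e + (N * d + c))%N ->
    (fun x => phi x * Psi (iter (n.+1 * d + k) T x)) =
    (fun x => phi x * shifted e (iter (N * d + c) T x)).
  by move=> ->; apply/funext => x; rewrite iterD.
have Bm r : 0 <= r -> 0 <= B * r * mass1 c by move=> ?; rewrite !mulr_ge0// ltW.
rewrite /lag; case: (leqP c k) => ck.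
  rewrite (iterE n.+1 (k - c)%N); last by rewrite addnCA subnK.
  have := class_oscillation mphi B0 phi_le phi_holder (mshifted (k - c))
    (shifted_le1 (k - c)) n.+1 cd.
  have := Bm _ r0; have := Bm _ r1; set Z := `|_ - _|; lra.
rewrite (iterE n (k + (d - c))%N); last first.
  rewrite mulSn [(n * d + c)%N]addnC addnA -[(k + _ + c)%N]addnA.
  by rewrite (subnK (ltnW cd)) addnAC [(d + k)%N]addnC.
have := class_oscillation mphi B0 phi_le phi_holder (mshifted (k + (d - c)))
    (shifted_le1 (k + (d - c))) n cd.
have := reference_step (mshifted (k + (d - c))) (shifted_le1 (k + (d - c))) n.
set x1 := reference _ n.+1; set x0 := reference _ n => xx H5.
rewrite -(subrK (JC c phi * x0) (JC c _)) -addrA -mulrBr.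
rewrite (le_trans (ler_normD _ _))// normrM [`|x0 - x1|]distrC.
have : `|JC c phi| * `|x1 - x0| <= B * mass1 c * rate n.+1.
  by rewrite ler_pM// class_mean_le.
have := Bm _ r0; have := Bm _ r1; move: H5; set Z := `|_ - _|; lra.
Qed.

(** For fixed [c], [lag c] is the rotation k - c modulo d. Hence the sum over k attaches the same
    reference value to every class. *)
Lemma sum_lag c (g : nat -> R) : (c < d)%N ->
  \sum_(0 <= k < d) g (lag c k) = \sum_(0 <= e < d) g e.
Proof.
move=> cd; rewrite (@big_cat_nat _ _ _ c 0 d)//=; last exact: ltnW.
rewrite [RHS](@big_cat_nat _ _ _ (d - c) 0 d)//=; last exact: leq_subr.
rewrite addrC; congr (_ + _).
  rewrite -{1}[c]add0n big_addn; apply: eq_big_nat => i _.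
  by rewrite /lag leq_addl addnK.
rewrite -{1}[(d - c)%N]add0n big_addn subKn ?(ltnW cd)//.
by apply: eq_big_nat => i /andP[_ ic]; rewrite /lag leqNgt ic.
Qed.

Let tb_shift k : tower_bounded tau (fun x => phi x * Psi (iter k T x)).
Proof.
split; last first.
  by exists B => x Dx; rewrite normrM (le_trans _ (phi_le Dx))// ler_piMr.
apply: measurable_funM => //; exact: mshifted.
Qed.

Let tb_phi : tower_bounded tau phi. Proof. by split => //; exists B. Qed.

Lemma integral_levels f : tower_bounded tau f ->
  J (fun y => \sum_(l < tau y) f (y, val l)) = \sum_(c < d) JC c f.
Proof.
move=> bf; under eq_Rintegral do rewrite -(class_sum_all _ d_gt0).
suff sum_class j : J (fun y => \sum_(c < j) class_sum tau d c f y) =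
  \sum_(c < j) JC c f by [].
elim: j => [|j IH].
  under eq_Rintegral do rewrite big_ord0.
  by rewrite big_ord0 J_cst.
under eq_Rintegral do rewrite big_ord_recr/=.
rewrite RintegralD//; last exact: int_class.
  by rewrite IH big_ord_recr.
rewrite (_ : _ \o _ = fun y => \sum_(c < j) (class_sum tau d c f y)%:E)%E; last first.
  by apply/funext => y; rewrite /= sumEFin.
by apply: integrable_sum => // i _; exact: int_class.
Qed.

Theorem tower_estimate n : J (fun y => \sum_(l < tau y) phi (y, val l)) = 0 ->
  `|\sum_(0 <= k < d) J (fun y => \sum_(l < tau y)
      phi (y, val l) * Psi (iter (n.+1 * d + k) T (y, val l)))| <=
  6 * B * d%:R * (rate n.+1 + rate n) * tau_bar m tau.
Proof.
move=> phi0.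
have sumX : \sum_(0 <= k < d) \sum_(c < d)
    JC c phi * reference (shifted (lag c k)) n.+1 = 0.
  rewrite exchange_big /=.
  rewrite (eq_bigr (fun c : 'I_d => JC c phi *
    \sum_(0 <= e < d) reference (shifted e) n.+1)); last first.
    move=> c _; rewrite -mulr_sumr.
    by rewrite (sum_lag (fun e => reference (shifted e) n.+1)).
  by rewrite -mulr_suml -integral_levels// phi0 mul0r.
have massE : \sum_(c < d) mass1 c = tau_bar m tau.
  rewrite -integral_levels//; apply: eq_Rintegral => y _.
  by rewrite sumr_const card_ord.
rewrite -[X in `|X|]subr0 -[X in _ - X]sumX.
rewrite big_nat [X in _ - X]big_nat -sumrB.
rewrite (le_trans (ler_norm_sum _ _ _))//.
apply: (@le_trans _ _ (\sum_(0 <= k < d)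
    6 * B * (rate n.+1 + rate n) * tau_bar m tau)); last first.
  by rewrite sumr_const_nat subn0 -mulr_natr le_eqVlt; apply/orP; left;
    apply/eqP; ring.
rewrite [leRHS]big_nat; apply: ler_sum => k /andP[_ kd].
rewrite (integral_levels (tb_shift (n.+1 * d + k))) -sumrB.
rewrite (le_trans (ler_norm_sum _ _ _))// -massE mulr_sumr.
by apply: ler_sum => c _; exact: class_lag.
Qed.

End summation.
End tower_estimate.

(** * Duality *)

Section tower_integrals.
Context (R : realType) (dsp : measure_display) (Y : measurableType dsp).
Variables (m : probability Y R) (tau : {mfun Y >-> nat}).
Local Notation mD := (m_Delta m tau).
Local Notation J f := (\int[m]_y f y).

Lemma bounded_Lfun_oo (psi : Y * nat -> R) b : measurable_fun setT psi ->
  (forall x, `|psi x| <= b) -> psi \in Lfun mD +oo%E.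
Proof.
move=> mpsi psib; rewrite inE; apply/andP; split; first by rewrite inE.
rewrite inE /= /finite_norm unlock /=; case: ifPn => // _.
apply: (@le_lt_trans _ _ b%:E); last by rewrite ltry.
by apply/ess_supP; apply: aeW => x /=; rewrite lee_fin.
Qed.

Lemma ge0_m_Delta_integral (f : Y * nat -> R) : measurable_fun setT f ->
  (forall x, 0 <= f x) ->
  (\int[mD]_(x in Delta tau) (f x)%:E =
   ((tau_bar m tau)^-1)%:E * \int[m]_y (\sum_(l < tau y) f (y, \val l))%:E)%E.
Proof.
move=> mf f0; have mDelta := measurable_Delta tau.
have mfE : measurable_fun (Delta tau) (EFin \o f).
  by apply/measurable_EFinP; exact: measurable_funTS.
rewrite ge0_integral_mscale//; last by move=> x _; rewrite lee_fin.
congr (_ * _)%E.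
transitivity (\int[(m \x @counting nat R)%E]_(x in Delta tau) (f x)%:E)%E.
  by apply: eq_measure_integral => A mA AD; rewrite /= /mrestr setIidl.
rewrite integral_mkcond.
have mfD : measurable_fun setT ((EFin \o f) \_ (Delta tau)).
  by apply/(measurable_restrictT _ _).1.
rewrite (@fubini_tonelli1 _ _ _ _ _ m (@counting nat R) _ mfD); last first.
  by move=> x; rewrite /patch; case: ifP => // _; rewrite lee_fin.
apply: eq_integral => y _; rewrite /fubini_F ge0_integral_count; last first.
  by move=> l; rewrite /patch; case: ifP => // _; rewrite lee_fin.
rewrite (nneseries_split 0 (tau y)); last first.
  by move=> l _; rewrite /patch; case: ifP => // _; rewrite lee_fin.
rewrite add0n [X in (_ + X)%E]eseries0 ?adde0; last first.
  move=> l tl _; rewrite patchN// notin_setE /Delta /=.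
  by apply/negP; rewrite -leqNgt.
rewrite big_mkord -sumEFin; apply: eq_bigr => l _.
by rewrite patchT// inE /Delta /=.
Qed.

Lemma m_Delta_integral (alpha : set (set Y)) (f : Y * nat -> R) :
  return_time m tau alpha -> tower_bounded tau f ->
  (\int[mD]_(x in Delta tau) (f x)%:E =
   ((tau_bar m tau)^-1 * J (fun y => \sum_(l < tau y) f (y, \val l)))%:E)%E.
Proof.
move=> rt [mf [b fb]].
have mDelta := measurable_Delta tau.
have part (g : Y * nat -> R) : measurable_fun setT g -> (forall x, 0 <= g x) ->
    (forall x, Delta tau x -> g x <= b) ->
  (\int[mD]_(x in Delta tau) (g x)%:E =
   ((tau_bar m tau)^-1 * J (fun y => \sum_(l < tau y) g (y, \val l)))%:E)%E
  /\ m.-integrable setT (EFin \o (fun y => \sum_(l < tau y) g (y, \val l))).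
  move=> mg g0 gb.
  have ig : m.-integrable setT (EFin \o (fun y => \sum_(l < tau y) g (y, \val l))).
    have bg : tower_bounded tau g.
      by split => //; exists b => x Dx; rewrite ger0_norm// gb.
    have := class_sum_integrable (d := 1) isT rt 0 bg.
    rewrite (_ : class_sum tau 1 0 g = fun y => \sum_(l < tau y) g (y, \val l))//.
    apply/funext => y.
    by rewrite -(class_sum_all tau (ltn0Sn 0) g) big_ord1.
  split => //; rewrite ge0_m_Delta_integral// EFinM; congr (_ * _)%E.
  by rewrite fineK//; exact: integrable_fin_num ig.
have mmax : measurable_fun setT (fun x => Num.max (f x) 0).
  by apply: measurable_maxr.
have mmin : measurable_fun setT (fun x => Num.max (- f x) 0).
  by apply: measurable_maxr => //; exact: measurable_funN.
have [|| E1 i1] := part _ mmax.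
- by move=> x; rewrite le_max lexx orbT.
- move=> x Dx; rewrite ge_max (le_trans (ler_norm _) (fb x Dx))/=.
  exact: le_trans (normr_ge0 _) (fb x Dx).
have [|| E2 i2] := part _ mmin.
- by move=> x; rewrite le_max lexx orbT.
- move=> x Dx; rewrite ge_max; apply/andP; split.
    by apply: le_trans (fb x Dx); rewrite -[leRHS]normrN; exact: ler_norm.
  exact: le_trans (normr_ge0 (f x)) (fb x Dx).
rewrite integralE.
have -> : (\int[mD]_(x in Delta tau) ((fun x => (f x)%:E)^\+ x) =
    \int[mD]_(x in Delta tau) (Num.max (f x) 0)%:E)%E.
  by apply: eq_integral => x _; rewrite funeposE EFin_max.
have -> : (\int[mD]_(x in Delta tau) ((fun x => (f x)%:E)^\- x) =
    \int[mD]_(x in Delta tau) (Num.max (- f x) 0)%:E)%E.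
  by apply: eq_integral => x _; rewrite funenegE EFin_max.
rewrite E1 E2 -EFinB -mulrBr -RintegralB//; congr (_ * _)%:E.
apply: eq_Rintegral => y _; rewrite -sumrB; apply: eq_bigr => l _.
case: (lerP (f (y, \val l)) 0) => f0.
  by rewrite max_l ?oppr_ge0// sub0r opprK.
by rewrite max_r ?subr0// oppr_le0 ltW.
Qed.

End tower_integrals.

Section duality.
Context (R : realType) (dsp : measure_display) (Y : measurableType dsp).
Variables (m : probability Y R) (tau : {mfun Y >-> nat}) (F : Y -> Y).
Variable L : (Y * nat -> R) -> (Y * nat -> R).
Local Notation mD := (m_Delta m tau).
Local Notation T := (tower_map tau F).
Hypothesis mF : measurable_fun setT F.
Hypothesis LP : transfer_operator m tau F L.
Variable phi : Y * nat -> R.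
Hypothesis phi1 : phi \in Lfun mD 1%E.

Lemma iter_transfer_Lfun k : iter k L phi \in Lfun mD 1%E.
Proof. by elim: k => //= k IH; have [] := LP IH. Qed.

Lemma iter_transfer_dual k (psi : Y * nat -> R) b : measurable_fun setT psi ->
  (forall x, `|psi x| <= b) ->
  (\int[mD]_(x in Delta tau) (iter k L phi x * psi x)%:E =
   \int[mD]_(x in Delta tau) (phi x * psi (iter k T x))%:E)%E.
Proof.
elim: k psi => // k IH psi mpsi psib; rewrite iterS.
have [_ ->] := LP (iter_transfer_Lfun k); last exact: bounded_Lfun_oo psib.
rewrite (IH (psi \o T)) => [|//|x]; last exact: psib.
  by apply: eq_integral => x _; rewrite /= -iterS.
by apply: measurableT_comp => //; exact: measurable_tower_map.
Qed.

Lemma transfer_sum_norm d n : exists psi : Y * nat -> R,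
  [/\ measurable_fun setT psi, forall x, `|psi x| <= 1 &
  (\int[mD]_(x in Delta tau) (`|\sum_(0 <= k < d) iter (n * d + k) L phi x|)%:E =
   \sum_(0 <= k < d)
     \int[mD]_(x in Delta tau) (phi x * psi (iter (n * d + k) T x))%:E)%E].
Proof.
pose s x := \sum_(0 <= k < d) iter (n * d + k) L phi x.
have mL k : measurable_fun setT (iter k L phi).
  by have := iter_transfer_Lfun k; rewrite inE => /andP[]; rewrite inE.
have ms : measurable_fun setT s by apply: measurable_sum.
pose psi x : R := if s x < 0 then -1 else 1.
have mpsi : measurable_fun setT psi.
  apply: measurable_fun_ifT => //.
  by apply: measurable_fun_ltr.
have psib x : `|psi x| <= 1.
  by rewrite /psi; case: ifP; rewrite ?normrN normr1.
exists psi; split => //.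
have mDelta := measurable_Delta tau.
transitivity (\int[mD]_(x in Delta tau)
    (\sum_(0 <= k < d) (iter (n * d + k) L phi x * psi x)%:E))%E.
  apply: eq_integral => x _; rewrite sumEFin -mulr_suml -/(s x); congr EFin.
  rewrite /psi; case: ltP => s0; first by rewrite ltr0_norm// mulrN1.
  by rewrite ger0_norm// mulr1.
rewrite integral_sum//.
  by apply: eq_bigr => k _; exact: (iter_transfer_dual _ mpsi psib).
move=> k; apply: (integrableS measurableT) => //.
apply: (@le_integrable _ _ _ _ _ measurableT _ (EFin \o iter (n * d + k) L phi)).
- by apply/measurable_EFinP; exact: measurable_funM.
- by move=> x _; rewrite lee_fin normrM ler_piMr.
- by apply/Lfun1_integrable; exact: iter_transfer_Lfun.
Qed.

End duality.

(** * From the rate to the transfer operator of a nonmixing tower *)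

Record nonmixing_tower (R : realType) (dsp : measure_display)
    (Y : measurableType dsp) (m : probability Y R) (F : Y -> Y)
    (dY : Y -> Y -> R) (alpha : set (set Y)) (zeta : Y -> R)
    (lambda K eta : R) (tau : {mfun Y >-> nat}) (d : nat) (I : seq nat)
    (delta : R) (L : (Y * nat -> R) -> (Y * nat -> R))
    (phi : Y * nat -> R) : Prop := {
  nt_expanding : uniformly_expanding m F dY alpha zeta lambda K eta ;
  nt_return : return_time m tau alpha ;
  nt_nonmixing : nonmixing tau alpha ;
  nt_period : is_period m tau d ;
  nt_data : period_data m tau d I delta ;
  nt_transfer : transfer_operator m tau F L ;
  nt_Lfun : phi \in Lfun (m_Delta m tau) 1%E ;
  nt_norm : (holder_norm tau dY eta phi < +oo)%E ;
  nt_mean : (\int[m_Delta m tau]_(x in Delta tau) (phi x)%:E = 0)%E }.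

Section nonmixing_tower.
Context (R : realType) (dsp : measure_display) (Y : measurableType dsp).
Variables (m : probability Y R) (F : Y -> Y) (dY : Y -> Y -> R).
Variables (alpha : set (set Y)) (zeta : Y -> R) (lambda K eta : R).
Variables (tau : {mfun Y >-> nat}) (d : nat) (I : seq nat) (delta : R).
Variables (L : (Y * nat -> R) -> (Y * nat -> R)) (phi : Y * nat -> R).
Hypothesis nt : nonmixing_tower m F dY alpha zeta lambda K eta tau d I delta L phi.

Let ue := nt_expanding nt.
Let rt := nt_return nt.

Let inhabited_Y : exists y : Y, True.
Proof.
apply: contrapT => noY; have := @probability_setT _ _ _ m.
rewrite (_ : [set: Y] = set0) ?measure0; last first.
  by apply/seteqP; split => // y _; apply: noY; exists y.
by move/eqP; rewrite eqe eq_sym oner_eq0.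
Qed.

(** An element of the partition with tau = 1 would make the gcd equal to 1. Consequently every point
    of [Y] has a level 1 above it. *)
Lemma tau_gt1 y : (1 < tau y)%N.
Proof.
have [t0 _ tc] := rt; have := t0 y; rewrite leq_eqVlt => /orP[/eqP t1|//].
case: (nt_nonmixing nt); split => [j _|e]; first exact: dvd1n.
apply; have [covr _ _] := ue_partition ue.
have [a aa ay] : (\bigcup_(a in alpha) id a) y by rewrite -/(cover _ _) covr.
by exists a => // z az; rewrite t1; exact: tc az ay.
Qed.

(** The supremum of an empty set being -oo, both suprema need a witness before finiteness of the sum
    bounds each of them; the levels 0 and 1 above one point supply it. *)
Lemma holder_norm_real : exists r : R,
  [/\ 0 <= r, holder_norm tau dY eta phi = r%:E,
      forall x, Delta tau x -> `|phi x| <= r &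
      forall y y' l, Delta tau (y, l) -> Delta tau (y', l) ->
        `|phi (y, l) - phi (y', l)| <= r * dY y y' `^ eta].
Proof.
have [y0 _] := inhabited_Y.
have D0 : Delta tau (y0, 0%N) by rewrite /Delta /= (ltn_trans _ (tau_gt1 y0)).
have D1 : Delta tau (y0, 1%N) by exact: tau_gt1.
have s0 : (0 <= holder_seminorm tau dY eta phi)%E.
  apply: le_trans (ereal_sup_ubound _); last first.
    by exists (y0, 0%N), (y0, 1%N); split.
  by rewrite lee_fin divr_ge0// powR_ge0.
have t0 : (0 <= sup_norm tau phi)%E.
  apply: le_trans (ereal_sup_ubound _); last by exists (y0, 0%N).
  by rewrite lee_fin.
have hn := nt_norm nt.
have hfin : holder_norm tau dY eta phi \is a fin_num.
  by rewrite ge0_fin_numE// adde_ge0.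
have hE := fineK hfin; set r := fine _ in hE.
have sr : (holder_seminorm tau dY eta phi <= r%:E)%E by rewrite hE leeDl.
have tr : (sup_norm tau phi <= r%:E)%E by rewrite hE leeDr.
have r0 : 0 <= r by rewrite -lee_fin (le_trans s0).
exists r; split => // [x Dx|y y' l Dy Dy'].
  by rewrite -lee_fin; apply: le_trans tr; apply: ereal_sup_ubound; exists x.
have [<-|yy'] := pselect (y = y').
  by rewrite subrr normr0 mulr_ge0// powR_ge0.
have [dge0 d0 _ _] := ue_metric ue.
have dpos : 0 < dY y y'.
  by rewrite lt_neqAle dge0 andbT eq_sym; apply/eqP => /d0.
rewrite -ler_pdivrMr ?powR_gt0// -lee_fin; apply: le_trans sr.
apply: ereal_sup_ubound; exists (y, l), (y', l); split => //.
  by case.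
by rewrite /d_Delta /= eqxx.
Qed.

Let measurable_tau_preimage (S : set nat) : measurable [set y | S (tau y)].
Proof.
rewrite (_ : [set _ | _] = tau @^-1` S) //.
by rewrite -[_ @^-1` _]setTI; exact: measurable_funPT.
Qed.

Lemma tau_preimage_eq0 (S : set nat) :
  (forall j, S j -> m [set y | tau y = j] = 0%E) -> m [set y | S (tau y)] = 0%E.
Proof.
move=> S0; apply: measure_negligible; first exact: measurable_tau_preimage.
apply: (@negligibleS _ _ _ _ (\bigcup_j [set y | S j /\ tau y = j])).
  by move=> y Sy; exists (tau y).
apply: negligible_bigcup => j; have [Sj|nSj] := pselect (S j).
  apply: (@negligibleS _ _ _ _ [set y | tau y = j]); first by move=> y [].
  apply/negligibleP; last exact: S0.
  exact: (measurable_tau_preimage [set j]).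
by apply: (@negligibleS _ _ _ _ set0); [move=> y []|exact: negligible_set0].
Qed.

(** If the period were 0, it would divide only 0, and all positive values of [tau] would have
    measure 0. *)
Lemma period_gt0 : (0 < d)%N.
Proof.
rewrite lt0n; apply/eqP => d0; have [dj _] := nt_period nt; rewrite d0 in dj.
have : m [set: Y] = 0%E.
  rewrite (_ : [set: Y] = [set y | [set j | 1 <= j]%N (tau y)]).
    apply: tau_preimage_eq0 => j j1.
    apply/eqP; rewrite eq_le measure_ge0 andbT leNgt; apply/negP => mj.
    by have := dj j (conj j1 mj); rewrite dvd0n => /eqP j0; rewrite j0 in j1.
  by apply/seteqP; split => // y _ /=; exact: ltn_trans (tau_gt1 y).
by rewrite probability_setT => /eqP; rewrite eqe oner_eq0.
Qed.

Lemma period_data_neq0 : exists i, i \in I.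
Proof.
apply: contrapT => noI; have [_ _ [_ gI] _] := nt_data nt.
have : (0 %| d)%N by apply: gI => j jI; case: noI; exists j.
by rewrite dvd0n => /eqP d0; have := period_gt0; rewrite d0.
Qed.

Lemma period_dvd i : i \in I -> (d %| i)%N.
Proof. by move=> iI; have [_ _ [dI _] _] := nt_data nt; exact: dI. Qed.

Lemma max_data_gt0 : (0 < \max_(i <- I) i)%N.
Proof.
have [i iI] := period_data_neq0; have [_ I0 _ _] := nt_data nt.
exact: leq_trans (I0 i iI) (@leq_bigmax_seq _ _ xpredT id i iI isT).
Qed.

Lemma period_le_max : (d <= \max_(i <- I) i)%N.
Proof.
have [i iI] := period_data_neq0; have [_ I0 _ _] := nt_data nt.
apply: leq_trans (dvdn_leq (I0 i iI) (period_dvd iI)) _.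
exact: (@leq_bigmax_seq _ _ xpredT id i iI isT).
Qed.

Lemma reduced_data_gcd :
  is_gcd [set i | i \in [seq (k %/ d)%N | k <- I]] 1.
Proof.
split=> [j _|e eI]; first exact: dvd1n.
have [_ _ [_ gI] _] := nt_data nt.
rewrite -(@dvdn_pmul2r d) ?period_gt0// mul1n; apply: gI => j jI.
rewrite -(divnK (period_dvd jI)) dvdn_pmul2r ?period_gt0//.
by apply: eI; apply/mapP; exists j.
Qed.

Lemma reduced_data_itv N : (\max_(i <- I) i <= N)%N ->
  forall i, i \in [seq (k %/ d)%N | k <- I] -> (0 < i <= N)%N.
Proof.
move=> IN i /mapP[j jI ->]; have [_ I0 _ _] := nt_data nt.
rewrite divn_gt0 ?period_gt0// (dvdn_leq (I0 j jI) (period_dvd jI))/=.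
apply: leq_trans (leq_div _ _) _; apply: leq_trans IN.
exact: (@leq_bigmax_seq _ _ xpredT id j jI isT).
Qed.

(** Combined with the tail bound at n = 1, this gives the sign of [Ctau]. *)
Lemma tau_ge1_measure : m [set y | (1 <= tau y)%N] = 1%E.
Proof.
rewrite (_ : [set _ | _] = setT) ?probability_setT//.
by apply/seteqP; split => // y _ /=; exact: ltn_trans (tau_gt1 y).
Qed.

Let Nd : set Y := [set y | ~~ (d %| tau y)%N].

Let mNd : measurable Nd.
Proof. exact: (measurable_tau_preimage [set j | ~~ (d %| j)%N]). Qed.

Let Nd0 : m Nd = 0%E.
Proof.
have [dj _] := nt_period nt.
apply: (@tau_preimage_eq0 [set j | ~~ (d %| j)%N]) => j /= dNj.
apply/eqP; rewrite eq_le measure_ge0 andbT leNgt; apply/negP => mj.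
move/negP: (dNj); apply; apply: dj; split => //.
by rewrite lt0n; apply/eqP => j0; rewrite j0 dvdn0 in dNj.
Qed.

Lemma tau_bar_ge1 : 1 <= tau_bar m tau.
Proof.
have [t0 ti _] := rt.
have tI : (\int[m]_y (tau y)%:R%:E = (tau_bar m tau)%:E)%E.
  by rewrite /tau_bar /Rintegral fineK//; exact: integrable_fin_num.
rewrite -lee_fin -tI.
apply: (@le_trans _ _ (\int[m]_y (cst 1%E y))%E).
  by rewrite integral_cst// mul1e -(@probability_setT _ _ _ m).
apply: ge0_le_integral => //; first exact: measurable_int ti.
by move=> y _; rewrite lee_fin ler1n t0.
Qed.

Let mphi : measurable_fun setT phi.
Proof. by have := nt_Lfun nt; rewrite inE => /andP[]; rewrite inE. Qed.

Let mF : measurable_fun setT F. Proof. by case: (ue_nonsingular ue). Qed.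

Let mD1 : m_Delta m tau (Delta tau) = 1%E.
Proof.
rewrite -(m_Delta_probability rt).
by rewrite [LHS]m_DeltaE [RHS]m_DeltaE setIid setTI.
Qed.

(** The trivial bound, which covers n = 0 in the exponential case. *)
Lemma transfer_sum_bounded n :
  (\int[m_Delta m tau]_(x in Delta tau)
     (`|\sum_(0 <= k < d) iter (n * d + k) L phi x|)%:E <=
   d%:R%:E * holder_norm tau dY eta phi)%E.
Proof.
have [psi [mpsi psi1 ->]] := transfer_sum_norm mF (nt_transfer nt) (nt_Lfun nt) d n.
have [r [r0 -> phir _]] := holder_norm_real.
have -> : (d%:R%:E * r%:E = \sum_(0 <= k < d) r%:E)%E.
  by rewrite sumEFin -EFinM sumr_const_nat subn0 mulr_natl.
apply: lee_sum => k _.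
have mDelta := measurable_Delta tau.
have mg : measurable_fun setT (fun x => phi x * psi (iter (n * d + k) (tower_map tau F) x)).
  apply: measurable_funM => //; apply: measurableT_comp => //.
  exact: measurable_iter_tower_map.
apply: le_trans (lee_abs _) _.
apply: le_trans (le_abse_integral _ _ _) _ => //.
  by apply/measurable_EFinP; exact: measurable_funTS.
apply: (@le_trans _ _ (\int[m_Delta m tau]_(x in Delta tau) (cst r%:E x))%E).
  apply: ge0_le_integral => //.
    by apply/measurable_EFinP/measurableT_comp => //; exact: measurable_funTS.
  move=> x Dx; rewrite lee_fin normrM -[leRHS]mulr1.
  by rewrite ler_pM// phir.
by rewrite integral_cst// mD1 mule1.
Qed.

Variables (H del : R) (h : nat -> R) (Q v0 : nat) (rate : nat -> R).
Hypothesis H_ge1 : 1 <= H.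
Hypothesis H1_le : K + H * lambda^-1 `^ eta + 1 <= H.
Hypothesis del_itv : 0 < del <= 1.
Hypothesis del_le : del <= delta.
Hypothesis h_tail : forall k n,
  \sum_(i < n) fine (m [set y | (k + i.+1 <= tau y)%N]) <= h k.
Hypothesis h0 : 1 <= h 0.
Hypothesis hQ : expR H * h Q <= 1 / 2.
Hypothesis v0P : forall v, (v0 <= v)%N ->
  nsemigroup [seq (k %/ d)%N | k <- I] v.
Hypothesis rateP : forall n, 2 <= rate n \/
  exists2 r, n = (r + delay Q v0)%N &
  forall w : nat -> R, (forall s, 0 <= w s) ->
    \sum_(0 <= s < r.+1) w s <= 1 ->
    (forall k, \sum_(k.+1 <= s < r.+1) w s <= 4 * expR H * h k) ->
    8 * expR H * h r +
      (1 - tower_drop H del Q v0) * \sum_(0 <= s < r.+1) w s * rate (r - s)%N <= rate n.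

Theorem transfer_sum_rate n :
  (\int[m_Delta m tau]_(x in Delta tau)
     (`|\sum_(0 <= k < d) iter (n.+1 * d + k) L phi x|)%:E <=
   (6 * d%:R * (rate n.+1 + rate n))%:E * holder_norm tau dY eta phi)%E.
Proof.
have [psi [mpsi psi1 ->]] := transfer_sum_norm mF (nt_transfer nt) (nt_Lfun nt) d n.+1.
have [r [r0 -> phir phih]] := holder_norm_real.
have tb1 := tau_bar_ge1.
have bphi : tower_bounded tau phi by split => //; exists r.
have mean0 : \int[m]_y (\sum_(l < tau y) phi (y, \val l)) = 0.
  have := nt_mean nt; rewrite (m_Delta_integral rt bphi) => /eqP.
  rewrite eqe mulf_eq0 invr_eq0 => /orP[/eqP t0|/eqP//].
  by move: tb1; rewrite t0 ler10.
have bg k : tower_bounded tau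
    (fun x => phi x * psi (iter (n.+1 * d + k) (tower_map tau F) x)).
  split.
    apply: measurable_funM => //; apply: measurableT_comp => //.
    exact: measurable_iter_tower_map.
  by exists r => x Dx; rewrite normrM -[leRHS]mulr1 ler_pM// phir.
rewrite (eq_bigr _ (fun k _ => m_Delta_integral rt (bg k))) sumEFin -mulr_sumr.
have [data0 I0 _ Idel] := nt_data nt.
rewrite -EFinM; set c := 6 * d%:R * _; rewrite lee_fin.
(* [tower_estimate] takes a positive bound on [phi], while the norm [r] may be 0; hence [r + e],
   with [e] tending to 0 at the end. *)
have est e : 0 < e -> `|\sum_(0 <= k < d) \int[m]_y (\sum_(l < tau y)
    phi (y, \val l) * psi (iter (n.+1 * d + k) (tower_map tau F) (y, \val l)))|
    <= (r + e) * (6 * d%:R * (rate n.+1 + rate n) * tau_bar m tau).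
  move=> e0.
  have re0 : 0 < r + e by rewrite ltr_wpDl.
  have dNd y : ~ Nd y -> (d %| tau y)%N by move/negP; rewrite negbK.
  have Idel' i : i \in I -> (del%:E <= m [set y | tau y = i])%E.
    by move=> iI; apply: le_trans (Idel i iI); rewrite lee_fin.
  have phire x : Delta tau x -> `|phi x| <= r + e.
    by move=> Dx; rewrite (le_trans (phir x Dx))// lerDl ltW.
  have phihe y y' l : Delta tau (y, l) -> Delta tau (y', l) ->
      `|phi (y, l) - phi (y', l)| <= (r + e) * dY y y' `^ eta.
    move=> Dy Dy'; apply: le_trans (phih y y' l Dy Dy') _.
    by rewrite ler_wpM2r ?powR_ge0// lerDl ltW.
  have := tower_estimate ue rt period_gt0 mNd Nd0 dNd H_ge1 H1_le del_itv I0
    period_dvd Idel' h_tail h0 hQ v0P rateP mphi re0 phire phihe mpsi psi1 n mean0.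
  rewrite (_ : 6 * (r + e) * d%:R * _ * _ =
    (r + e) * (6 * d%:R * (rate n.+1 + rate n) * tau_bar m tau)) => [//|]; ring.
have c0 : 0 <= c.
  by rewrite /c !mulr_ge0// addr_ge0//; apply: rate_ge0 h_tail rateP _.
have tb0 : 0 < tau_bar m tau by exact: lt_le_trans tb1.
rewrite mulrC ler_pdivrMr//.
apply: le_trans (ler_norm _) _; apply/ler_addgt0Pl => e e0.
have ct0 : 0 <= c * tau_bar m tau by rewrite mulr_ge0// ltW.
have e'0 : 0 < e / (c * tau_bar m tau + 1) by rewrite divr_gt0// ltr_wpDl.
apply: le_trans (est _ e'0) _; rewrite -/c mulrDl addrC.
rewrite (_ : c * r * _ = r * (c * tau_bar m tau)); last by ring.
by rewrite lerD2r mulrAC ler_pdivrMr ?ltr_wpDl// ler_wpM2l ?ltW// ltrDl.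
Qed.

End nonmixing_tower.

(** * Uniform constants *)

Section box_constants.
Context {R : realType}.
Implicit Types (b g x : R) (N : nat).

Lemma ler_powR_base_lt1 u x y : 0 < u <= 1 -> x <= y -> u `^ y <= u `^ x :> R.
Proof.
move=> /andP[u0 u1] xy; rewrite /powR gt_eqF// ler_expR.
by rewrite ler_wnM2r// -ln1 ler_ln ?posrE.
Qed.

(** H solves H q + N + 1 = H, where q = (1 + 1/N)^(-1/N) is the weakest contraction occurring in the
    box. *)
Lemma box_expansion N : (0 < N)%N -> exists2 H : R, 1 <= H &
  forall lambda K eta, 1 + N%:R^-1 <= lambda -> K <= N%:R -> N%:R^-1 <= eta ->
  K + H * lambda^-1 `^ eta + 1 <= H.
Proof.
move=> N0; have Np : 0 < N%:R^-1 :> R by rewrite invr_gt0 ltr0n.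
pose u : R := (1 + N%:R^-1)^-1.
have u0 : 0 < u by rewrite invr_gt0 addr_gt0.
have u1 : u < 1 by rewrite invf_lt1 ?addr_gt0// ltrDl.
pose q := u `^ N%:R^-1.
have q1 : q < 1.
  by rewrite /q /powR gt_eqF// -[ltRHS]expR0 ltr_expR pmulr_rlt0// ln_lt0// u0.
have q0 : 0 <= q := powR_ge0 _ _.
have sq0 : 0 < 1 - q by rewrite subr_gt0.
pose H := (N%:R + 1) / (1 - q).
have H1 : 1 <= H.
  rewrite /H ler_pdivlMr// mul1r; have := ler0n R N; lra.
exists H => // lambda K eta lamN KN etaN.
have lam0 : 0 < lambda by apply: lt_le_trans lamN; rewrite addr_gt0.
have lu : lambda^-1 <= u by rewrite /u lef_pV2 ?posrE ?addr_gt0.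
have lq : lambda^-1 `^ eta <= q.
  apply: (@le_trans _ _ (u `^ eta)).
    by apply: powR_le => //; [exact: le_trans (ltW Np) etaN|rewrite invr_ge0 ltW].
  by apply: ler_powR_base_lt1 => //; rewrite u0 ltW.
have Hq : H * lambda^-1 `^ eta <= H * q by rewrite ler_wpM2l// (le_trans _ H1).
have HE : H * q + (N%:R + 1) = H.
  have -> : N%:R + 1 = H * (1 - q) by rewrite /H divfK// gt_eqF.
  by ring.
lra.
Qed.

Lemma powR_large (C : R) N : (0 < N)%N -> exists2 Q, (0 < Q)%N &
  forall g, N%:R^-1 <= g -> C <= Q%:R `^ g.
Proof.
move=> N0; pose C1 := Num.max 1 C.
have C11 : 1 <= C1 by rewrite le_max lexx.
have C10 : 0 <= C1 by exact: le_trans C11.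
pose Q := Num.bound (C1 ^+ N).
have QC : C1 ^+ N < Q%:R by apply: archi_boundP; rewrite exprn_ge0.
have Q1 : 1 <= Q%:R :> R by apply: le_trans (ltW QC); rewrite exprn_ege1.
exists Q => [|g gN]; first by rewrite -(ler1n R) in Q1 *.
apply: (@le_trans _ _ C1); first by rewrite le_max lexx orbT.
apply: (@le_trans _ _ (Q%:R `^ N%:R^-1)); last by rewrite ler_powR.
have CN : (C1 ^+ N) `^ N%:R^-1 = C1.
  by rewrite -powR_mulrn// -powRrM mulfV ?powRr1// pnatr_eq0 -lt0n.
rewrite -[leLHS]CN; apply: powR_le; rewrite ?invr_ge0 ?exprn_ge0//.
exact: ltW.
Qed.

(** Follows from ln(1 - 1/(x+1)) <= -1/(x+1) and e^t >= 1 + t. *)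
Lemma powRN_telescope b x : 0 <= b -> 0 < x ->
  b * (x + 1) `^ (- (b + 1)) <= x `^ (- b) - (x + 1) `^ (- b).
Proof.
move=> b0 x0; have y0 : 0 < x + 1 by rewrite addr_gt0.
have lnx : ln x <= ln (x + 1) - (x + 1)^-1.
  rewrite [X in ln X <= _](_ : x = (x + 1) * (1 - (x + 1)^-1)); last first.
    by field; rewrite gt_eqF.
  rewrite lnM ?posrE//; last by rewrite subr_gt0 invf_lt1// ltrDr.
  rewrite lerD2l; apply: le_ln1Dx.
  by rewrite ltrN2 invf_lt1// ltrDr.
have yb : (x + 1) `^ (- b) * (1 + b / (x + 1)) <= x `^ (- b).
  rewrite [leRHS]/powR gt_eqF//.
  apply: (@le_trans _ _ (expR (- b * ln (x + 1) + b / (x + 1)))).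
    by rewrite expRD {1}/powR gt_eqF// ler_wpM2l ?expR_ge0// expR_ge1Dx.
  by rewrite ler_expR -subr_ge0; nra.
rewrite lerBrDr addrC; apply: le_trans yb; rewrite mulrDr mulr1 lerD2l.
rewrite opprD powRD ?powR_inv1 ?(ltW y0)//; first by rewrite mulrCA.
by apply/implyP => _; rewrite gt_eqF.
Qed.

(** The first term is at most (k+1)^(-b), and the others telescope up to the factor 1/b <= N:
    together N + 1. *)
Lemma poly_tail b N k n : (0 < N)%N -> N%:R^-1 <= b ->
  \sum_(i < n) (k + i.+1)%:R `^ (- (b + 1)) <= (N.+1)%:R * k.+1%:R `^ (- b).
Proof.
move=> N0 bN; have Np : 0 < N%:R^-1 :> R by rewrite invr_gt0 ltr0n.
have b0 : 0 < b by exact: lt_le_trans bN.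
case: n => [|n]; first by rewrite big_ord0 mulr_ge0// powR_ge0.
suff : \sum_(i < n.+1) (k + i.+1)%:R `^ (- (b + 1)) <=
    (N.+1)%:R * k.+1%:R `^ (- b) - N%:R * (k + n.+1)%:R `^ (- b).
  by move/le_trans; apply; rewrite gerBl mulr_ge0// powR_ge0.
elim: n => [|n IH].
  rewrite big_ord1 addn1 -[N.+1%:R]natr1 mulrDl mul1r addrAC subrr add0r.
  by rewrite ler_powR ?ler1n// lerN2 lerDl.
rewrite big_ord_recr /=.
have := @powRN_telescope b (k + n.+1)%:R (ltW b0) _.
rewrite natr1 !addnS ltr0n => /(_ isT) tel.
set u := _ `^ _ in tel; set v := _ `^ _ in tel; set w := _ `^ _ in tel.
have : u <= N%:R * (v - w).
  rewrite -ler_pdivrMl ?ltr0n//; apply: le_trans tel.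
  by rewrite ler_wpM2r// powR_ge0.
move: IH; rewrite mulrBr.
rewrite !addnS -/u -/v -/w; lra.
Qed.

(** With a = 1/(2N) one has A >= 2 a, and k + i + 1 dominates both k and i + 1. Half of the exponent
    is kept for k and the other half makes the sum over i converge. *)
Lemma exp_tail N : (0 < N)%N -> exists2 c : R, 0 < c &
  forall A g k n, N%:R^-1 <= A -> N%:R^-1 <= g <= 1 ->
  \sum_(i < n) expR (- (A * (k + i.+1)%:R `^ g)) <=
  c * expR (- ((2 * N%:R)^-1 * k%:R `^ g)).
Proof.
move=> N0; have Np : 0 < N%:R :> R by rewrite ltr0n.
pose a : R := (2 * N%:R)^-1.
have a0 : 0 < a by rewrite invr_gt0 mulr_gt0.
have aN : N%:R^-1 = 2 * a by rewrite /a; field; rewrite gt_eqF.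
pose c1 := ((2 * N)%:R / a) ^+ (2 * N).
have c10 : 0 < c1 by rewrite exprn_gt0// divr_gt0// ltr0n muln_gt0.
have small i g : N%:R^-1 <= g -> expR (- (a * i.+1%:R `^ g)) <= c1 * (i.+1%:R ^+ 2)^-1.
  move=> gN; pose z : R := i.+1%:R `^ N%:R^-1.
  have z0 : 0 < z by rewrite powR_gt0.
  have zg : z <= i.+1%:R `^ g by rewrite ler_powR// ler1n.
  have -> : i.+1%:R ^+ 2 = z ^+ (2 * N) :> R.
    rewrite mulnC exprM; congr (_ ^+ 2).
    by rewrite -powR_mulrn ?powR_ge0// -powRrM mulVf ?gt_eqF// powRr1.
  apply: (@le_trans _ _ (expR (- (a * z)))).
    by rewrite ler_expR lerN2 ler_wpM2l// ltW.
  have := @expRN_le R (2 * N).-1 (a * z) (mulr_gt0 a0 z0).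
  rewrite prednK ?muln_gt0//; move/le_trans; apply.
  by rewrite /c1 -exprVn -exprMn invfM mulrA.
exists (c1 * 2) => [|A g k n AN /andP[gN g1]]; first by rewrite mulr_gt0.
have g0 : 0 <= g by apply: le_trans gN; rewrite invr_ge0 ltW.
set E := expR _.
apply: (@le_trans _ _ (\sum_(i < n) E * (c1 * (i.+1%:R ^+ 2)^-1))).
  apply: ler_sum => i _.
  apply: (@le_trans _ _ (E * expR (- (a * i.+1%:R `^ g)))); last first.
    by rewrite ler_wpM2l ?expR_ge0// small.
  rewrite /E -expRD ler_expR -/a.
  have kk : k%:R `^ g <= (k + i.+1)%:R `^ g :> R.
    by apply: powR_le => //; rewrite ler_nat leq_addr.
  have ii : i.+1%:R `^ g <= (k + i.+1)%:R `^ g :> R.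
    by apply: powR_le => //; rewrite ler_nat leq_addl.
  have AA : 2 * a * (k + i.+1)%:R `^ g <= A * (k + i.+1)%:R `^ g.
    by rewrite ler_wpM2r ?powR_ge0// -aN.
  have := ler_wpM2l (ltW a0) kk; have := ler_wpM2l (ltW a0) ii; lra.
rewrite -mulr_sumr -mulr_sumr mulrC ler_wpM2r ?expR_ge0// ler_wpM2l ?(ltW c10)//.
case: n => [|n]; first by rewrite big_ord0.
rewrite big_ord_recl /= expr1n invr1.
have := @sum_inv_square R 1 n.+1 isT; rewrite invr1 => sq.
rewrite (_ : 2 = 1 + 1 :> R)// lerD2l; apply: le_trans sq.
by rewrite big_add1 /= big_add1 /= big_mkord.
Qed.

Lemma tower_drop_itv (H del : R) Q v0 : 1 <= H -> 0 < del <= 1 ->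
  0 < tower_drop H del Q v0 <= 1 / 4.
Proof.
move=> H1 del_itv; have /andP[m0 m2] := tower_minor_itv H1.
have /andP[t0 t1] := tower_hit_itv H1 del_itv.
have p0 := exprn_gt0 (delay Q v0) t0.
have p1 := exprn_ile1 (delay Q v0) (ltW t0) t1.
rewrite /tower_drop; set p := _ ^+ _ in p0 p1 *.
have q0 : 0 < (2 * Q.+1%:R)^-1 :> R by rewrite invr_gt0 mulr_gt0.
have q2 : (2 * Q.+1%:R)^-1 <= 1 / 2 :> R.
  by rewrite invfM div1r ler_piMr// invf_le1// ler1n.
rewrite !mulr_gt0//=.
have pq : p / (2 * Q.+1%:R) <= 1 / 2.
  by apply: le_trans q2; rewrite ler_piMl// ltW.
have -> : (1 / 4 : R) = 1 / 2 * (1 / 2) by field.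
by rewrite ler_pM// ltW// mulr_gt0.
Qed.

End box_constants.

Section boxes.
Context {R : realType}.

Lemma measure_tail_sum (dsp : measure_display) (Y : measurableType dsp)
    (m : probability Y R) (tau : {mfun Y >-> nat}) (t : nat -> R) k n :
  (forall n, (0 < n)%N -> (m [set y | (n <= tau y)%N] <= (t n)%:E)%E) ->
  \sum_(i < n) fine (m [set y | (k + i.+1 <= tau y)%N]) <=
  \sum_(i < n) t (k + i.+1)%N.
Proof.
move=> tP; apply: ler_sum => i _.
have mt : measurable [set y | (k + i.+1 <= tau y)%N].
  by rewrite addnS; exact: measurable_tau_gt.
rewrite -lee_fin fineK; first by apply: tP; rewrite addnS.
by rewrite fin_num_measure.
Qed.

Lemma holder_norm_ge0 (dsp : measure_display) (Y : measurableType dsp)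
    (m : probability Y R) F dY alpha zeta (lambda K eta : R)
    (tau : {mfun Y >-> nat}) d I delta L phi :
  nonmixing_tower m F dY alpha zeta lambda K eta tau d I delta L phi ->
  (0 <= holder_norm tau dY eta phi)%E.
Proof. by move=> /holder_norm_real[r [r0 -> _ _]]; rewrite lee_fin. Qed.

(** The order of the choices matters: H, [v0], [del], [Ch], [Q] and the constant of the rate are
    obtained from N alone, and only then is the tower introduced. *)
Lemma poly_box (N : nat) : (0 < N)%N -> exists2 C : R, 0 < C &
  forall (dsp : measure_display) (Y : measurableType dsp) (m : probability Y R)
    F dY alpha zeta (lambda K eta : R) (tau : {mfun Y >-> nat}) d I delta L phi
    (beta Ctau : R),
  nonmixing_tower m F dY alpha zeta lambda K eta tau d I delta L phi ->
  1 + N%:R^-1 <= lambda -> K <= N%:R -> N%:R^-1 <= eta ->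
  (\max_(i <- I) i <= N)%N -> N%:R^-1 <= delta ->
  1 + N%:R^-1 <= beta <= N%:R -> Ctau <= N%:R ->
  (forall n : nat, (0 < n)%N ->
    (m [set y | (n <= tau y)%N] <= (Ctau * n%:R `^ (- beta))%:E)%E) ->
  forall n : nat, (1 <= n)%N ->
    (\int[m_Delta m tau]_(x in Delta tau)
       (`|\sum_(0 <= k < d) iter (n * d + k) L phi x|%R)%:E <=
     C%:E * holder_norm tau dY eta phi * (n%:R `^ (- (beta - 1)))%:E)%E.
Proof.
move=> N0; have Np : 0 < N%:R :> R by rewrite ltr0n.
have N1 : 1 <= N%:R :> R by rewrite ler1n.
have [H H1 HP] := @box_expansion R N N0.
have [v0 v0P] := nsemigroup_cofinite_uniform N.
pose del : R := N%:R^-1.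
have del_itv : 0 < del <= 1 by rewrite invr_gt0 Np invf_le1.
pose Ch : R := N%:R * N.+1%:R.
have Ch1 : 1 <= Ch by rewrite /Ch -natrM ler1n muln_gt0 N0.
have [Q Q0 QP] := @powR_large R (2 * expR H * Ch) N N0.
have expH1 : 1 <= expR H by rewrite -[leLHS]expR0 ler_expR (le_trans _ H1).
have [C C0 CP] := @poly_rate R (expR H) (tower_drop H del Q v0) Ch (delay Q v0) N
  expH1 (tower_drop_itv Q v0 H1 del_itv) (le_trans ler01 Ch1).
(* The 6 of [transfer_sum_rate], doubled because the rates at n and n + 1 are both at most C
   (n+1)^(-b), with d <= N. *)
exists (12 * N%:R * C); first by rewrite !mulr_gt0.
move=> dsp Y m F dY alpha zeta lambda K eta tau d I delta L phi beta Ctau nt.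
move=> lamN KN etaN IN delN /andP[bN1 bN] CtN tailP [//|n] _.
pose b := beta - 1.
have bge : N%:R^-1 <= b by rewrite /b lerBrDl.
have b0 : 0 <= b by apply: le_trans bge; rewrite invr_ge0 ltW.
have b0N : 0 <= b <= N%:R by rewrite b0 /b lerBlDr (le_trans bN)// lerDl.
have Ct0 : 0 <= Ctau.
  have := tailP 1%N isT; rewrite (tau_ge1_measure nt) powR1 mulr1 lee_fin.
  exact: le_trans.
have htail k j : \sum_(i < j) fine (m [set y | (k + i.+1 <= tau y)%N]) <=
    Ch * k.+1%:R `^ (- b).
  apply: le_trans (measure_tail_sum k j tailP) _; rewrite -mulr_sumr.
  have := poly_tail k j N0 bge; rewrite (_ : b + 1 = beta) ?subrK// => pt.
  rewrite /Ch -mulrA; apply: (le_trans (ler_wpM2l Ct0 pt)).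
  by rewrite ler_wpM2r// mulr_ge0// powR_ge0.
have hQ : expR H * (Ch * Q.+1%:R `^ (- b)) <= 1 / 2.
  have := QP b bge; have QS : Q%:R `^ b <= Q.+1%:R `^ b :> R.
    by apply: powR_le => //; rewrite ler_nat.
  move=> /le_trans /(_ QS) big.
  rewrite powRN mulrA ler_pdivrMr ?powR_gt0//; lra.
have v0P' := v0P _ (reduced_data_itv nt IN) (reduced_data_gcd nt).
have := transfer_sum_rate nt H1 (HP _ _ _ lamN KN etaN) del_itv delN
  htail _ hQ v0P' (CP b b0N) n.
rewrite powR1 mulr1 => /(_ Ch1) /le_trans; apply.
rewrite muleAC lee_wpmul2r ?(holder_norm_ge0 nt)//.
rewrite -EFinM lee_fin.
set q := n.+1%:R `^ _; have q0 : 0 <= q := powR_ge0 _ _.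
have r1 : Num.min 2 (C * q) <= C * q by rewrite ge_min lexx orbT.
have r2 : Num.min 2 (C * n.+2%:R `^ (- b)) <= C * q.
  rewrite ge_min ler_wpM2l ?orbT ?(ltW C0)//.
  by apply: powRN_le; rewrite // ler_nat.
have dN : d%:R <= N%:R :> R by rewrite ler_nat (leq_trans (period_le_max nt)).
rewrite (_ : 12 * _ * _ * _ = 6 * N%:R * (C * q + C * q)); last by ring.
apply: (@le_trans _ _ (6 * d%:R * (C * q + C * q))).
  by rewrite ler_wpM2l ?mulr_ge0// lerD.
by rewrite ler_wpM2r ?addr_ge0 ?mulr_ge0 ?(ltW C0)// ler_wpM2l.
Qed.

Lemma exp_box (N : nat) : (0 < N)%N -> exists B C : R, [/\ 0 < B, 0 < C &
  forall (dsp : measure_display) (Y : measurableType dsp) (m : probability Y R)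
    F dY alpha zeta (lambda K eta : R) (tau : {mfun Y >-> nat}) d I delta L phi
    (A gamma Ctau : R),
  nonmixing_tower m F dY alpha zeta lambda K eta tau d I delta L phi ->
  1 + N%:R^-1 <= lambda -> K <= N%:R -> N%:R^-1 <= eta ->
  (\max_(i <- I) i <= N)%N -> N%:R^-1 <= delta ->
  N%:R^-1 <= A -> N%:R^-1 <= gamma <= 1 -> Ctau <= N%:R ->
  (forall n : nat, (0 < n)%N ->
    (m [set y | (n <= tau y)%N] <=
      (Ctau * expR (- (A * n%:R `^ gamma)))%:E)%E) ->
  forall n : nat,
    (\int[m_Delta m tau]_(x in Delta tau)
       (`|\sum_(0 <= k < d) iter (n * d + k) L phi x|%R)%:E <=
     C%:E * holder_norm tau dY eta phi * (expR (- (B * n%:R `^ gamma)))%:E)%E].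
Proof.
move=> N0; have Np : 0 < N%:R :> R by rewrite ltr0n.
have N1 : 1 <= N%:R :> R by rewrite ler1n.
have [H H1 HP] := @box_expansion R N N0.
have [v0 v0P] := nsemigroup_cofinite_uniform N.
pose del : R := N%:R^-1.
have del_itv : 0 < del <= 1 by rewrite invr_gt0 Np invf_le1.
have [c c0 cP] := @exp_tail R N N0.
pose a : R := (2 * N%:R)^-1.
have a0 : 0 < a by rewrite invr_gt0 mulr_gt0.
pose Ch : R := Num.max 1 (N%:R * c).
have Ch1 : 1 <= Ch by rewrite le_max lexx.
have ChN : N%:R * c <= Ch by rewrite le_max lexx orbT.
have Ch0 : 0 < Ch by exact: lt_le_trans Ch1.
have [Q Q0 QP] := @powR_large R (2 * expR H * Ch / a) N N0.
have expH1 : 1 <= expR H by rewrite -[leLHS]expR0 ler_expR (le_trans _ H1).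
have [C [kappa [C0 /andP[kappa0 kappaa] CP]]] :=
  @exp_rate R (expR H) (tower_drop H del Q v0) Ch a (delay Q v0) N
  expH1 (tower_drop_itv Q v0 H1 del_itv) (ltW Ch0) a0 N0.
(* The factor e^kappa pays for the rate at n when the bound is stated at n + 1. The [N%:R] added to
   [Cn] below is for n = 0. *)
pose Cn := 12 * N%:R * C * expR kappa.
have Cn0 : 0 < Cn by rewrite !mulr_gt0// expR_gt0.
exists kappa, (Cn + N%:R); split => //; first by rewrite addr_gt0.
move=> dsp Y m F dY alpha zeta lambda K eta tau d I delta L phi A g Ctau nt.
move=> lamN KN etaN IN delN AN gN CtN tailP n.
have /andP[gN' g1] := gN.
have g0 : 0 < g by apply: lt_le_trans gN'; rewrite invr_gt0.
have dN : d%:R <= N%:R :> R by rewrite ler_nat (leq_trans (period_le_max nt)).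
case: n => [|n].
  apply: le_trans (transfer_sum_bounded nt 0) _.
  rewrite powR0 ?gt_eqF// mulr0 oppr0 expR0 mule1.
  by rewrite lee_wpmul2r ?(holder_norm_ge0 nt)// lee_fin ler_wpDl// ltW.
have Ct0 : 0 <= Ctau.
  have := tailP 1%N isT; rewrite (tau_ge1_measure nt) powR1 mulr1 lee_fin.
  by rewrite -ler_pdivrMr ?expR_gt0//; apply: le_trans; rewrite div1r invr_ge0 expR_ge0.
have htail k j : \sum_(i < j) fine (m [set y | (k + i.+1 <= tau y)%N]) <=
    Ch * expR (- (a * k%:R `^ g)).
  apply: le_trans (measure_tail_sum k j tailP) _; rewrite -mulr_sumr.
  apply: (le_trans (ler_wpM2l Ct0 (cP A g k j AN gN))); rewrite mulrA.
  rewrite ler_wpM2r ?expR_ge0//; apply: le_trans ChN.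
  by rewrite ler_wpM2r// ltW.
have h0 : 1 <= Ch * expR (- (a * 0%:R `^ g)).
  by rewrite powR0 ?gt_eqF// mulr0 oppr0 expR0 mulr1.
have hQ : expR H * (Ch * expR (- (a * Q%:R `^ g))) <= 1 / 2.
  have big := QP g gN'; rewrite ler_pdivrMr// in big.
  set z := Q%:R `^ g in big *; have z0 : 0 < z by rewrite powR_gt0// ltr0n.
  have := @expRN_le R 0 (a * z) (mulr_gt0 a0 z0); rewrite expr1 => ez.
  apply: (@le_trans _ _ (expR H * (Ch * (1 / (a * z))))).
    by rewrite ler_wpM2l ?expR_ge0// ler_wpM2l// ltW.
  rewrite !mulrA mulr1 ler_pdivrMr ?mulr_gt0//; move: big; rewrite -/a.
  lra.
have v0P' := v0P _ (reduced_data_itv nt IN) (reduced_data_gcd nt).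
have CnE : Cn = 12 * N%:R * C * expR kappa by [].
clearbody Cn Ch a.
have := transfer_sum_rate nt H1 (HP _ _ _ lamN KN etaN) del_itv delN
  htail h0 hQ v0P' (CP g gN) n.
move=> /le_trans; apply.
rewrite muleAC lee_wpmul2r ?(holder_norm_ge0 nt)//.
rewrite -EFinM lee_fin.
set q := expR _ ; have q0 : 0 <= q := expR_ge0 _.
have r2 : C * expR (- (kappa * n%:R `^ g)) <= C * (expR kappa * q).
  rewrite ler_wpM2l ?(ltW C0)// /q -expRD ler_expR -natr1.
  have := powR_subadd (_ : 0 < g <= 1) (ler0n R n) ler01.
  rewrite g0 g1 powR1 => /(_ isT) sub.
  have := ler_wpM2l (ltW kappa0) sub; lra.
have r1 : C * q <= C * (expR kappa * q).
  by rewrite ler_wpM2l ?(ltW C0)// ler_peMl// -[leLHS]expR0 ler_expR ltW.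
apply: (@le_trans _ _ (Cn * q)); last by rewrite ler_wpM2r// lerDl ltW.
rewrite (_ : Cn * q = 6 * N%:R * (C * (expR kappa * q) + C * (expR kappa * q))); last first.
  by rewrite CnE; ring.
apply: (@le_trans _ _ (6 * d%:R * (C * (expR kappa * q) + C * (expR kappa * q)))).
  by rewrite ler_wpM2l ?mulr_ge0// lerD.
by rewrite ler_wpM2r ?addr_ge0 ?mulr_ge0 ?expR_ge0 ?(ltW C0)// ler_wpM2l.
Qed.

End boxes.

(** * Continuous dependence on the parameters *)

Section continuous_majorant.
Context {R : realType}.
Variable c : nat -> R.
Hypothesis c0 : forall k, 0 < c k.

(** A ramp, 0 up to k - 2 and 1 from k - 1 on: near any point only finitely many are nonzero, and
    for x >= 0 the one of index [(Num.truncn x).+1] is already 1 at x. *)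
Let hat (k : nat) (x : R) : R := Num.max 0 (Num.min 1 (x - k%:R + 2)).

Let partial (n : nat) (x : R) : R := \sum_(0 <= k < n) c k * hat k x.

(* Only the hats of index less than [x + 2] contribute at [x]. *)
Definition majorant (x : R) : R := partial (Num.truncn x).+4 x.

Let hat_ge0 k x : 0 <= hat k x. Proof. by rewrite le_max lexx. Qed.

Let partial_stable n n' x : x + 2 <= n%:R -> (n <= n')%N ->
  partial n' x = partial n x.
Proof.
move=> xn nn'; rewrite /partial (@big_cat_nat _ _ _ n)//= [X in _ + X]big1_seq ?addr0// => k.
rewrite mem_index_iota => /andP[_ /andP[nk _]]; rewrite (_ : hat k x = 0) ?mulr0//.
have nk' : n%:R <= k%:R :> R by rewrite ler_nat.
by rewrite /hat max_l// ge_min; apply/orP; right; lra.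
Qed.

Let partial_eq n n' x : x + 2 <= n%:R -> x + 2 <= n'%:R ->
  partial n x = partial n' x.
Proof.
move=> xn xn'; have [nn'|/ltnW nn'] := leqP n n'.
  by rewrite (partial_stable xn).
by rewrite (partial_stable xn').
Qed.

Let hat_continuous k : continuous (hat k : R -> R).
Proof.
move=> x; apply: (@continuous_max R R (fun=> 0) _ x); first exact: cvg_cst.
apply: (@continuous_min R R (fun=> 1) _ x); first exact: cvg_cst.
apply: cvgD; last exact: cvg_cst.
by apply: cvgB; [exact: cvg_id|exact: cvg_cst].
Qed.

Let partial_continuous n : continuous (partial n).
Proof.
move=> x; elim: n => [|n IH].
  rewrite (_ : partial 0 = fun=> 0); first exact: cvg_cst.
  by apply/funext => y; rewrite /partial big_geq.
rewrite (_ : partial n.+1 = fun y => partial n y + c n * hat n y); last first.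
  by apply/funext => y; rewrite /partial big_nat_recr.
apply: cvgD => //; apply: cvgM; first exact: cvg_cst.
exact: hat_continuous.
Qed.

Lemma majorant_continuous : continuous majorant.
Proof.
(* With this margin one partial sum represents [majorant] on the whole neighbourhood y < x + 1. *)
move=> x; pose n := (Num.truncn x).+4.
have maj y : y < x + 1 -> majorant y = partial n y.
  move=> yx; have := truncnS_gt x; have := truncnS_gt y.
  rewrite -!natr1 => ty tx.
  by apply: partial_eq; rewrite -!natr1; lra.
have x1 : x < x + 1 by rewrite ltrDl.
rewrite /continuous_at (maj x x1); apply: cvg_trans (@partial_continuous n x).
apply: near_eq_cvg; near=> y; apply/esym/maj.
by near: y; exact: (open_nbhs_nbhs (conj (@open_lt _ _) x1)).
Unshelve. all: by end_near. Qed.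

Lemma majorant_ge x : 0 <= x -> c (Num.truncn x).+1 <= majorant x.
Proof.
move=> x0.
have xn : (Num.truncn x).+1 \in index_iota 0 (Num.truncn x).+4.
  by rewrite mem_index_iota; lia.
rewrite /majorant /partial (bigD1_seq _ xn (iota_uniq _ _))/=.
rewrite (_ : hat _ _ = 1) ?mulr1; last first.
  have : (Num.truncn x)%:R <= x by rewrite truncn_le.
  by rewrite /hat -natr1 => tx; rewrite min_l; [rewrite max_r|lra].
by rewrite lerDl; apply: sumr_ge0 => k _; rewrite mulr_ge0// ltW.
Qed.

Lemma majorant_gt0 x : 0 <= x -> 0 < majorant x.
Proof. by move=> /majorant_ge; exact: lt_le_trans. Qed.

End continuous_majorant.

(** * Sizes of the parameters and their continuity *)

Section parameters.
Context {R : realType}.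

(* The sizes below bound the parameters and the inverses of their distances to
   the excluded values. *)
Definition expansion_size (lambda K eta : R) (M : nat) (delta Ctau : R) : R :=
  lambda + (lambda - 1)^-1 + K + eta^-1 + M%:R + delta^-1 + Ctau.

Definition poly_size (p : R * R * R * nat * R * R * R) : R :=
  let: (lambda, K, eta, M, delta, beta, Ctau) := p in
  expansion_size lambda K eta M delta Ctau + (beta + (beta - 1)^-1).

Definition exp_size (p : R * R * R * nat * R * R * R * R) : R :=
  let: (lambda, K, eta, M, delta, A, gamma, Ctau) := p in
  expansion_size lambda K eta M delta Ctau + (A^-1 + gamma^-1).

Lemma natr_continuous : continuous (fun n : nat => n%:R : R).
Proof.
move=> n A /nbhs_singleton An.
apply: (@filterS _ (nbhs n) _ [set n]) (discrete_set1 n).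
by move=> k ->.
Qed.

Lemma continuous_fst (S A B : topologicalType) (x : S) (f : S -> A * B) :
  {for x, continuous f} -> {for x, continuous (fun t => (f t).1)}.
Proof.
move=> cf; apply: (@continuous_comp _ _ _ f fst x cf).
by case: (f x) => a b; exact: cvg_fst.
Qed.

Lemma continuous_snd (S A B : topologicalType) (x : S) (f : S -> A * B) :
  {for x, continuous f} -> {for x, continuous (fun t => (f t).2)}.
Proof.
move=> cf; apply: (@continuous_comp _ _ _ f snd x cf).
by case: (f x) => a b; exact: cvg_snd.
Qed.

Section continuity.
Variables (T : topologicalType) (x : T).
Variables (lambda K eta delta Ctau : T -> R) (M : T -> nat).
Hypotheses (lambda_c : {for x, continuous lambda}) (K_c : {for x, continuous K})
  (eta_c : {for x, continuous eta}) (delta_c : {for x, continuous delta})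
  (Ctau_c : {for x, continuous Ctau}) (M_c : {for x, continuous M}).

Lemma expansion_size_continuous :
  1 < lambda x -> 0 < eta x -> 0 < delta x ->
  {for x, continuous (fun t =>
    expansion_size (lambda t) (K t) (eta t) (M t) (delta t) (Ctau t))}.
Proof.
move=> lam1 eta0 delta0; rewrite /expansion_size.
apply: cvgD => //; apply: cvgD; last by apply: cvgV => //; rewrite gt_eqF.
apply: cvgD; last first.
  exact: (@cvg_comp _ _ _ M (fun n : nat => n%:R : R) _ _ _ M_c (@natr_continuous (M x))).
apply: cvgD; last by apply: cvgV => //; rewrite gt_eqF.
apply: cvgD => //; apply: cvgD => //; apply: cvgV.
  by rewrite gt_eqF// subr_gt0.
by apply: cvgB => //; exact: cvg_cst.
Qed.

End continuity.

Lemma poly_size_continuous : {in @poly_params R, continuous poly_size}.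
Proof.
move=> p; rewrite inE; case: p => [[[[[[lambda K] eta] M] delta] beta] Ctau] /=.
move=> [[lam1 K0 /andP[eta0 eta1]] [M0 delta0 beta1 Ctau0]].
pose p := (lambda, K, eta, M, delta, beta, Ctau); rewrite -/p.
have c1 : {for p, continuous (fun p => p.1)} by exact: cvg_fst.
have c2 := continuous_fst c1.
have c3 := continuous_fst c2.
have c4 := continuous_fst c3.
have c5 := continuous_fst c4.
rewrite (_ : poly_size = fun p => expansion_size p.1.1.1.1.1.1 p.1.1.1.1.1.2
    p.1.1.1.1.2 p.1.1.1.2 p.1.1.2 p.2 + (p.1.2 + (p.1.2 - 1)^-1)); last first.
  by apply/funext => -[[[[[[? ?] ?] ?] ?] ?] ?].
have cs : {for p, continuous (fun p => p.2)} by exact: cvg_snd.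
have cb := continuous_snd c1.
apply: cvgD; first exact: (expansion_size_continuous (continuous_fst c5)
  (continuous_snd c5) (continuous_snd c4) (continuous_snd c2) cs
  (continuous_snd c3) lam1 eta0 delta0).
apply: cvgD => //; apply: cvgV; first by rewrite gt_eqF// subr_gt0.
by apply: cvgB => //; exact: cvg_cst.
Qed.

Lemma exp_size_continuous : {in @exp_params R, continuous exp_size}.
Proof.
move=> p; rewrite inE.
case: p => [[[[[[[lambda K] eta] M] delta] A] gamma] Ctau] /=.
move=> [[lam1 K0 /andP[eta0 eta1]] [M0 delta0 A0 /andP[gamma0 gamma1] Ctau0]].
pose p := (lambda, K, eta, M, delta, A, gamma, Ctau); rewrite -/p.
have c1 : {for p, continuous (fun p => p.1)} by exact: cvg_fst.
have c2 := continuous_fst c1.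
have c3 := continuous_fst c2.
have c4 := continuous_fst c3.
have c5 := continuous_fst c4.
have c6 := continuous_fst c5.
rewrite (_ : exp_size = fun p => expansion_size p.1.1.1.1.1.1.1 p.1.1.1.1.1.1.2
    p.1.1.1.1.1.2 p.1.1.1.1.2 p.1.1.1.2 p.2 + (p.1.1.2^-1 + p.1.2^-1)); last first.
  by apply/funext => -[[[[[[[? ?] ?] ?] ?] ?] ?] ?].
have cs : {for p, continuous (fun p => p.2)} by exact: cvg_snd.
apply: cvgD; first exact: (expansion_size_continuous (continuous_fst c6)
  (continuous_snd c6) (continuous_snd c5) (continuous_snd c3) cs
  (continuous_snd c4) lam1 eta0 delta0).
apply: cvgD; apply: cvgV; rewrite ?gt_eqF//.
  exact: continuous_snd c2.
exact: continuous_snd c1.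
Qed.

Lemma invr_le_nat (x : R) N : 0 < x -> x^-1 <= N%:R -> N%:R^-1 <= x.
Proof.
move=> x0 xN; rewrite -[leRHS]invrK lef_pV2 ?posrE ?invr_gt0//.
by apply: lt_le_trans xN; rewrite invr_gt0.
Qed.

Lemma expansion_size_box lambda K eta M delta Ctau N :
  1 < lambda -> 0 < K -> 0 < eta -> 0 < delta -> 0 < Ctau ->
  expansion_size lambda K eta M delta Ctau <= N%:R ->
  [/\ 1 + N%:R^-1 <= lambda, K <= N%:R & N%:R^-1 <= eta] /\
  [/\ (M <= N)%N, N%:R^-1 <= delta & Ctau <= N%:R].
Proof.
move=> lam1 K0 eta0 delta0 Ctau0; rewrite /expansion_size.
have lam0 : 0 < lambda - 1 by rewrite subr_gt0.
have := ler0n R M; have : 0 < (lambda - 1)^-1 by rewrite invr_gt0.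
have : 0 < eta^-1 by rewrite invr_gt0.
have : 0 < delta^-1 by rewrite invr_gt0.
move=> d0 e0 l0 m0 le; split; split; [|lra| | | |lra].
- by rewrite -lerBrDl; apply: invr_le_nat => //; lra.
- by apply: invr_le_nat => //; lra.
- by rewrite -(ler_nat R); lra.
- by apply: invr_le_nat => //; lra.
Qed.

Lemma expansion_size_ge0 lambda K eta M delta Ctau :
  1 < lambda -> 0 < K -> 0 < eta -> 0 < delta -> 0 < Ctau ->
  0 <= expansion_size lambda K eta M delta Ctau.
Proof.
move=> lam1 K0 eta0 delta0 Ctau0; rewrite /expansion_size.
rewrite !addr_ge0// ?invr_ge0 ?subr_ge0 ?(ltW K0) ?(ltW eta0) ?(ltW delta0) ?(ltW Ctau0) ?(ltW lam1)//.
by rewrite (le_trans ler01)// ltW.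
Qed.

Lemma poly_size_ge0 p : poly_params p -> 0 <= poly_size p.
Proof.
case: p => [[[[[[lambda K] eta] M] delta] beta] Ctau] /=.
move=> [[lam1 K0 /andP[eta0 _]] [M0 delta0 beta1 Ctau0]].
rewrite addr_ge0 ?expansion_size_ge0// addr_ge0 ?invr_ge0 ?subr_ge0 ?(ltW beta1)//.
by rewrite (le_trans ler01)// ltW.
Qed.

Lemma exp_size_ge0 p : exp_params p -> 0 <= exp_size p.
Proof.
case: p => [[[[[[[lambda K] eta] M] delta] A] gamma] Ctau] /=.
move=> [[lam1 K0 /andP[eta0 _]] [M0 delta0 A0 /andP[gamma0 _] Ctau0]].
by rewrite addr_ge0 ?expansion_size_ge0// addr_ge0// invr_ge0 ltW.
Qed.

End parameters.

Theorem theorem2p8 (R : realType) :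
  (exists C : R * R * R * nat * R * R * R -> R,
    [/\ forall p, poly_params p -> 0 < C p,
        {within @poly_params R, continuous C} &
        forall (dsp : measure_display) (Y : measurableType dsp)
          (m : probability Y R) (F : Y -> Y) (dY : Y -> Y -> R)
          (alpha : set (set Y)) (zeta : Y -> R) (lambda K eta : R)
          (tau : {mfun Y >-> nat}) (d : nat) (I : seq nat) (delta : R)
          (L : (Y * nat -> R) -> (Y * nat -> R)) (phi : Y * nat -> R)
          (beta Ctau : R),
        uniformly_expanding m F dY alpha zeta lambda K eta ->
        return_time m tau alpha ->
        nonmixing tau alpha ->
        is_period m tau d ->
        period_data m tau d I delta ->
        transfer_operator m tau F L ->
        phi \in Lfun (m_Delta m tau) 1%E ->
        (holder_norm tau dY eta phi < +oo)%E ->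
        (\int[m_Delta m tau]_(x in Delta tau) (phi x)%:E = 0)%E ->
        1 < beta ->
        (forall n : nat, (0 < n)%N ->
          (m [set y | (n <= tau y)%N] <= (Ctau * n%:R `^ (- beta))%:E)%E) ->
        forall n : nat, (1 <= n)%N ->
          (\int[m_Delta m tau]_(x in Delta tau)
              (`|\sum_(0 <= k < d) iter (n * d + k) L phi x|%R)%:E <=
            (C (lambda, K, eta, (\max_(i <- I) i)%N, delta, beta, Ctau))%:E *
            holder_norm tau dY eta phi *
            (n%:R `^ (- (beta - 1)))%:E)%E])
  /\
  (exists B C : R * R * R * nat * R * R * R * R -> R,
    [/\ forall p, exp_params p -> 0 < B p /\ 0 < C p,
        {within @exp_params R, continuous B},
        {within @exp_params R, continuous C} &
        forall (dsp : measure_display) (Y : measurableType dsp)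
          (m : probability Y R) (F : Y -> Y) (dY : Y -> Y -> R)
          (alpha : set (set Y)) (zeta : Y -> R) (lambda K eta : R)
          (tau : {mfun Y >-> nat}) (d : nat) (I : seq nat) (delta : R)
          (L : (Y * nat -> R) -> (Y * nat -> R)) (phi : Y * nat -> R)
          (A gamma Ctau : R),
        uniformly_expanding m F dY alpha zeta lambda K eta ->
        return_time m tau alpha ->
        nonmixing tau alpha ->
        is_period m tau d ->
        period_data m tau d I delta ->
        transfer_operator m tau F L ->
        phi \in Lfun (m_Delta m tau) 1%E ->
        (holder_norm tau dY eta phi < +oo)%E ->
        (\int[m_Delta m tau]_(x in Delta tau) (phi x)%:E = 0)%E ->
        0 < A ->
        0 < gamma <= 1 ->
        (forall n : nat, (0 < n)%N ->
          (m [set y | (n <= tau y)%N] <=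
            (Ctau * expR (- (A * n%:R `^ gamma)))%:E)%E) ->
        forall n : nat,
          (\int[m_Delta m tau]_(x in Delta tau)
              (`|\sum_(0 <= k < d) iter (n * d + k) L phi x|%R)%:E <=
            (C (lambda, K, eta, (\max_(i <- I) i)%N, delta, A, gamma, Ctau))%:E *
            holder_norm tau dY eta phi *
            (expR (- (B (lambda, K, eta, (\max_(i <- I) i)%N, delta,
                         A, gamma, Ctau) * n%:R `^ gamma)))%:E)%E]).
Proof.
split.
(* Index N stands for the box N + 1, which keeps the size of the box positive. *)
- pose c N := s2val (cid2 (@poly_box R N.+1 isT)).
  have c0 N : 0 < c N by rewrite /c; case: cid2.
  exists (fun p => majorant c (poly_size p)); split.
  + by move=> p /poly_size_ge0 /(majorant_gt0 c0).
  + apply: continuous_in_subspaceT => p pp.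
    apply: continuous_comp; first exact: poly_size_continuous.
    exact: majorant_continuous.
  move=> dsp Y m F dY alpha zeta lambda K eta tau d I delta L phi beta Ctau.
  move=> ue rt nm ip pd top phi1 hn mean beta1 tailP n n1.
  have nt := Build_nonmixing_tower ue rt nm ip pd top phi1 hn mean.
  set p := (lambda, _, _, _, _, _, _).
  have lam1 := ue_lambda ue; have K0 := ue_K ue.
  have /andP[eta0 eta1] := ue_eta ue; have [del0 _ _ _] := pd.
  have Ctau0 : 0 < Ctau.
    have := tailP 1%N isT; rewrite (tau_ge1_measure nt) powR1 mulr1 lee_fin.
    exact: lt_le_trans.
  have pp : poly_params p.
    by rewrite /p /=; split; split => //; [rewrite eta0|exact: max_data_gt0 nt].
  have p0 := poly_size_ge0 pp.
  have cN := majorant_ge c0 p0.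
  (* [cN] is about the index truncn + 1, that is the box truncn + 2, and the parameters lie in that
     box. *)
  have pN : poly_size p <= (Num.truncn (poly_size p)).+2%:R.
    by rewrite -natr1 (le_trans (ltW (truncnS_gt _)))// lerDl.
  move: (Num.truncn _) (majorant c _) cN pN => N Cp; rewrite {pp p0}/p /= => cN pN.
  have be : 0 < beta - 1 by rewrite subr_gt0.
  have bei : 0 < (beta - 1)^-1 by rewrite invr_gt0.
  have es0 := expansion_size_ge0 (\max_(i <- I) i)%N lam1 K0 eta0 del0 Ctau0.
  have eN : expansion_size lambda K eta (\max_(i <- I) i) delta Ctau <= N.+2%:R.
    by apply: le_trans pN; rewrite lerDl addr_ge0 ?(ltW bei)//; lra.
  have [[lamN KN etaN] [MN delN CN]] :=
    expansion_size_box lam1 K0 eta0 del0 Ctau0 eN.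
  have bN : 1 + N.+2%:R^-1 <= beta <= N.+2%:R.
    apply/andP; split; last lra.
    by rewrite -lerBrDl; apply: invr_le_nat => //; lra.
  move: cN; rewrite /c; case: cid2 => C C0 CP cN.
  have := CP _ _ _ _ _ _ _ _ _ _ _ _ _ _ _ _ _ _
    nt lamN KN etaN MN delN bN CN tailP n n1.
  move=> /le_trans; apply; rewrite lee_wpmul2r ?lee_fin ?powR_ge0//.
  by rewrite lee_wpmul2r ?(holder_norm_ge0 nt)// lee_fin.
- have [b bP] := choice (fun N => @exp_box R N.+1 isT).
  have [c cP] := choice bP.
  have b0 N : 0 < (b N)^-1 by rewrite invr_gt0; case: (cP N).
  have c0 N : 0 < c N by case: (cP N).
  (* The exponent has to stay below those of the boxes, so their inverses are majorised and the
     result is inverted. *)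
  exists (fun p => (majorant (fun N => (b N)^-1) (exp_size p))^-1).
  exists (fun p => majorant c (exp_size p)); split.
  + move=> p /exp_size_ge0 p0; rewrite invr_gt0.
    by split; exact: majorant_gt0.
  + apply: continuous_in_subspaceT => p pp.
    apply: cvgV.
      by rewrite gt_eqF// majorant_gt0//; apply: exp_size_ge0; rewrite inE in pp.
    apply: (@continuous_comp _ _ _ exp_size); first exact: exp_size_continuous.
    exact: majorant_continuous.
  + apply: continuous_in_subspaceT => p pp.
    apply: continuous_comp; first exact: exp_size_continuous.
    exact: majorant_continuous.
  move=> dsp Y m F dY alpha zeta lambda K eta tau d I delta L phi A gamma Ctau.
  move=> ue rt nm ip pd top phi1 hn mean A0 gamma01 tailP n.
  have nt := Build_nonmixing_tower ue rt nm ip pd top phi1 hn mean.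
  set p := (lambda, _, _, _, _, _, _, _).
  have lam1 := ue_lambda ue; have K0 := ue_K ue.
  have /andP[eta0 eta1] := ue_eta ue; have [del0 _ _ _] := pd.
  have /andP[gamma0 gamma1] := gamma01.
  have Ctau0 : 0 < Ctau.
    have := tailP 1%N isT; rewrite (tau_ge1_measure nt) lee_fin.
    move=> /(lt_le_trans ltr01).
    by rewrite pmulr_lgt0// expR_gt0.
  have pp : exp_params p.
    rewrite /p /=; split; split => //; first by rewrite eta0.
    exact: max_data_gt0 nt.
  have p0 := exp_size_ge0 pp.
  have bN := majorant_ge b0 p0; have cN := majorant_ge c0 p0.
  have pN : exp_size p <= (Num.truncn (exp_size p)).+2%:R.
    by rewrite -natr1 (le_trans (ltW (truncnS_gt _)))// lerDl.
  move: cN bN pN; move: (majorant c _) => Cp; move: (majorant _ _) => Bp.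
  move: (Num.truncn _) => N; rewrite {pp p0}/p /= => cN bN pN.
  have Ai : 0 < A^-1 by rewrite invr_gt0.
  have gi : 0 < gamma^-1 by rewrite invr_gt0.
  have es0 := expansion_size_ge0 (\max_(i <- I) i)%N lam1 K0 eta0 del0 Ctau0.
  have eN : expansion_size lambda K eta (\max_(i <- I) i) delta Ctau <= N.+2%:R.
    by apply: le_trans pN; rewrite lerDl addr_ge0// ltW.
  have [[lamN KN etaN] [MN delN CN]] :=
    expansion_size_box lam1 K0 eta0 del0 Ctau0 eN.
  have AN : N.+2%:R^-1 <= A by apply: invr_le_nat => //; lra.
  have gN : N.+2%:R^-1 <= gamma <= 1.
    by rewrite gamma1 andbT; apply: invr_le_nat => //; lra.
  have [bp cp CP] := cP N.+1.
  have := CP _ _ _ _ _ _ _ _ _ _ _ _ _ _ _ _ _ _ _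
    nt lamN KN etaN MN delN AN gN CN tailP n.
  have hn0 := holder_norm_ge0 nt.
  move=> /le_trans; apply.
  apply: (@le_trans _ _ (Cp%:E * holder_norm tau dY eta phi *
      (expR (- (b N.+1 * n%:R `^ gamma)))%:E)%E).
    by rewrite lee_wpmul2r ?lee_fin ?expR_ge0// lee_wpmul2r// lee_fin.
  have Cp0 : 0 <= Cp by apply: le_trans cN; exact: ltW.
  rewrite lee_wpmul2l ?mule_ge0// lee_fin ler_expR lerN2.
  rewrite ler_wpM2r ?powR_ge0// -[leRHS]invrK lef_pV2 ?posrE//.
  exact: lt_le_trans bN.
Qed.
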